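(* For each $n\ge 1$ let $d_1^{(n)},\dots,d_n^{(n)}$ be a degree sequence of positive integers with even total degree $D^{(n)}=d_1^{(n)}+\cdots+d_n^{(n)}$. Suppose that $\min_{i\in[n]} d_i^{(n)}\gg\sqrt{D^{(n)}/n}$ as $n\to\infty$, i.e. $\min_{i} d_i^{(n)}/\sqrt{D^{(n)}/n}\to\infty$. Let $M^{(n)}$ be the normalized Laplacian matrix of the configuration model with this degree sequence. Then for every fixed positive integer $k$, $$\lim_{n\to\infty}\frac1n\,\mathbb{E}\big[\operatorname{Tr}\big((M^{(n)})^k\big)\big]=\begin{cases} C_{k/2} & k \text{ even},\\ 0 & k\text{ odd},\end{cases}$$ where $C_m=\frac{1}{m+1}\binom{2m}{m}$ is the $m$-th Catalan number. Moreover, the empirical eigenvalue distribution $\mu_n$ of $M^{(n)}$ converges weakly in probability to the semicircle distribution $\rho_{\rm sc}$; that is, for every bounded continuous $f:\mathbb{R}\to\mathbb{R}$ and every $\varepsilon>0$, $\mathbb{P}\big(|\int f\,d\mu_n-\int f\,d\rho_{\rm sc}|>\varepsilon\big)\to0$ as $n\to\infty$.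
   Context: Configuration model: given positive integers $d_1,\dots,d_n$ with $D=d_1+\cdots+d_n$ even, vertex $v_i$ carries $d_i$ half-edges labelled $1,\dots,d_i$; a uniformly random perfect matching of all $D$ half-edges is chosen, giving a random multigraph (self-loops and multi-edges allowed). For $1\le s\le d_i$, $1\le t\le d_j$, let $H_{ij}^{st}$ be the indicator that the $s$-th half-edge of $v_i$ is matched with the $t$-th half-edge of $v_j$ (so $H_{ii}^{ss}=0$). The adjacency matrix is $A_{ij}=\sum_{s=1}^{d_i}\sum_{t=1}^{d_j}H_{ij}^{st}$. Normalized Laplacian: with $\Delta=\operatorname{diag}(d_1,\dots,d_n)$, $M=\sqrt{D/n}\;\Delta^{-1/2}\big(A-[\tfrac{d_id_j}{D-1}]_{i,j}\big)\Delta^{-1/2}$, i.e. $M_{ij}=\sqrt{D/n}\,\frac{1}{\sqrt{d_id_j}}\big(A_{ij}-\frac{d_id_j}{D-1}\big)$. Superscript $(n)$ indicates dependence on $n$. The empirical eigenvalue distribution is $\mu_n=\frac1n\sum_{i=1}^n\delta_{\lambda_i}$ with $\lambda_i$ the eigenvalues of $M^{(n)}$. The semicircle distribution $\rho_{\rm sc}$ has density $\frac{1}{2\pi}\sqrt{4-x^2}$ on $[-2,2]$. *)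

(* Defs.v *)
From HB Require Import structures.
From mathcomp Require Import all_boot all_order all_algebra.
From mathcomp Require Import polyrcf complex spectral.
From mathcomp Require Import all_classical all_reals all_analysis.
From mathcomp Require Import measurable_realfun.
Set Implicit Arguments.
Unset Strict Implicit.
Unset Printing Implicit Defensive.
Import Order.TTheory GRing.Theory Num.Theory.
Import numFieldNormedType.Exports.
Local Open Scope classical_set_scope.
Local Open Scope ring_scope.

Section ConfigurationModel.
Variables (n : nat) (d : 'I_n -> nat).

Definition total_degree : nat := (\sum_(i < n) d i)%N.

(* [minn] has no neutral element, so the fold is seeded with the maximum;
   for n > 0 the result is the minimum of the d i. *)
Definition min_degree : nat :=
  (\big[minn/(\max_(i < n) d i)]_(i < n) d i)%N.

Definition half_edge : finType := {i : 'I_n & 'I_(d i)}.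

Definition hedge (i : 'I_n) (s : 'I_(d i)) : half_edge :=
  Tagged (fun i => 'I_(d i)) s.

Definition perfect_matchings : {set {set {set half_edge}}} :=
  [set m : {set {set half_edge}} |
    finset.partition m [set: half_edge]%SET & [forall e in m, #|e| == 2%N]].

(* For i = j and s = t the pair below is a singleton, hence not in m. *)
Definition matched (m : {set {set half_edge}}) (i j : 'I_n)
    (s : 'I_(d i)) (t : 'I_(d j)) : bool :=
  [set hedge s; hedge t]%SET \in m.

(* A self-loop at i contributes 2 to the diagonal entry A i i. *)
Definition adjacency (m : {set {set half_edge}}) (i j : 'I_n) : nat :=
  (\sum_(s < d i) \sum_(t < d j) matched m s t)%N.

Variable R : realType.

Definition normalized_laplacian (m : {set {set half_edge}}) : 'M[R]_n :=
  \matrix_(i, j)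
    (Num.sqrt (total_degree%:R / n%:R) * (Num.sqrt ((d i)%:R * (d j)%:R))^-1
     * ((adjacency m i j)%:R
        - (d i)%:R * (d j)%:R / (total_degree%:R - 1))).

Definition expectation_cm (X : {set {set half_edge}} -> R) : R :=
  (\sum_(m in perfect_matchings) X m) / #|perfect_matchings|%:R.

Definition prob_cm (E : pred {set {set half_edge}}) : R :=
  #|[set m in perfect_matchings | E m]%SET|%:R / #|perfect_matchings|%:R.

End ConfigurationModel.

Arguments normalized_laplacian {n d} R m.
Arguments expectation_cm {n} d {R} X.
Arguments prob_cm {n} d R E.

Section SpectralDistribution.
Variable R : realType.

(* The roots of the characteristic polynomial in R, listed with multiplicity;
   a symmetric matrix has exactly n of them (eigenvalues_sym). *)
Definition eigenvalues n (A : 'M[R]_n) : seq R :=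
  flatten [seq nseq (mup x (char_poly A)) x | x <- rootsR (char_poly A)].

Lemma char_poly_sym n (A : 'M[R]_n) : A^T = A ->
  exists2 s : seq R, size s = n & char_poly A = \prod_(x <- s) ('X - x%:P).
Proof.
move=> sA; pose f := real_complex R; pose B := map_mx f A.
have hB : B \is hermsymmx.
  apply/is_hermitianmxP; rewrite expr0 scale1r; apply/matrixP => i j.
  by rewrite !mxE -{1}sA mxE; apply/esym/CrealP/complex_realP; exists (A j i).
have /mxOverP rB := hermitian_spectral_diag_real hB.
pose s := [seq complex.Re (spectral_diag B 0 i) | i <- enum 'I_n].
exists s; first by rewrite size_map size_enum_ord.
apply: (map_inj_poly (f := f)) => [x y []//||]; first exact: rmorph0.
rewrite map_char_poly -/B rmorph_prod/= big_map big_enum/=.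
set P := spectralmx B; set D := spectral_diag B.
have uP : P \in unitmx := spectral_unit B.
have -> : char_poly B = char_poly (diag_mx D).
  have {1}-> : B = invmx P *m diag_mx D *m P.
    exact/orthomx_spectralP/hermitian_normalmx.
  rewrite /char_poly /char_poly_mx.
  have -> : 'X%:M - map_mx polyC (invmx P *m diag_mx D *m P) =
      map_mx polyC (invmx P) *m ('X%:M - map_mx polyC (diag_mx D)) *m
      map_mx polyC P.
    rewrite !map_mxM mulmxBr mulmxBl; congr (_ - _).
    by rewrite scalar_mxC -mulmxA -map_mxM mulVmx// map_mx1 mulmx1.
  rewrite !det_mulmx mulrAC -det_mulmx -map_mxM mulVmx// map_mx1 det1.
  by rewrite mul1r.
rewrite char_poly_trig ?diag_mx_is_trig//; apply: eq_bigr => i _.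
rewrite rmorphB/= map_polyX map_polyC/= mxE eqxx mulr1n.
by congr (_ - _%:P); apply/esym/RRe_real.
Qed.

Lemma eigenvalues_sym n (A : 'M[R]_n) : A^T = A ->
  size (eigenvalues A) = n /\
  char_poly A = \prod_(x <- eigenvalues A) ('X - x%:P).
Proof.
move=> /char_poly_sym[s ss es].
suff ps : perm_eq (eigenvalues A) s.
  by rewrite (perm_size ps) ss (perm_big _ ps).
rewrite -(permPr (perm_count_undup s)) /eigenvalues.
under eq_map do rewrite es mu_prod_XsubC.
apply/perm_flatten/perm_map/uniq_perm.
- exact: uniq_roots.
- exact: undup_uniq.
move=> x; rewrite mem_undup -(root_prod_XsubC s) -es.
by rewrite -roots_on_rootsR ?monic_neq0 ?char_poly_monic// in_itv.
Qed.

Definition empirical_spectral_distribution n (A : 'M[R]_n) :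
    {measure set (measurableTypeR R) -> \bar R} :=
  mscale (n%:R^-1)%:nng
    (msum (fun i => \d_((eigenvalues A)`_i : measurableTypeR R)) n).

(* Num.sqrt vanishes on negative reals, so this is 0 outside [-2, 2]. *)
Definition semicircle_pdf (x : R) : R := (pi *+ 2)^-1 * Num.sqrt (4 - x ^+ 2).

Definition semicircle (V : set (measurableTypeR R)) : \bar R :=
  (\int[lebesgue_measure]_(x in V) (semicircle_pdf x)%:E)%E.

Let semicircle_pdf_ge0 x : 0 <= semicircle_pdf x.
Proof. by rewrite mulr_ge0 ?sqrtr_ge0// invr_ge0 mulrn_wge0// pi_ge0. Qed.

Let measurable_semicircle_pdf :
  measurable_fun [set: measurableTypeR R] semicircle_pdf.
Proof.
apply: measurable_funM; first exact: measurable_cst.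
apply: continuous_measurable_fun => x.
apply: continuous_comp; last exact: sqrt_continuous.
by apply: cvgB; [exact: cvg_cst|exact: exprn_continuous].
Qed.

Let semicircle0 : semicircle set0 = 0%E.
Proof. by rewrite /semicircle integral_set0. Qed.

Let semicircle_ge0 V : (0 <= semicircle V)%E.
Proof. by apply: integral_ge0 => x _; rewrite lee_fin. Qed.

Let semicircle_sigma_additive : semi_sigma_additive semicircle.
Proof.
move=> F mF tF mUF; rewrite /semicircle ge0_integral_bigcup//=.
- by apply: is_cvg_ereal_nneg_natsum_cond => k _ _; exact: semicircle_ge0.
- apply/measurable_EFinP; exact: measurable_funTS.
- by move=> x _; rewrite lee_fin.
Qed.

HB.instance Definition _ := isMeasure.Build _ _ _ semicircle
  semicircle0 semicircle_ge0 semicircle_sigma_additive.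

End SpectralDistribution.

Arguments semicircle R : clear implicits.

Definition catalan (R : realType) (m : nat) : R :=
  m.+1%:R^-1 * 'C(2 * m, m)%:R.

(* Main.v *)
(** Write the adjacency matrix as the sum of [u_x^T u_(f x)] over half-edges [x],
    where [f] is the random matching and [u_x = e_v / sqrt d_v] at the vertex [v]
    of [x].  The law of [f] is invariant under the switching that exchanges the
    partners of two half-edges, and a switching changes the matrix [M] by an
    explicit [Ediff] of rank two.  Exchangeability of [f] and of the switched
    matching turns [E tr (M F(M))] into a sum of [tr (Ediff (F(M') - F(M)))], as
    in Stein's method.  With [s = sqrt (D / n)] and [tau_k = tr (M ^ k) / n] this
    gives, first, bounds on [E tau_2k] that are uniform as soon as the degrees
    exceed [s], and then the approximate loop equation
      [E phi(tau_k+1) (tau_k+1 - sum_(i + j = k - 1) tau_i tau_j)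
        = O(s / min d + 1 / n)]
    for every bounded Lipschitz [phi].  Choosing [phi] as a truncation and using
    the Catalan recurrence, [tau_k] converges in L^1 to the [k]-th semicircle
    moment.  Weak convergence follows from polynomial approximation on [-3, 3],
    where the tails are controlled by a high even moment. *)
Require Import Defs.
From HB Require Import structures.
From mathcomp Require Import all_boot all_order all_algebra fingroup perm.
From mathcomp Require Import complex spectral ring lra zify.
From mathcomp Require Import all_classical all_reals all_analysis.
From mathcomp Require Import measurable_realfun.
Set Implicit Arguments.
Unset Strict Implicit.
Unset Printing Implicit Defensive.
Import Order.TTheory GRing.Theory Num.Theory.
Import numFieldNormedType.Exports.
Local Open Scope classical_set_scope.
Local Open Scope ring_scope.

(** * Powers of symmetric matrices *)

Section BilinearForm.
Variables (R : realType) (n : nat).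
Implicit Types (A B : 'M[R]_n) (p q z : 'rV[R]_n).

(** No operator norm is ever bounded: only diagonal entries of even powers are controlled, and only
    on average over vertices and matchings. Every error is therefore reduced to sums of such entries
    weighted by inverse degrees. Summed over pairs of half-edges, these weights produce the inverse
    degrees of neighbours, which is why [ell] must have bounded moments beforehand. The ratio
    [s / dmin] is the price of one switching beyond first order: each insertion of [Ediff] costs [s]
    times a product of two factors of size [dmin ^ (- 1/2)]. Two integrations by parts are used. The
    symmetric one ([lapm_Stein]) bounds a moment by the one two degrees lower through Young's
    inequality, with no a priori control. The one-sided one ([lapm_loop]) has a linear part that can
    be computed exactly. The test function is needed because the means of [tau_i tau_j] do not close
    into a recursion on the means of [tau_k]. Testing against a truncation of the error itself
    yields L^1 concentration without a variance estimate, and costs only O(1 / n), since a switching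
    has finite rank. *)

Definition bform A p q : R := (p *m A *m q^T) 0 0.

Lemma bformBl A p1 p2 q : bform A (p1 - p2) q = bform A p1 q - bform A p2 q.
Proof. by rewrite /bform !mulmxBl !mxE. Qed.

Lemma bformBr A p q1 q2 : bform A p (q1 - q2) = bform A p q1 - bform A p q2.
Proof. by rewrite /bform raddfB mulmxBr !mxE. Qed.

Lemma bformNr A p q : bform A p (- q) = - bform A p q.
Proof. by rewrite /bform raddfN mulmxN mxE. Qed.

Lemma bformNl A p q : bform A (- p) q = - bform A p q.
Proof. by rewrite /bform !mulNmx mxE. Qed.

Lemma bformDm A B p q : bform (A + B) p q = bform A p q + bform B p q.
Proof. by rewrite /bform mulmxDr mulmxDl mxE. Qed.

Lemma bformBm A B p q : bform (A - B) p q = bform A p q - bform B p q.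
Proof. by rewrite /bform mulmxBr mulmxBl !mxE. Qed.

Lemma bformZm a A p q : bform (a *: A) p q = a * bform A p q.
Proof. by rewrite /bform -scalemxAr -scalemxAl mxE. Qed.

Lemma bform_suml (I : finType) A (F : I -> 'rV[R]_n) q :
  bform A (\sum_i F i) q = \sum_i bform A (F i) q.
Proof. by rewrite /bform !mulmx_suml summxE. Qed.

Lemma bform_sumr (I : finType) A p (F : I -> 'rV[R]_n) :
  bform A p (\sum_i F i) = \sum_i bform A p (F i).
Proof. by rewrite /bform raddf_sum mulmx_sumr summxE. Qed.

Lemma bform_summ m (F : 'I_m -> 'M[R]_n) p q :
  bform (\sum_i F i) p q = \sum_i bform (F i) p q.
Proof. by rewrite /bform mulmx_sumr mulmx_suml summxE. Qed.

Lemma bformC A p q : A^T = A -> bform A p q = bform A q p.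
Proof.
move=> sA; rewrite /bform -[in LHS](trmxK (p *m A *m q^T)) mxE !trmx_mul.
by rewrite trmxK sA mulmxA.
Qed.

Lemma bform_outer A B p q w z :
  bform (A *m (p^T *m q) *m B) w z = bform A w p * bform B q z.
Proof.
rewrite /bform !mulmxA -(mulmxA _ q B) -(mulmxA _ (q *m B)) mxE big_ord1.
by [].
Qed.

Lemma mxtrace_outer A p q : \tr (p^T *m q *m A) = bform A q p.
Proof. by rewrite -mulmxA mxtrace_mulC /bform trace_mx11. Qed.

Lemma exprmx_sym A k : A^T = A -> (A ^+ k)^T = A ^+ k.
Proof.
move=> sA; elim: k => [|k IH]; first by rewrite expr0 trmx1.
by rewrite [in LHS]exprS -mulmxE trmx_mul IH sA mulmxE exprSr.
Qed.

Lemma exprmxS A k : A ^+ k.+1 = A *m A ^+ k.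
Proof. by rewrite exprS mulmxE. Qed.

Lemma exprmxD A i j : A ^+ (i + j) = A ^+ i *m A ^+ j.
Proof. by rewrite exprD mulmxE. Qed.

(** Noncommutative telescoping with the old matrix on the left and the new one on the right. A
    second application to the right factor isolates the part linear in [B - A]. *)
Lemma exprmx_diff A B k : B ^+ k - A ^+ k =
  \sum_(i < k) A ^+ i *m (B - A) *m B ^+ (k - i.+1).
Proof.
elim: k => [|k IH]; first by rewrite !expr0 subrr big_ord0.
rewrite big_ord_recl /= expr0 mul1mx subSS subn0.
under eq_bigr => i _.
  have -> : A ^+ bump 0 i *m (B - A) *m B ^+ (k.+1 - (bump 0 i).+1) =
    A *m (A ^+ i *m (B - A) *m B ^+ (k - i.+1)).
    by rewrite /bump /= add1n exprmxS subSS !mulmxA.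
  over.
rewrite -mulmx_sumr -IH mulmxBl mulmxBr !exprmxS.
by rewrite addrA addrNK.
Qed.

(** A Parseval frame computes traces as an orthonormal basis does; it is applied to the family
    [uvec], which has one vector per half-edge. *)
Lemma mxtrace_frame (I : finType) (c : I -> 'rV[R]_n) A :
  \sum_i (c i)^T *m (c i) = 1%:M -> \sum_i bform A (c i) (c i) = \tr A.
Proof.
move=> h; rewrite -[A in RHS]mul1mx -h mulmx_suml raddf_sum /=.
by apply: eq_bigr => i _; rewrite mxtrace_outer.
Qed.

End BilinearForm.

Section SpectralFrame.
Variables (R : realType) (n : nat) (A : 'M[R]_n).
Hypothesis sA : A^T = A.
Local Notation cplx := (real_complex R).
Local Notation conjC := Num.conj_op.

(* Real and imaginary parts of the coordinates of z in a unitary eigenbasis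
   are indexed by 'I_n * bool, which turns the complex spectral
   decomposition into a real (redundant) one. *)
Lemma spectral_frame : exists lam : 'I_n -> R,
  [/\ exists c : 'I_n * bool -> 'rV[R]_n -> R, forall j z w,
        bform (A ^+ j) z w = \sum_l lam l.1 ^+ j * (c l z * c l w),
      forall j, \tr (A ^+ j) = \sum_l lam l ^+ j &
      char_poly A = \prod_l ('X - (lam l)%:P)].
Proof.
pose B := map_mx cplx A.
have hB : B \is hermsymmx.
  apply/is_hermitianmxP; rewrite expr0 scale1r; apply/matrixP => i j.
  by rewrite !mxE -{1}sA mxE; apply/esym/CrealP/complex_realP; exists (A j i).
have /mxOverP rB := hermitian_spectral_diag_real hB.
set P := spectralmx B in rB *; set D := spectral_diag B in rB *.
have uP : P \in unitmx := spectral_unit B.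
have iP : invmx P = (map_mx conjC P^T) by exact/invmx_unitary/spectral_unitarymx.
have BE : B = invmx P *m diag_mx D *m P.
  exact/orthomx_spectralP/hermitian_normalmx.
clearbody P D.
pose lam l := complex.Re (D 0 l).
have lamE l : (lam l)%:C%C = D 0 l by apply: RRe_real.
have BX j : map_mx cplx (A ^+ j) =
    invmx P *m diag_mx (\row_l (lam l ^+ j)%:C%C) *m P.
  elim: j => [|j IH].
    rewrite expr0 map_mx1.
    have -> : diag_mx (\row_l (lam l ^+ 0)%:C%C) = 1%:M.
      by apply/matrixP => i k; rewrite !mxE expr0.
    by rewrite mulmx1 mulVmx.
  rewrite exprmxS map_mxM IH [map_mx cplx A]BE !mulmxA (mulmxK uP).
  congr (_ *m P); rewrite -mulmxA mulmx_diag; congr (_ *m diag_mx _).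
  apply/rowP => l.
  by rewrite !mxE -lamE -rmorphM /= exprS.
exists lam; split.
- pose c (l : 'I_n * bool) (z : 'rV[R]_n) :=
    let y := (map_mx cplx z *m invmx P) 0 l.1 in
    if l.2 then complex.Re y else complex.Im y.
  exists c => j z w.
  pose y (z : 'rV[R]_n) := map_mx cplx z *m invmx P.
  have yw : P *m (map_mx cplx w)^T = map_mx conjC (y w)^T.
    rewrite /y trmx_mul map_mxM iP; congr (_ *m _).
      apply/matrixP => i k; rewrite !mxE; exact/esym/conjCK.
    apply/matrixP => i k; rewrite !mxE.
    by apply/esym/CrealP/complex_realP; eexists.
  have E : cplx (bform (A ^+ j) z w) =
     \sum_l (lam l ^+ j)%:C%C * (y z 0 l * conjC (y w 0 l)).
    transitivity ((map_mx cplx (z *m A ^+ j *m w^T)) 0 0); first by rewrite mxE.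
    rewrite !map_mxM BX !mulmxA -/(y z) -mulmxA -map_trmx yw mxE.
    apply: eq_bigr => l _; rewrite mul_mx_diag !mxE.
    by rewrite mulrCA mulrA.
  transitivity (complex.Re (cplx (bform (A ^+ j) z w))) => //.
  rewrite E (big_morph _ (id1 := 0) (op1 := +%R)) => [||//]; last first.
    by case=> [a b] [a' b'].
  transitivity (\sum_l \sum_b lam l ^+ j * (c (l, b) z * c (l, b) w)); last first.
    by rewrite pair_bigA; apply: eq_bigr => -[].
  apply: eq_bigr => l _; rewrite big_bool /c /= -!/(y _).
  case: (y z 0 l) (y w 0 l) => [a b] [a' b'] /=.
  ring.
- move=> j; apply: (fmorph_inj cplx).
  rewrite -trace_map_mx BX mxtrace_mulC mulmxA mulmxV// mul1mx mxtrace_diag.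
  by rewrite raddf_sum; apply: eq_bigr => l _; rewrite mxE.
- apply: (map_inj_poly (f := cplx)) => [x y []//||]; first exact: rmorph0.
  rewrite map_char_poly -/B rmorph_prod/=.
  have -> : char_poly B = char_poly (diag_mx D).
    rewrite {1}BE /char_poly /char_poly_mx.
    have -> : 'X%:M - map_mx polyC (invmx P *m diag_mx D *m P) =
        map_mx polyC (invmx P) *m ('X%:M - map_mx polyC (diag_mx D)) *m
        map_mx polyC P.
      rewrite !map_mxM mulmxBr mulmxBl; congr (_ - _).
      by rewrite scalar_mxC -mulmxA -map_mxM mulVmx// map_mx1 mulmx1.
    rewrite !det_mulmx mulrAC -det_mulmx -map_mxM mulVmx// map_mx1 det1.
    by rewrite mul1r.
  rewrite char_poly_trig ?diag_mx_is_trig//; apply: eq_bigr => i _.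
  rewrite rmorphB/= map_polyX map_polyC/= mxE eqxx mulr1n.
  by rewrite lamE.
Qed.

End SpectralFrame.

Section SumInequalities.
Variable R : realType.

(** Lagrange's identity: the double sum of [(a i * b j - a j * b i) ^+ 2] is twice the difference of
    the two sides. *)
Lemma sum_CauchySchwarz (I : finType) (a b : I -> R) :
  (\sum_i a i * b i) ^+ 2 <= (\sum_i a i ^+ 2) * (\sum_i b i ^+ 2).
Proof.
have : 0 <= \sum_i \sum_j (a i * b j - a j * b i) ^+ 2.
  by apply: sumr_ge0 => i _; apply: sumr_ge0 => j _; apply: sqr_ge0.
have E (f g : I -> R) : \sum_i \sum_j f i * g j = (\sum_i f i) * (\sum_j g j).
  by rewrite mulr_suml; apply: eq_bigr => i _; rewrite mulr_sumr.
have -> : \sum_i \sum_j (a i * b j - a j * b i) ^+ 2 =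
   \sum_i \sum_j (a i ^+ 2) * (b j ^+ 2) + \sum_i \sum_j (b i ^+ 2) * (a j ^+ 2)
   - 2 * \sum_i \sum_j (a i * b i) * (a j * b j).
  rewrite mulr_sumr -!big_split -sumrB /=; apply: eq_bigr => i _.
  rewrite mulr_sumr -!big_split -sumrB /=; apply: eq_bigr => j _; ring.
rewrite !E expr2; nra.
Qed.

Lemma sum_CauchySchwarz_sqrt (I : finType) (a b : I -> R) :
  `|\sum_i a i * b i| <=
    Num.sqrt (\sum_i a i ^+ 2) * Num.sqrt (\sum_i b i ^+ 2).
Proof.
rewrite -sqrtrM ?sumr_ge0 // => [|i _]; last exact: sqr_ge0.
by rewrite -sqrtr_sqr ler_wsqrtr// sum_CauchySchwarz.
Qed.

Lemma normX_le1D (x : R) j N : (j <= N)%N -> ~~ odd N -> `|x| ^+ j <= 1 + x ^+ N.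
Proof.
move=> jN eN; have -> : x ^+ N = `|x| ^+ N by rewrite -normrX ger0_norm // exprn_even_ge0.
case: (lerP `|x| 1) => h.
  by apply: (le_trans (exprn_ile1 _ _ h)) => //; rewrite lerDl exprn_ge0.
apply: (le_trans (ler_weXn2l (ltW h) jN)); rewrite lerDr; exact: ler01.
Qed.

(** A crude Young inequality: the product is at most the power of the larger base. *)
Lemma normX_mul_le (x y : R) j l : `|x| ^+ j * `|y| ^+ l <=
  `|x| ^+ (j + l) + `|y| ^+ (j + l).
Proof.
wlog xy : x y j l / `|x| <= `|y|.
  move=> H; case: (lerP `|x| `|y|) => [|/ltW] h; first exact: H.
  by rewrite mulrC addnC [leRHS]addrC; apply: H.
apply: (@le_trans _ _ (`|y| ^+ (j + l))); last by rewrite lerDr exprn_ge0.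
by rewrite exprD ler_wpM2r ?exprn_ge0 // lerXn2r ?nnegrE.
Qed.

End SumInequalities.

(** * Bounds for quadratic forms of powers, through the eigenvalues *)

Section SymmetricMatrix.
Variables (R : realType) (n : nat).
Implicit Types (A B : 'M[R]_n) (p q z w : 'rV[R]_n).

Lemma bform1E z w : bform 1 z w = \sum_i z 0 i * w 0 i.
Proof.
rewrite /bform mulmx1 mxE; by apply: eq_bigr => i _; rewrite mxE.
Qed.

Lemma bform1_ge0 z : 0 <= bform 1 z z.
Proof. by rewrite bform1E sumr_ge0// => i _; rewrite -expr2 sqr_ge0. Qed.

Lemma bform_mulmx A B z w : bform (A *m B) z w = bform 1 (z *m A) (w *m B^T).
Proof. by rewrite /bform mulmx1 trmx_mul trmxK !mulmxA. Qed.

Lemma bform1_CauchySchwarz z w :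
  `|bform 1 z w| <= Num.sqrt (bform 1 z z) * Num.sqrt (bform 1 w w).
Proof. by rewrite !bform1E sum_CauchySchwarz_sqrt. Qed.

Lemma bform_CauchySchwarz A B z w : A^T = A -> B^T = B ->
  `|bform (A *m B) z w| <=
    Num.sqrt (bform (A *m A) z z) * Num.sqrt (bform (B *m B) w w).
Proof.
move=> sA sB; rewrite !bform_mulmx sA sB; exact: bform1_CauchySchwarz.
Qed.

Lemma bform_sqr_ge0 A z : A^T = A -> 0 <= bform (A *m A) z z.
Proof. by move=> sA; rewrite bform_mulmx sA bform1_ge0. Qed.

Lemma bform_even_ge0 A z k : A^T = A -> ~~ odd k -> 0 <= bform (A ^+ k) z z.
Proof.
move=> sA ek; rewrite -(even_halfK ek) -addnn exprmxD.
by apply: bform_sqr_ge0; apply: exprmx_sym.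
Qed.

(** One weight that serves all exponents up to an even [N] at once, because [1 + x ^+ N] dominates
    every smaller power of [|x|]. *)
Definition bform_bound N A z := bform 1 z z + bform (A ^+ N) z z.

Lemma bform_bound_ge0 N A z : A^T = A -> ~~ odd N -> 0 <= bform_bound N A z.
Proof. by move=> sA eN; rewrite addr_ge0 ?bform1_ge0 ?bform_even_ge0. Qed.

Lemma bform_le_bound A N j z w : A^T = A -> ~~ odd N -> (j <= N)%N ->
  `|bform (A ^+ j) z w| <=
    Num.sqrt (bform_bound N A z) * Num.sqrt (bform_bound N A w).
Proof.
move=> sA eN jN; have [lam [[c cE] _ _]] := spectral_frame sA.
have bE u : bform_bound N A u =
    \sum_l (Num.sqrt (1 + lam l.1 ^+ N) * `|c l u|) ^+ 2.
  rewrite /bform_bound -(expr0 A) !cE -big_split /=; apply: eq_bigr => l _.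
  rewrite exprMn sqr_sqrtr ?addr_ge0 ?exprn_even_ge0// real_normK ?num_real//.
  by rewrite expr0; ring.
rewrite !bE; apply: le_trans (le_trans (ler_norm _) (sum_CauchySchwarz_sqrt _ _)).
rewrite cE; apply: (le_trans (ler_norm_sum _ _ _)); apply: ler_sum => l _.
rewrite mulrACA -!expr2 sqr_sqrtr ?addr_ge0 ?exprn_even_ge0//.
by rewrite !normrM normrX ler_wpM2r ?mulr_ge0// normX_le1D.
Qed.

(** [A] and [B] have no common eigenbasis, so Cauchy-Schwarz first separates them; this squares each
    power and explains the doubled exponents. *)
Lemma bform_le_bound_mix A B N i l z w : A^T = A -> B^T = B -> ~~ odd N ->
  (i.*2 <= N)%N -> (l.*2 <= N)%N ->
  `|bform (A ^+ i *m B ^+ l) z w| <=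
    Num.sqrt (bform_bound N A z) * Num.sqrt (bform_bound N B w).
Proof.
move=> sA sB eN iN lN.
apply: (le_trans (bform_CauchySchwarz _ _ _ _)); try exact: exprmx_sym.
have H C j u : C^T = C -> (j.*2 <= N)%N ->
    Num.sqrt (bform (C ^+ j *m C ^+ j) u u) <= Num.sqrt (bform_bound N C u).
  move=> sC jN; rewrite ler_wsqrtr// -exprmxD addnn.
  apply: (le_trans (ler_norm _)).
  apply: (le_trans (bform_le_bound _ _ sC eN jN)).
  by rewrite -expr2 sqr_sqrtr// bform_bound_ge0.
by rewrite ler_pM ?sqrtr_ge0// H.
Qed.

(** Each form is expanded in the eigenframe of its own matrix, and [normX_mul_le] is applied to
    every pair of eigenvalues with the nonnegative weight of that pair. Evenness of [j + l] removes
    the absolute values on the right. *)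
Lemma bform_Young_diag A B j l p q : A^T = A -> B^T = B -> ~~ odd (j + l) ->
  `|bform (A ^+ j) q q * bform (B ^+ l) p p| <=
    bform (A ^+ (j + l)) q q * bform 1 p p + bform 1 q q * bform (B ^+ (j + l)) p p.
Proof.
move=> sA sB e; have [lam [[c cE] _ _]] := spectral_frame sA.
have [mu [[c' cE'] _ _]] := spectral_frame sB.
have q1 u : bform 1 u u = \sum_k c k u ^+ 2.
  by rewrite -(expr0 A) cE; apply: eq_bigr => k _; rewrite expr0 mul1r.
have p1 u : bform 1 u u = \sum_k c' k u ^+ 2.
  by rewrite -(expr0 B) cE'; apply: eq_bigr => k _; rewrite expr0 mul1r.
rewrite (p1 p) (q1 q) !cE !cE'.
rewrite !mulr_suml -big_split; apply: (le_trans (ler_norm_sum _ _ _)).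
apply: ler_sum => k _; rewrite /= !mulr_sumr -big_split.
apply: (le_trans (ler_norm_sum _ _ _)); apply: ler_sum => m _ /=.
rewrite !normrM !normrX -!expr2 !real_normK ?num_real//.
rewrite -(ger0_norm (exprn_even_ge0 (lam k.1) e)) normrX.
rewrite -(ger0_norm (exprn_even_ge0 (mu m.1) e)) normrX.
have : 0 <= c k q ^+ 2 * c' m p ^+ 2 by rewrite mulr_ge0 ?sqr_ge0.
move=> /ler_wpM2r/(_ _ _ (normX_mul_le (lam k.1) (mu m.1) j l)).
by rewrite mulrACA mulrDl; congr (_ <= _); ring.
Qed.

(** As for [bform_Young_diag], except that the weight of a pair of eigenvalues is now a product of
    four coordinates with no sign; it is first split by [2 * (a * b * (a' * b')) <= a ^+ 2 * b' ^+ 2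
    + b ^+ 2 * a' ^+ 2]. *)
Lemma bform_Young_cross A B j l p q : A^T = A -> B^T = B -> ~~ odd (j + l) ->
  2 * `|bform (A ^+ j) p q * bform (B ^+ l) p q| <=
    bform (A ^+ (j + l)) p p * bform 1 q q + bform (A ^+ (j + l)) q q * bform 1 p p
    + bform (B ^+ (j + l)) p p * bform 1 q q + bform (B ^+ (j + l)) q q * bform 1 p p.
Proof.
move=> sA sB e; have [lam [[c cE] _ _]] := spectral_frame sA.
have [mu [[c' cE'] _ _]] := spectral_frame sB.
have q1 u : bform 1 u u = \sum_k c k u ^+ 2.
  by rewrite -(expr0 A) cE; apply: eq_bigr => k _; rewrite expr0 mul1r.
have p1 u : bform 1 u u = \sum_k c' k u ^+ 2.
  by rewrite -(expr0 B) cE'; apply: eq_bigr => k _; rewrite expr0 mul1r.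
have -> : bform (B ^+ (j + l)) p p * bform 1 q q = bform 1 q q * bform (B ^+ (j + l)) p p.
  exact: mulrC.
have -> : bform (B ^+ (j + l)) q q * bform 1 p p = bform 1 p p * bform (B ^+ (j + l)) q q.
  exact: mulrC.
rewrite {1}(p1 q) {1}(p1 p) (q1 q) (q1 p) !cE !cE'.
rewrite !mulr_suml -!big_split -[2]ger0_norm// -normrM mulr_sumr.
apply: (le_trans (ler_norm_sum _ _ _)).
apply: ler_sum => k _; rewrite /= !mulr_sumr -!big_split.
apply: (le_trans (ler_norm_sum _ _ _)); apply: ler_sum => m _ /=.
rewrite !normrM !normrX -?expr2 [`|2|]ger0_norm//.
rewrite -(ger0_norm (exprn_even_ge0 (lam k.1) e)) normrX.
rewrite -(ger0_norm (exprn_even_ge0 (mu m.1) e)) normrX.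
rewrite -!(@real_normK _ (c _ _)) ?num_real// -!(@real_normK _ (c' _ _)) ?num_real//.
have := normX_mul_le (lam k.1) (mu m.1) j l.
have := normr_ge0 (c k p); have := normr_ge0 (c k q).
have := normr_ge0 (c' m p); have := normr_ge0 (c' m q).
move: (`|c k p|) (`|c k q|) (`|c' m p|) (`|c' m q|) => a b a' b' b'0 a'0 b0 a0.
set X := _ ^+ (j + l) + _ => h.
apply: (@le_trans _ _ (X * (a ^+ 2 * b' ^+ 2 + b ^+ 2 * a' ^+ 2))); last first.
  by rewrite /X le_eqVlt; apply/orP; left; apply/eqP; ring.
have h' : 2 * (a * b * (a' * b')) <= a ^+ 2 * b' ^+ 2 + b ^+ 2 * a' ^+ 2.
  by have := sqr_ge0 (a * b' - b * a'); lra.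
have X0 : 0 <= `|lam k.1| ^+ j * `|mu m.1| ^+ l by rewrite mulr_ge0 ?exprn_ge0.
have Y0 : 0 <= 2 * (a * b * (a' * b')) by rewrite !mulr_ge0.
apply: le_trans (ler_pM X0 Y0 h h').
by rewrite le_eqVlt; apply/orP; left; apply/eqP; ring.
Qed.

(** Eigenvalue by eigenvalue, with [t = lam ^+ 2]: the first term suffices if [x <= eta * t], the
    second if [t < x / eta]. It lets a random weight [x] be absorbed into a small multiple of the
    next even moment. *)
Lemma bform_interpolate A k x eta z : A^T = A -> 0 <= x -> 0 < eta ->
  x * bform (A ^+ k.*2) z z <=
    eta * bform (A ^+ k.+1.*2) z z + eta ^- k * x ^+ k.+1 * bform 1 z z.
Proof.
move=> sA x0 eta0; have [lam [[c cE] _ _]] := spectral_frame sA.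
have q1 u : bform 1 u u = \sum_k c k u ^+ 2.
  by rewrite -(expr0 A) cE; apply: eq_bigr => l _; rewrite expr0 mul1r.
have [m mE] : exists m, m = k.+1.*2 by eexists.
rewrite -mE q1 !cE !mulr_sumr -big_split; apply: ler_sum => l _ /=.
rewrite -expr2 [x * _]mulrA [eta * _]mulrA -mulrDl ler_wpM2r ?sqr_ge0// mE.
have -> : lam l.1 ^+ k.*2 = (lam l.1 ^+ 2) ^+ k by rewrite -exprM mul2n.
have -> : lam l.1 ^+ k.+1.*2 = (lam l.1 ^+ 2) ^+ k.+1 by rewrite -exprM mul2n.
have := sqr_ge0 (lam l.1); move: (lam l.1 ^+ 2) => t t0.
case: (lerP x (eta * t)) => h.
  apply: ler_wpDr; first by rewrite !mulr_ge0 ?invr_ge0 ?exprn_ge0// ltW.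
  by rewrite exprS mulrA ler_wpM2r ?exprn_ge0.
apply: ler_wpDl; first by rewrite mulr_ge0 ?exprn_ge0// ltW.
rewrite exprS mulrCA ler_wpM2l// mulrC -exprVn -exprMn.
by rewrite lerXn2r ?nnegrE ?mulr_ge0 ?invr_ge0 ?(ltW eta0)// ler_pdivlMr// mulrC ltW.
Qed.

Lemma bform_sqr_le A i z : A^T = A ->
  bform (A ^+ i) z z ^+ 2 <= bform 1 z z * bform (A ^+ i.*2) z z.
Proof.
move=> sA; have sAi := exprmx_sym i sA.
have -> : bform (A ^+ i) z z = bform 1 z (z *m A ^+ i).
  by rewrite /bform mulmx1 trmx_mul sAi mulmxA.
have -> : bform (A ^+ i.*2) z z = bform 1 (z *m A ^+ i) (z *m A ^+ i).
  by rewrite -addnn exprmxD bform_mulmx sAi.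
rewrite !bform1E; under [X in _ <= X * _]eq_bigr do rewrite -expr2.
under [X in _ <= _ * X]eq_bigr do rewrite -expr2.
exact: sum_CauchySchwarz.
Qed.

Lemma trX_sqr_le A i : A^T = A ->
  \tr (A ^+ i) ^+ 2 <= n%:R * \tr (A ^+ i.*2).
Proof.
move=> sA; have [lam [_ tE _]] := spectral_frame sA; rewrite !tE.
have := sum_CauchySchwarz (fun=> 1) (fun l => lam l ^+ i).
under eq_bigr do rewrite mul1r.
under [X in _ <= X * _]eq_bigr do rewrite expr1n.
under [X in _ <= _ * X]eq_bigr do rewrite -exprM muln2.
by rewrite sumr_const card_ord.
Qed.

Lemma trX_even_ge0 A k : A^T = A -> ~~ odd k -> 0 <= \tr (A ^+ k).
Proof.
move=> sA ek; have [lam [_ tE _]] := spectral_frame sA; rewrite tE.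
by apply: sumr_ge0 => l _; rewrite exprn_even_ge0.
Qed.

(** Nonnegativity of [t ^+ k.*2 * (t - 1) ^+ 2] at [t = |lam|]. *)
Lemma norm_trX_odd_le A k : A^T = A ->
  2 * `|\tr (A ^+ k.*2.+1)| <= \tr (A ^+ k.*2) + \tr (A ^+ k.+1.*2).
Proof.
move=> sA; have [lam [_ tE _]] := spectral_frame sA; rewrite !tE.
rewrite -[2]ger0_norm// -normrM mulr_sumr -big_split.
apply: (le_trans (ler_norm_sum _ _ _)); apply: ler_sum => l _ /=.
rewrite !normrM [`|2|]ger0_norm// normrX.
have -> : lam l ^+ k.*2 = `|lam l| ^+ k.*2.
  by rewrite -normrX ger0_norm// exprn_even_ge0// odd_double.
have -> : lam l ^+ k.+1.*2 = `|lam l| ^+ k.+1.*2.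
  by rewrite -normrX ger0_norm// exprn_even_ge0// odd_double.
rewrite doubleS !exprS; set t := `|lam l|.
have : 0 <= t ^+ k.*2 by rewrite exprn_ge0 /t.
by have := sqr_ge0 (t - 1); nra.
Qed.

(** Both [eigenvalues A] and the family [lam] of the frame factor the characteristic polynomial, so
    comparing root multiplicities shows that they agree up to order. *)
Lemma eigenvalues_trX A k : A^T = A ->
  \sum_(x <- eigenvalues A) x ^+ k = \tr (A ^+ k).
Proof.
move=> sA; have [lam [_ tE cE]] := spectral_frame sA; rewrite tE.
have [_ eE] := eigenvalues_sym sA.
have P : perm_eq (eigenvalues A) [seq lam l | l <- enum 'I_n].
  apply/seq.permP => a.
  have E : \prod_(x <- eigenvalues A) ('X - x%:P) =
           \prod_(x <- [seq lam l | l <- enum 'I_n]) ('X - x%:P).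
    by rewrite -eE cE big_map big_enum.
  suff : perm_eq (eigenvalues A) [seq lam l | l <- enum 'I_n] by move/seq.permP.
  by apply/allP => x _ /=; apply/eqP; rewrite -!mu_prod_XsubC E.
by rewrite (perm_big _ P) /= big_map big_enum.
Qed.

End SymmetricMatrix.

(** * Random matchings and switchings *)

Section Mean.
Variables (R : realType) (T : finType).
Implicit Types X Y : T -> R.

Definition mean X : R := (\sum_t X t) / #|T|%:R.

Lemma eq_mean X Y : X =1 Y -> mean X = mean Y.
Proof. by move=> XY; rewrite /mean (eq_bigr _ (fun t _ => XY t)). Qed.

Lemma meanD X Y : mean (fun t => X t + Y t) = mean X + mean Y.
Proof. by rewrite /mean big_split mulrDl. Qed.

Lemma meanZ a X : mean (fun t => a * X t) = a * mean X.
Proof. by rewrite /mean -mulr_sumr mulrA. Qed.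

Lemma meanN X : mean (fun t => - X t) = - mean X.
Proof. by rewrite /mean sumrN mulNr. Qed.

Lemma meanB X Y : mean (fun t => X t - Y t) = mean X - mean Y.
Proof. by rewrite meanD meanN. Qed.

Lemma mean_sum (I : Type) (r : seq I) (P : pred I) (F : I -> T -> R) :
  mean (fun t => \sum_(i <- r | P i) F i t) = \sum_(i <- r | P i) mean (F i).
Proof. by rewrite /mean exchange_big mulr_suml. Qed.

Lemma ler_mean X Y : (forall t, X t <= Y t) -> mean X <= mean Y.
Proof. by move=> XY; rewrite /mean ler_wpM2r ?invr_ge0// ler_sum. Qed.

Lemma mean_ge0 X : (forall t, 0 <= X t) -> 0 <= mean X.
Proof. by move=> X0; rewrite /mean divr_ge0// sumr_ge0. Qed.

Lemma ler_norm_mean X : `|mean X| <= mean (fun t => `|X t|).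
Proof.
by rewrite /mean normrM [`|_^-1|]ger0_norm ?invr_ge0// ler_wpM2r ?invr_ge0// ler_norm_sum.
Qed.

Lemma mean_cst c : (0 < #|T|)%N -> mean (fun=> c) = c.
Proof.
move=> T0; rewrite /mean sumr_const -[c *+ _]mulr_natr mulfK//.
by rewrite pnatr_eq0 -lt0n.
Qed.

End Mean.

Section Switching.
Variables (R : realType) (H : finType).

(** Perfect matchings are encoded as fixed-point-free involutions, so that a switching becomes
    conjugation by a transposition. *)
Definition is_matching (f : {perm H}) :=
  [forall x, (f (f x) == x) && (f x != x)].

Definition matching := {f : {perm H} | is_matching f}.

Definition partner (f : matching) (x : H) : H := val f x.

Lemma partnerK f : involutive (partner f).
Proof. by move=> x; have /forallP/(_ x)/andP[/eqP] := valP f. Qed.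

Lemma partner_neq f x : partner f x != x.
Proof. by have /forallP/(_ x)/andP[] := valP f. Qed.

Lemma partner_inj f : injective (partner f).
Proof. exact: inv_inj (@partnerK f). Qed.

Lemma eq_partner f x y : (partner f x == y) = (x == partner f y).
Proof. by rewrite -(inj_eq (@partner_inj f)) partnerK. Qed.

Lemma switch_subproof x y (f : matching) :
  is_matching (tperm x y * val f * tperm x y)%g.
Proof.
apply/forallP => z; rewrite !permM tpermK.
have h := partnerK f; have h' := partner_neq f; rewrite /partner in h h'.
rewrite h tpermK eqxx /=.
by rewrite -[X in _ != X](tpermK x y) (inj_eq perm_inj).
Qed.

Definition switch x y (f : matching) : matching := Sub _ (switch_subproof x y f).

Lemma switchE x y f z :
  partner (switch x y f) z = tperm x y (partner f (tperm x y z)).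
Proof. by rewrite /partner SubK !permM. Qed.

Lemma switchK x y : involutive (switch x y).
Proof.
move=> f; apply: val_inj; apply/permP => z.
by rewrite -!/(partner _ z) !switchE !tpermK.
Qed.

(** The degenerate switching: the transposition of two matched half-edges commutes with [f]. All
    conditions [partner f x != y] below come from this case. *)
Lemma switch_id x y f : partner f x = y -> switch x y f = f.
Proof.
move=> fxy; have fyx : partner f y = x by rewrite -fxy partnerK.
apply: val_inj; apply/permP => z; rewrite -!/(partner _ z) switchE.
case: (tpermP x y z) => [->|->|/eqP zx /eqP zy].
- by rewrite fyx tpermL.
- by rewrite fxy tpermR.
- rewrite tpermD// eq_sym; first by rewrite eq_partner fxy.
  by rewrite eq_partner fyx.
Qed.

Lemma switch_partnerL x y f : partner f x != y ->
  partner (switch x y f) x = partner f y.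
Proof.
move=> fxy; rewrite switchE tpermL tpermD// eq_sym ?partner_neq//.
by rewrite eq_partner eq_sym.
Qed.

Lemma mean_switch x y (X : matching -> R) :
  mean (fun f => X (switch x y f)) = mean X.
Proof.
rewrite /mean; congr (_ / _); rewrite [RHS](reindex (switch x y))//.
exact/onW_bij/inv_bij/switchK.
Qed.

(** Exchangeability of the pair formed by [f] and [switch x y f], since the switching is an
    involution that preserves the uniform law. *)
Lemma mean_swap x y (F : matching -> matching -> R) :
  mean (fun f => F f (switch x y f)) = mean (fun f => F (switch x y f) f).
Proof.
rewrite -(mean_switch x y (fun f => F f (switch x y f))).
by apply: eq_mean => f; rewrite switchK.
Qed.

(* Resampling the partner of x: switching along (x, y) for a uniform y turns
   the partner of x into that of y, unless x and y are matched. *)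
Lemma mean_partner x (G : H -> matching -> R) :
  (#|H|%:R - 1) * mean (fun f => G (partner f x) f) =
  mean (fun f => \sum_(y | partner f x != y) G (partner f y) (switch x y f)).
Proof.
have : \sum_(y : H) mean (fun f => G (partner f x) f) =
       mean (fun f => \sum_y G (partner (switch x y f) x) (switch x y f)).
  rewrite mean_sum; apply: eq_bigr => y _.
  exact/esym/(mean_switch x y (fun f => G (partner f x) f)).
(* The factor [#|H|%:R] counts all [y]; the [- 1] cancels the term [y = partner f x], where the
   switching is trivial. *)
rewrite sumr_const => E; rewrite mulrBl mul1r mulr_natl E -meanB.
apply: eq_mean => f; rewrite (bigD1 (partner f x))//=.
rewrite [switch _ _ _]switch_id// addrAC subrr add0r.
apply: eq_big => [y|y]; first by rewrite eq_sym.
by move=> yx; rewrite switch_partnerL// eq_sym.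
Qed.

End Switching.

(** * The Laplacian as a function of the matching, and its integration by parts *)

Section LaplacianOfMatching.
Variables (R : realType) (n : nat) (H : finType).
Variables (v : H -> 'I_n) (deg : 'I_n -> nat) (s : R).
Hypothesis deg_gt0 : forall i, (0 < deg i)%N.
Hypothesis card_fiber : forall i, #|[set x | v x == i]%SET| = deg i.

Definition kap (x : H) : R := (deg (v x))%:R^-1.
Definition uvec (x : H) : 'rV[R]_n := Num.sqrt (kap x) *: delta_mx 0 (v x).
(** The vector of square roots of the degrees. It is fixed by every [adjm f], hence is a
    deterministic eigenvector of every [lapm f]. *)
Definition gvec : 'rV[R]_n := \sum_x uvec x.
Definition csub : R := (#|H|%:R - 1)^-1.
Definition adjm (f : matching H) : 'M[R]_n :=
  \sum_x (uvec x)^T *m uvec (partner f x).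
Definition lapm f : 'M[R]_n := s *: (adjm f - csub *: (gvec^T *m gvec)).

Local Notation M := lapm.
Local Notation u := uvec.
Local Notation g := gvec.
Local Notation pi := partner.

Lemma kap_gt0 x : 0 < kap x.
Proof. by rewrite invr_gt0 ltr0n. Qed.

Lemma kap_ge0 x : 0 <= kap x. Proof. exact: ltW (kap_gt0 x). Qed.

Lemma kap_le1 x : kap x <= 1.
Proof. by rewrite invf_le1 ?ltr0n// ler1n. Qed.

Lemma sum_kap (F : 'I_n -> R) : \sum_x kap x * F (v x) = \sum_i F i.
Proof.
rewrite (partition_big v xpredT) //=; apply: eq_bigr => i _.
rewrite (eq_bigr (fun=> (deg i)%:R^-1 * F i)); last first.
  by move=> x /eqP <-.
rewrite sumr_const -cardsE card_fiber -[LHS]mulr_natl mulrA mulfV ?mul1r//.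
by rewrite pnatr_eq0 -lt0n.
Qed.

Lemma sum_kap1 : \sum_x kap x = n%:R.
Proof.
have := sum_kap (fun=> 1); under eq_bigr do rewrite mulr1.
by move=> ->; rewrite sumr_const card_ord.
Qed.

Lemma bform_uvec A x y :
  bform A (u x) (u y) = Num.sqrt (kap x) * Num.sqrt (kap y) * A (v x) (v y).
Proof.
rewrite /bform /uvec -!scalemxAl linearZ /= -scalemxAr.
rewrite -rowE trmx_delta -colE !mxE; ring.
Qed.

Lemma bform_uvec_diag A x : bform A (u x) (u x) = kap x * A (v x) (v x).
Proof. by rewrite bform_uvec -expr2 sqr_sqrtr ?kap_ge0. Qed.

(** Each vertex [i] carries [deg i] copies of its basis vector, each of squared length
    [1 / deg i]. *)
Lemma sum_uvec : \sum_x (u x)^T *m u x = 1%:M.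
Proof.
apply/matrixP => i j; rewrite summxE mxE.
transitivity (\sum_x kap x * ((v x == i) && (v x == j))%:R).
  apply: eq_bigr => x _; rewrite mxE big_ord1 !mxE !eqxx /=.
  rewrite mulrACA -expr2 sqr_sqrtr ?kap_ge0// ![_ == v x]eq_sym.
  by case: eqP; case: eqP; rewrite ?mulr1 ?mulr0.
rewrite (sum_kap (fun k => ((k == i) && (k == j))%:R)) (bigD1 i)//= eqxx /=.
rewrite big1 ?addr0// => k /negbTE ->; by [].
Qed.

Lemma trE A : \tr A = \sum_x bform A (u x) (u x).
Proof. by rewrite (mxtrace_frame _ sum_uvec). Qed.

Lemma sum_uvec_prod A B : B^T = B ->
  \sum_x \sum_y bform A (u x) (u y) * bform B (u x) (u y) = \tr (A *m B).
Proof.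
move=> sB; rewrite [RHS]trE; apply: eq_bigr => x _.
rewrite -[A in RHS]mulmx1 -sum_uvec mulmx_sumr mulmx_suml.
rewrite /bform mulmx_sumr mulmx_suml summxE; apply: eq_bigr => y _.
by rewrite -!/(bform _ _ _) bform_outer (bformC (u x) _ sB).
Qed.

Lemma gvec_uvec x : bform 1 g (u x) = 1.
Proof.
rewrite /gvec bform_suml.
transitivity (\sum_y kap y * (v y == v x)%:R).
  apply: eq_bigr => y _; rewrite bform_uvec mxE.
  case: eqP => [e|_]; last by rewrite !mulr0.
  by rewrite !mulr1 /kap e -expr2 sqr_sqrtr// invr_ge0.
rewrite (sum_kap (fun k => (k == v x)%:R)) (bigD1 (v x))//= eqxx big1 ?addr0//.
by move=> k /negbTE ->.
Qed.

Lemma gvec_gvec : bform 1 g g = #|H|%:R.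
Proof.
rewrite [in X in bform 1 _ X]/gvec bform_sumr (eq_bigr (fun=> 1)).
  by rewrite sumr_const.
by move=> x _; exact: gvec_uvec.
Qed.

Lemma mulmx_outer (p q w : 'rV[R]_n) : w *m (p^T *m q) = bform 1 w p *: q.
Proof.
rewrite mulmxA /bform mulmx1; apply/rowP => i; rewrite mxE big_ord1 !mxE.
by [].
Qed.

Lemma adjm_sym f : (adjm f)^T = adjm f.
Proof.
rewrite /adjm [in RHS](reindex_inj (@partner_inj _ f)) raddf_sum /=.
by apply: eq_bigr => x _; rewrite trmx_mul trmxK partnerK.
Qed.

Lemma lapm_sym f : (M f)^T = M f.
Proof.
by rewrite /lapm linearZ /= linearB /= linearZ /= adjm_sym trmx_mul trmxK.
Qed.

Lemma reindex_partner f (V : nmodType) (F : H -> V) : \sum_x F (pi f x) = \sum_x F x.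
Proof. by rewrite [RHS](reindex_inj (@partner_inj _ f)). Qed.

Lemma outer_expand (a b p : 'rV[R]_n) (c e : R) :
  (a - c *: p)^T *m (b - e *: p) =
  a^T *m b - c *: (p^T *m b) - e *: (a^T *m p) + c *: (e *: (p^T *m p)).
Proof. by apply/matrixP => i j; rewrite !mxE !big_ord1 !mxE; ring. Qed.

Lemma gvec_adjm f : g *m adjm f = g.
Proof.
rewrite /adjm mulmx_sumr -[RHS](reindex_partner f).
by apply: eq_bigr => x _; rewrite mulmx_outer gvec_uvec scale1r.
Qed.

Hypothesis card_H : (1 < #|H|)%N.

Lemma card_H_sub1 : 0 < #|H|%:R - 1 :> R.
Proof. by rewrite subr_gt0 ltr1n. Qed.

Lemma card_H_neq1 : #|H|%:R - 1 != 0 :> R.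
Proof. exact: lt0r_neq0 card_H_sub1. Qed.

(** Minus the eigenvalue of [lapm f] at [gvec]. It is nonzero because the centring divides by
    [#|H| - 1] rather than [#|H|]. *)
Definition shift_coef : R := s * csub.
Local Notation eps := shift_coef.

Lemma gvec_lapm f : g *m M f = - eps *: g.
Proof.
rewrite /lapm -scalemxAr mulmxBr gvec_adjm -scalemxAr mulmx_outer gvec_gvec.
rewrite scalerA -{1}(scale1r g) -scalerBl scalerA /eps /csub; congr (_ *: _).
by field; exact: card_H_neq1.
Qed.

Lemma bform_lapmX_gvecl f j w : bform (M f ^+ j) g w = (- eps) ^+ j * bform 1 g w.
Proof.
elim: j => [|j IH]; first by rewrite !expr0 mul1r.
rewrite exprmxS bform_mulmx gvec_lapm exprmx_sym ?lapm_sym//.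
rewrite /bform mulmx1 -scalemxAl mxE trmx_mul exprmx_sym ?lapm_sym// mulmxA.
by rewrite -/(bform (M f ^+ j) g w) IH exprS mulrA.
Qed.

(** Row sums in the frame are pairings with the eigenvector [gvec], so they do not depend on the
    matching. *)
Lemma sum_bform_lapmX f j x : \sum_y bform (M f ^+ j) (u x) (u y) = (- eps) ^+ j.
Proof.
rewrite -bform_sumr -/g bformC ?exprmx_sym ?lapm_sym// bform_lapmX_gvecl.
by rewrite gvec_uvec mulr1.
Qed.

Lemma trM_lapm f B : B^T = B -> \tr (M f *m B) =
  s * (\sum_x bform B (u x) (u (pi f x)) - csub * bform B g g).
Proof.
move=> sB; rewrite /lapm -scalemxAl mxtraceZ mulmxBl raddfB /=; congr (_ * (_ - _)).
  rewrite /adjm mulmx_suml raddf_sum; apply: eq_bigr => x _ /=.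
  by rewrite mxtrace_outer bformC.
by rewrite -scalemxAl mxtraceZ mxtrace_outer.
Qed.

Section SwitchDifference.
Variables (x y : H) (f : matching H).
Let p := u x - u y.
Let q := u (pi f x) - u (pi f y).

(** Turns the transposition into a rank-one correction of the frame, as stated in [uvec_tperm], with
    no case distinction and also for [x = y]. *)
Let csgn z : R := (z == x)%:R - (z == y)%:R.

Let sum_csgn (V : lmodType R) (F : H -> V) : \sum_z csgn z *: F z = F x - F y.
Proof.
under eq_bigr do rewrite scalerBl.
rewrite sumrB (bigD1 x)//= eqxx scale1r big1 ?addr0; last first.
  by move=> z /negbTE ->; rewrite scale0r.
rewrite (bigD1 y)//= eqxx scale1r big1 ?addr0// => z /negbTE ->.
by rewrite scale0r.
Qed.

Let uvec_tperm z : u (tperm x y z) = u z - csgn z *: p.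
Proof.
rewrite /csgn /p; case: tpermP => [->|->|/eqP/negbTE -> /eqP/negbTE ->].
- rewrite eqxx; case: eqP => [<-|_]; first by rewrite subrr scale0r subr0.
  by rewrite subr0 scale1r opprB addrC subrK.
- rewrite eqxx; case: eqP => [<-|_]; first by rewrite subrr scale0r subr0.
  by rewrite sub0r scaleN1r opprK addrC subrK.
- by rewrite subrr scale0r subr0.
Qed.

(** After reindexing by the transposition each frame vector is shifted by a multiple of [p]. The
    part quadratic in [csgn] survives only if [x] and [y] are matched, where each of them
    contributes -1. *)
Lemma adjm_switch : adjm (switch x y f) - adjm f =
  - (p^T *m q + q^T *m p + (2 * (pi f x == y)%:R) *: (p^T *m p)).
Proof.
have -> : adjm (switch x y f) =
   \sum_z (u z - csgn z *: p)^T *m (u (pi f z) - csgn (pi f z) *: p).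
  rewrite /adjm (reindex_inj (@perm_inj _ (tperm x y))) /=.
  by apply: eq_bigr => z _; rewrite switchE tpermK !uvec_tperm.
rewrite /adjm -sumrB.
rewrite (eq_bigr (fun z => - (csgn z *: (p^T *m u (pi f z)))
   - csgn (pi f z) *: ((u z)^T *m p) + csgn z *: (csgn (pi f z) *: (p^T *m p)))); last first.
  by move=> z _; rewrite outer_expand -!addrA [LHS]addrC -!addrA addNr addr0.
rewrite !big_split !sumrN /= sum_csgn.
have -> : \sum_z csgn (pi f z) *: ((u z)^T *m p) = q^T *m p.
  rewrite -(reindex_partner f) /=; under eq_bigr do rewrite partnerK.
  by rewrite sum_csgn -mulmxBl; congr (_ *m _); apply/matrixP => i j; rewrite !mxE.
rewrite sum_csgn -mulmxBr -/q -scalerBl !opprD -scaleNr; congr (_ + _ *: _).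
rewrite /csgn !(negbTE (partner_neq _ _)).
rewrite [pi f y == x]eq_partner [y == _]eq_sym /= !mulr0n; ring.
Qed.

Lemma lapm_switch : M (switch x y f) - M f =
  - s *: (p^T *m q + q^T *m p + (2 * (pi f x == y)%:R) *: (p^T *m p)).
Proof.
rewrite /lapm -scalerBr opprB addrA subrK adjm_switch scalerN scaleNr.
by [].
Qed.

Lemma lapm_switchN : pi f x != y -> M (switch x y f) - M f =
  - s *: (p^T *m q + q^T *m p).
Proof.
by move=> /negbTE fxy; rewrite lapm_switch fxy mulr0 scale0r addr0.
Qed.

Lemma tr_lapm_switch B : B^T = B -> \tr ((M (switch x y f) - M f) *m B) =
   - (2 * s) * ((pi f x != y)%:R * bform B p q).
Proof.
move=> sB; case: (eqVneq (pi f x) y) => [fxy|fxy].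
  by rewrite switch_id// subrr mul0mx raddf0 mul0r mulr0.
rewrite lapm_switchN// -scalemxAl mxtraceZ mulmxDl mxtraceD !mxtrace_outer.
by rewrite (bformC q p sB) /= mulr1n; ring.
Qed.

End SwitchDifference.

(** The linear regression property of an exchangeable pair: summed over all switchings, the change
    of [M f] is a negative multiple of [M f + eps]. *)
Lemma sum_tr_lapm_switch f B : B^T = B ->
  \sum_x \sum_y \tr ((M (switch x y f) - M f) *m B) =
  - 4 * ((#|H|%:R - 1) * (\tr (M f *m B) + eps * \tr B)).
Proof.
move=> sB; under eq_bigr => x _ do
  [under eq_bigr => y _ do rewrite tr_lapm_switch//; rewrite -mulr_sumr].
rewrite -mulr_sumr.
pose b x y := bform B (u x) (u y).
have bC x y : b x y = b y x by apply: bformC.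
(* The sum over [y != pi f x] is completed to all [y], and the missing term is subtracted. *)
rewrite (eq_bigr (fun x => (\sum_y (b x (pi f x) - b x (pi f y) - (b y (pi f x) - b y (pi f y))))
   - (b x (pi f x) - b x x - (b (pi f x) (pi f x) - b (pi f x) x)))); last first.
  move=> x _; rewrite [in RHS](bigD1 (pi f x)) //= addrAC.
  rewrite !partnerK subrr add0r.
  rewrite (bigD1 (pi f x))//= eqxx mul0r add0r.
  by apply: eq_bigr => y; rewrite eq_sym => ->; rewrite mul1r bformBl !bformBr.
set S := \sum_x b x (pi f x).
have S1 : \sum_x \sum_y b x y = bform B g g.
  by rewrite /gvec bform_suml; apply: eq_bigr => x _; rewrite bform_sumr.
have A1 : \sum_x \sum_(y : H) b x (pi f x) = #|H|%:R * S.
  by rewrite mulr_sumr; apply: eq_bigr => x _; rewrite sumr_const mulr_natl.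
have A2 : \sum_x \sum_y b x (pi f y) = bform B g g.
  by rewrite -S1; apply: eq_bigr => x _; rewrite (reindex_partner f (b x)).
have A3 : \sum_x \sum_y b y (pi f x) = bform B g g.
  rewrite (reindex_partner f (fun z => \sum_y b y z)) -S1.
  by apply: eq_bigr => x _; apply: eq_bigr => y _; rewrite bC.
have A4 : \sum_(x : H) \sum_y b y (pi f y) = #|H|%:R * S.
  by rewrite sumr_const mulr_natl.
have T1 : \sum_x b x x = \tr B by rewrite trE.
have T2 : \sum_x b (pi f x) (pi f x) = \tr B.
  by rewrite (reindex_partner f (fun z => b z z)).
have T3 : \sum_x b (pi f x) x = S.
  by apply: eq_bigr => x _; rewrite bC.
rewrite !sumrB T1 T2 T3 trM_lapm// /eps /csub -/S.
rewrite (eq_bigr (fun x => \sum_(y : H) b x (pi f x) - \sum_y b x (pi f y)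
  - (\sum_y b y (pi f x) - \sum_y b y (pi f y)))); last first.
  by move=> x _; rewrite -!sumrB.
rewrite !sumrB A1 A2 A3 A4.
by field; exact: card_H_neq1.
Qed.

(** By exchangeability, evaluating [F] at the new matrix instead of the old one reverses the sign of
    the regression identity; the difference of the two gives [8 = 4 + 4]. *)
Lemma lapm_Stein (F : 'M[R]_n -> 'M[R]_n) :
  (forall f, (F (M f))^T = F (M f)) ->
  8 * ((#|H|%:R - 1) * mean (fun f => \tr (M f *m F (M f)) + eps * \tr (F (M f)))) =
  mean (fun f => \sum_x \sum_y
    \tr ((M (switch x y f) - M f) *m (F (M (switch x y f)) - F (M f)))).
Proof.
move=> sF.
have E : mean (fun f => \sum_x \sum_y \tr ((M (switch x y f) - M f) *m F (M f))) =
  - 4 * ((#|H|%:R - 1) * mean (fun f => \tr (M f *m F (M f)) + eps * \tr (F (M f)))).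
  by rewrite -!meanZ; apply: eq_mean => f; rewrite sum_tr_lapm_switch.
have E' : mean (fun f => \sum_x \sum_y
     \tr ((M (switch x y f) - M f) *m F (M (switch x y f)))) =
  4 * ((#|H|%:R - 1) * mean (fun f => \tr (M f *m F (M f)) + eps * \tr (F (M f)))).
  transitivity (- mean (fun f => \sum_x \sum_y
      \tr ((M (switch x y f) - M f) *m F (M f)))); last by rewrite E; ring.
  rewrite mean_sum [in RHS]mean_sum -sumrN; apply: eq_bigr => x _.
  rewrite mean_sum [in RHS]mean_sum -sumrN; apply: eq_bigr => y _.
  rewrite (mean_swap x y (fun f f' => \tr ((M f' - M f) *m F (M f')))) -meanN.
  by apply: eq_mean => f; rewrite -[M f - _]opprB mulNmx raddfN.
transitivity (4 * ((#|H|%:R - 1) * mean (fun f => \tr (M f *m F (M f)) + eps * \tr (F (M f))))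
  - - 4 * ((#|H|%:R - 1) * mean (fun f => \tr (M f *m F (M f)) + eps * \tr (F (M f))))).
  by ring.
rewrite -E -E' -meanB; apply: eq_mean => f; rewrite -sumrB; apply: eq_bigr => x _.
by rewrite -sumrB; apply: eq_bigr => y _; rewrite mulmxBr raddfB.
Qed.

(** Resampling the partner of each half-edge by [mean_partner]. The excluded [y = pi f x] leaves a
    trace, which is the [eps] term on the left. Here [F] may depend on the whole matching, as the
    test function requires. *)
Lemma lapm_loop (F : matching H -> 'M[R]_n) :
  (forall f, (F f)^T = F f) ->
  (#|H|%:R - 1) * mean (fun f => \tr (M f *m F f) + eps * \tr (F f)) =
  s * mean (fun f => \sum_x \sum_y
    bform (F (switch x y f) - F f) (u x) (u (pi f y))).
Proof.
move=> sF.
have E1 : (#|H|%:R - 1) * mean (fun f => \sum_x bform (F f) (u x) (u (pi f x))) =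
   mean (fun f => \sum_x \sum_(y | pi f x != y)
      bform (F (switch x y f)) (u x) (u (pi f y))).
  rewrite !mean_sum mulr_sumr; apply: eq_bigr => x _.
  by rewrite (mean_partner x (fun b f => bform (F f) (u x) (u b))).
have E2 f : \sum_x \sum_(y | pi f x != y) bform (F f) (u x) (u (pi f y)) =
    bform (F f) g g - \tr (F f).
  rewrite trE {1}/gvec bform_suml -sumrB; apply: eq_bigr => x _.
  rewrite bform_sumr -(reindex_partner f) [in RHS](bigD1 (pi f x))//= partnerK.
  rewrite addrAC subrr add0r; apply: eq_bigl => y; by rewrite eq_sym.
have -> : mean (fun f => \sum_x \sum_y bform (F (switch x y f) - F f) (u x) (u (pi f y))) =
   mean (fun f => \sum_x \sum_(y | pi f x != y)
      bform (F (switch x y f)) (u x) (u (pi f y))) -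
   mean (fun f => bform (F f) g g - \tr (F f)).
  rewrite -meanB; apply: eq_mean => f; rewrite -E2 -sumrB; apply: eq_bigr => x _.
  rewrite -sumrB (bigD1 (pi f x))//= switch_id// subrr.
  rewrite {1}/bform mulmx0 mul0mx mxE add0r.
  apply: eq_big => [y|y _]; first by rewrite eq_sym.
  by rewrite bformBm.
rewrite -E1 -!meanZ -meanB -meanZ; apply: eq_mean => f.
rewrite trM_lapm// /eps /csub.
by set S := \sum_x _; field; exact: card_H_neq1.
Qed.

End LaplacianOfMatching.

(** * Bounds on the spectral moments *)

(** The product of the factors lost at the successive induction steps of [mean_ell_le]. *)
Definition ell_const (R : realType) (q : nat) : R :=
  \prod_(i < q) (2 ^+ i.+1 + 4).

(** The recursion closed by [mean_trX_le]: half of the top moment is absorbed there, and doubling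
    turns the coefficients 1/4 and 16 into 1/2 and 32. *)
Fixpoint moment_const (R : realType) (p : nat) : R :=
  if p is p'.+1 then
    2^-1 * moment_const R p' +
    32 * p'.*2.+1%:R * (64 * p'.*2.+1%:R) ^+ p' * ell_const R p
  else 1.

Section MomentBound.
Variables (R : realType) (n : nat) (H : finType).
Variables (v : H -> 'I_n) (deg : 'I_n -> nat) (s dmin : R).
Hypothesis deg_gt0 : forall i, (0 < deg i)%N.
Hypothesis card_fiber : forall i, #|[set x | v x == i]%SET| = deg i.
Hypothesis card_H : (1 < #|H|)%N.
Hypothesis card_matching : (0 < #|{: matching H}|)%N.
Hypothesis s_ge0 : 0 <= s.
Hypothesis s_sqr : s ^+ 2 * n%:R = #|H|%:R.
Hypothesis dmin_gt0 : 0 < dmin.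
Hypothesis dmin_le : forall i, dmin <= (deg i)%:R.
Hypothesis s_le_dmin : s <= dmin.
Hypothesis eps_le : shift_coef H s <= 2^-1.

Local Notation M := (lapm v deg s).
Local Notation u := (uvec R v deg).
Local Notation kap := (@kap R n H v deg).
Local Notation pi := (@partner H).
Local Notation eps := (shift_coef H s).
Implicit Types (f : matching H) (x y z : H) (i : 'I_n).

Let kap_ge0 := kap_ge0 R v deg_gt0.

Lemma kap_le_dmin x : kap x <= dmin^-1.
Proof. by rewrite lef_pV2 ?posrE ?ltr0n. Qed.

(* By exchangeability, s^2 times the mean inverse degree of the neighbours of i
   is of order 1; a small minimum degree is what could make it fluctuate. *)
Definition ell f i : R :=
  s ^+ 2 * (deg i)%:R^-1 * \sum_(x | v x == i) kap (pi f x).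

Lemma ell_ge0 f i : 0 <= ell f i.
Proof. by rewrite !mulr_ge0 ?sqr_ge0 ?invr_ge0// sumr_ge0. Qed.

(** Only [x], [y] and their two partners can change partner. *)
Lemma kap_switch_le x y f z : kap (pi (switch x y f) z) <= kap (pi f z) +
  dmin^-1 * ((z == x)%:R + (z == y)%:R + (z == pi f x)%:R + (z == pi f y)%:R).
Proof.
have d0 : 0 <= dmin^-1 by rewrite invr_ge0 ltW.
have b0 (b : bool) : 0 <= b%:R :> R by [].
case: (boolP ((z == x) || (z == y) || (z == pi f x) || (z == pi f y))) => [h|].
  apply: (le_trans (kap_le_dmin _)).
  rewrite -[X in X <= _]add0r lerD// -[X in X <= _]mulr1 ler_wpM2l//.
  by move: h; do 4 case: eqP => _ //=; rewrite ?addr0 ?add0r ?lerDr ?lerDl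
    ?addr_ge0// -?addrA ?lerDl ?addr_ge0.
rewrite !negb_or -!andbA => /and4P[zx zy zfx zfy].
rewrite switchE [tperm x y z]tpermD 1?eq_sym// tpermD ?lerDl ?mulr_ge0 ?addr_ge0//.
  by rewrite eq_sym eq_partner.
by rewrite eq_sym eq_partner.
Qed.

Lemma sum_fiber_cst i (c : R) : \sum_(x | v x == i) c = (deg i)%:R * c.
Proof. by rewrite sumr_const -cardsE card_fiber mulr_natl. Qed.

Lemma s_sqr_le : s ^+ 2 <= dmin ^+ 2.
Proof. by rewrite lerXn2r ?nnegrE// ltW. Qed.

(** Each of the four modified half-edges costs at most [s ^+ 2 / (deg i * dmin)], which is at most 1
    since [s <= dmin]. *)
Lemma ell_switch_le x y f i : ell (switch x y f) i <= ell f i + 4.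
Proof.
have c0 : 0 <= s ^+ 2 * (deg i)%:R^-1 by rewrite mulr_ge0 ?sqr_ge0 ?invr_ge0.
have cl : s ^+ 2 * (deg i)%:R^-1 * dmin^-1 <= 1.
  have h : (deg i)%:R^-1 <= dmin^-1 by rewrite lef_pV2 ?posrE ?ltr0n.
  have d0 : 0 <= dmin^-1 by rewrite invr_ge0 ltW.
  apply: (@le_trans _ _ (s ^+ 2 * dmin^-1 * dmin^-1)).
    by rewrite ler_wpM2r// ler_wpM2l ?sqr_ge0.
  rewrite -mulrA -invfM -expr2 ler_pdivrMr ?exprn_gt0// mul1r; exact: s_sqr_le.
have S1 w : \sum_(z | v z == i) (z == w)%:R <= 1 :> R.
  case: (boolP (v w == i)) => [vw|vw].
    rewrite (bigD1 w)//= eqxx big1 ?addr0// => z /andP[_ /negbTE ->]; exact: mulr0n.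
  rewrite big1// => z vz; case: eqP => // zw; by rewrite -zw vz in vw.
apply: (@le_trans _ _ (s ^+ 2 * (deg i)%:R^-1 * (\sum_(z | v z == i) kap (pi f z) +
   dmin^-1 * 4))).
  rewrite ler_wpM2l//; apply: (le_trans (ler_sum _ (fun z _ => kap_switch_le x y f z))).
  rewrite big_split /= lerD2l -mulr_sumr ler_wpM2l ?invr_ge0 ?(ltW dmin_gt0)//.
  rewrite !big_split /=.
  have -> : (4 : R) = 1 + 1 + 1 + 1 by ring.
  by rewrite !lerD ?S1.
rewrite mulrDr lerD2l mulrA -[leRHS]mul1r ler_wpM2r//.
Qed.

Lemma card_ratio_le2 : #|H|%:R / (#|H|%:R - 1) <= 2 :> R.
Proof.
have D1 := @card_H_sub1 R H card_H.
rewrite ler_pdivrMr//.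
have : 2 <= #|H|%:R :> R by rewrite (ler_nat _ 2).
by lra.
Qed.

(** Induction on [q], resampling the partner that appears in one factor [ell]. The shift by 4 makes
    [ell_switch_le] multiplicative: the other factors at most double. The resampled inverse degree
    averages to [n / (#|H| - 1)], and [s ^+ 2] times this is at most 2. *)
Lemma mean_ell_le q i : mean (fun f => (ell f i + 4) ^+ q) <= ell_const R q.
Proof.
have a4 f : 0 <= ell f i + 4 by rewrite addr_ge0// ell_ge0.
elim: q => [|q IH].
  by under eq_mean do rewrite expr0; rewrite mean_cst// /ell_const big_ord0.
have B : mean (fun f => ell f i * (ell f i + 4) ^+ q) <=
    2 ^+ q.+1 * mean (fun f => (ell f i + 4) ^+ q).
  have X x : mean (fun f => kap (pi f x) * (ell f i + 4) ^+ q) <=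
      (#|H|%:R - 1)^-1 * (n%:R * 2 ^+ q * mean (fun f => (ell f i + 4) ^+ q)).
    rewrite ler_pdivlMl ?card_H_sub1//.
    rewrite (mean_partner x (fun b f => kap b * (ell f i + 4) ^+ q)) -meanZ.
    apply: ler_mean => f; rewrite big_mkcond /=.
    apply: (@le_trans _ _ (\sum_y kap (pi f y) * (2 ^+ q * (ell f i + 4) ^+ q))).
      apply: ler_sum => y _; case: ifP => _; last first.
        by rewrite !mulr_ge0 ?exprn_ge0.
      rewrite ler_wpM2l// -exprMn lerXn2r ?nnegrE// ?mulr_ge0//.
      by have := ell_switch_le x y f i; have := ell_ge0 f i; lra.
    rewrite -mulr_suml (reindex_partner f kap) sum_kap1//.
    by rewrite mulrA.
  have -> : mean (fun f => ell f i * (ell f i + 4) ^+ q) =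
     s ^+ 2 * (deg i)%:R^-1 *
       \sum_(x | v x == i) mean (fun f => kap (pi f x) * (ell f i + 4) ^+ q).
    rewrite -mean_sum -meanZ; apply: eq_mean => f.
    by rewrite /ell -mulrA mulr_suml.
  apply: (@le_trans _ _ (s ^+ 2 * (deg i)%:R^-1 * \sum_(x | v x == i)
     ((#|H|%:R - 1)^-1 * (n%:R * 2 ^+ q * mean (fun f => (ell f i + 4) ^+ q))))).
    rewrite ler_wpM2l ?mulr_ge0 ?sqr_ge0 ?invr_ge0//.
    by apply: ler_sum => x _.
  rewrite sum_fiber_cst.
  rewrite (mulrA (s ^+ 2 / (deg i)%:R)) mulfVK ?pnatr_eq0 -?lt0n//.
  set E := mean _; have E0 : 0 <= E by apply: mean_ge0 => f; rewrite exprn_ge0.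
  have -> : s ^+ 2 * ((#|H|%:R - 1)^-1 * (n%:R * 2 ^+ q * E)) =
     (s ^+ 2 * n%:R) / (#|H|%:R - 1) * (2 ^+ q * E) by ring.
  rewrite s_sqr exprS -[leRHS]mulrA; apply: ler_wpM2r.
    by apply: mulr_ge0 => //; apply: exprn_ge0.
  exact: card_ratio_le2.
have -> : mean (fun f => (ell f i + 4) ^+ q.+1) =
   mean (fun f => ell f i * (ell f i + 4) ^+ q) + 4 * mean (fun f => (ell f i + 4) ^+ q).
  by rewrite -meanZ -meanD; apply: eq_mean => f; rewrite exprS mulrDl.
rewrite /ell_const big_ord_recr /= -/(ell_const R q) [leRHS]mulrC.
apply: (@le_trans _ _ ((2 ^+ q.+1 + 4) * mean (fun f => (ell f i + 4) ^+ q))).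
  by rewrite [leRHS]mulrDl lerD2r.
by rewrite ler_wpM2l ?addr_ge0 ?exprn_ge0.
Qed.

(** The four pairs with one end in [x], [y] and the other in their partners, as they arise when
    products of [p] and [q] are expanded. *)
Definition pair_sum f x y (b : 'I_n -> R) : R :=
  let pr z w := kap z * kap w * (b (v z) + b (v w)) in
  pr x (pi f x) + pr x (pi f y) + pr y (pi f x) + pr y (pi f y).

(** The two matched pairs couple each vertex to its neighbours and give [ell]. In the two crossed
    pairs the ends vary independently, the sum factorizes, and the weight is 1. *)
Lemma sum_pair_sum f b : s ^+ 2 * (\sum_x \sum_y pair_sum f x y b) =
  4 * #|H|%:R * \sum_i (ell f i + 1) * b i.
Proof.
pose L := \sum_x kap x * kap (pi f x) * b (v x).
have LE : s ^+ 2 * L = \sum_i ell f i * b i.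
  rewrite /L (partition_big v xpredT)//= mulr_sumr; apply: eq_bigr => i _.
  rewrite /ell !mulr_sumr mulr_suml; apply: eq_bigr => x /eqP vx.
  by rewrite /kap vx; ring.
pose pr z w := kap z * kap w * (b (v z) + b (v w)).
have P1 : \sum_x pr x (pi f x) = 2 * L.
  have L' : L = \sum_x kap (pi f x) * kap x * b (v (pi f x)).
    by rewrite /L -(reindex_partner f); apply: eq_bigr => x _; rewrite partnerK.
  transitivity (L + L); last by ring.
  rewrite {2}L' /L -big_split /=.
  by apply: eq_bigr => x _; rewrite /pr; ring.
have P2 : \sum_x \sum_y pr x y = 2 * (n%:R * \sum_i b i).
  have Q : \sum_x \sum_y kap x * kap y * b (v x) = n%:R * \sum_i b i.
    rewrite -(sum_kap deg_gt0 card_fiber b) mulr_sumr; apply: eq_bigr => x _.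
    rewrite -(sum_kap1 R deg_gt0 card_fiber) mulr_suml; apply: eq_bigr => y _; ring.
  transitivity (n%:R * \sum_i b i + n%:R * \sum_i b i); last by ring.
  rewrite -{1}Q -Q [X in _ + X]exchange_big -big_split /=.
  apply: eq_bigr => x _; rewrite -big_split /=; apply: eq_bigr => y _.
  by rewrite /pr; ring.
have -> : \sum_x \sum_y pair_sum f x y b =
   4 * #|H|%:R * L + 4 * (n%:R * \sum_i b i).
  rewrite (eq_bigr (fun x => \sum_(y : H) pr x (pi f x) + \sum_y pr x (pi f y)
     + \sum_y pr y (pi f x) + \sum_y pr y (pi f y))); last first.
    by move=> x _; rewrite -!big_split.
  rewrite !big_split /=.
  have -> : \sum_x \sum_(y : H) pr x (pi f x) = #|H|%:R * (2 * L).
    by rewrite -P1 mulr_sumr; apply: eq_bigr => x _; rewrite sumr_const mulr_natl.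
  have -> : \sum_(x : H) \sum_y pr y (pi f y) = #|H|%:R * (2 * L).
    by rewrite -P1 sumr_const mulr_natl.
  have -> : \sum_x \sum_y pr x (pi f y) = 2 * (n%:R * \sum_i b i).
    by rewrite -P2; apply: eq_bigr => x _; rewrite (reindex_partner f (pr x)).
  have -> : \sum_x \sum_y pr y (pi f x) = 2 * (n%:R * \sum_i b i).
    by rewrite (reindex_partner f (fun z => \sum_y pr y z)) exchange_big.
  ring.
under [in RHS]eq_bigr do rewrite mulrDl mul1r.
rewrite big_split /= -LE mulrDr.
by rewrite [s ^+ 2 * (4 * (n%:R * _))]mulrCA [s ^+ 2 * (n%:R * _)]mulrA s_sqr; ring.
Qed.

Section Perturbation.
Variables (x y : H) (f : matching H).
Let p := u x - u y.
Let q := u (pi f x) - u (pi f y).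
Local Notation f' := (switch x y f).

(** The common bound for all placements of two insertions of the perturbation, symmetric in [p] and
    [q]. *)
Definition Phi (A : 'M[R]_n) : R :=
  s ^+ 2 * (bform 1 q q * bform A p p + bform 1 p p * bform A q q).

Lemma mxtrace_outer2 (A B : 'M[R]_n) (a b c d : 'rV[R]_n) :
  \tr (a^T *m b *m A *m (c^T *m d) *m B) = bform A b c * bform B d a.
Proof. by rewrite -!mulmxA mulmxA mxtrace_outer !mulmxA -bform_outer !mulmxA. Qed.

Lemma tr_dAdB (A B : 'M[R]_n) : A^T = A -> B^T = B -> pi f x != y ->
  \tr ((M f' - M f) *m A *m (M f' - M f) *m B) =
  s ^+ 2 * (2 * (bform A p q * bform B p q) + bform A q q * bform B p p
            + bform A p p * bform B q q).
Proof.
move=> sA sB fxy; rewrite lapm_switchN// -/p -/q.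
clearbody p q.
rewrite -!scalemxAl -!scalemxAr -!scalemxAl scalerA mxtraceZ mulrNN -expr2.
congr (_ * _); rewrite !mulmxDl mulmxDr mulmxDr !mulmxDl !raddfD /=.
rewrite !mxtrace_outer2 (bformC q p sA) (bformC q p sB).
ring.
Qed.

Lemma Phi_ge0 k : ~~ odd k -> 0 <= Phi (M f ^+ k) /\ 0 <= Phi (M f' ^+ k).
Proof.
move=> ek; split; rewrite /Phi mulr_ge0 ?sqr_ge0// addr_ge0// mulr_ge0 ?bform1_ge0//;
  by rewrite bform_even_ge0// lapm_sym.
Qed.

(** Telescoping gives [k.+1] traces in which a total power [k] is shared between the old and the new
    matrix; the Young inequalities move all of it onto one of them. *)
Lemma tr_diffX_le k : ~~ odd k ->
  \tr ((M f' - M f) *m (M f' ^+ k.+1 - M f ^+ k.+1)) <=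
  2 * k.+1%:R * (Phi (M f ^+ k) + Phi (M f' ^+ k)).
Proof.
move=> ek; have [P0 P0'] := Phi_ge0 ek.
case: (eqVneq (pi f x) y) => [fxy|fxy].
  have -> : M f' - M f = 0 by rewrite switch_id// subrr.
  rewrite mul0mx mxtrace0; apply: mulr_ge0; first exact: mulr_ge0.
  exact: (addr_ge0 P0 P0').
rewrite exprmx_diff mulmx_sumr raddf_sum /=.
set X := Phi _ + Phi _.
have -> : 2 * k.+1%:R * X = \sum_(i < k.+1) 2 * X.
  by rewrite sumr_const card_ord -[RHS]mulr_natl; ring.
rewrite /X.
apply: ler_sum => i _; rewrite subSS !mulmxA.
have ik : (i + (k - i))%N = k by rewrite subnKC// -ltnS.
rewrite tr_dAdB ?exprmx_sym ?lapm_sym//.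
rewrite /Phi -mulrDr [leRHS]mulrCA; apply: ler_wpM2l; first exact: sqr_ge0.
have eik : ~~ odd (i + (k - i)) by rewrite ik.
have sM := lapm_sym v deg s f; have sM' := lapm_sym v deg s f'.
have h1 := bform_Young_cross p q sM sM' eik.
have h2 := bform_Young_diag p q sM sM' eik.
have h3 := bform_Young_diag q p sM sM' eik.
rewrite !ik in h1 h2 h3; move: h1 h2 h3; clear.
move: (bform (M f ^+ i) p q) (bform (M f ^+ i) q q) (bform (M f ^+ i) p p).
move: (bform (M f' ^+ (k - i)) p q) (bform (M f' ^+ (k - i)) q q).
move: (bform (M f' ^+ (k - i)) p p).
move: (bform (M f ^+ k) p p) (bform (M f ^+ k) q q).
move: (bform (M f' ^+ k) p p) (bform (M f' ^+ k) q q).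
move: (bform 1 p p) (bform 1 q q) => ip iq Bp Bq Ap Aq b3 b2 b1 a1 a2 a3.
move=> /(le_trans (ler_wpM2l (ler0n _ 2) (ler_norm _))) h1.
move=> /(le_trans (ler_norm _)) h2 /(le_trans (ler_norm _)) h3.
by lra.
Qed.

Lemma bform_sub_le k (a b : 'rV[R]_n) : ~~ odd k ->
  bform (M f ^+ k) (a - b) (a - b) <= 2 * (bform (M f ^+ k) a a + bform (M f ^+ k) b b).
Proof.
move=> ek.
have h := @bform_even_ge0 R n (M f) (a + b) k (lapm_sym v deg s f) ek.
have sMk := exprmx_sym k (lapm_sym v deg s f).
rewrite !bformBl !bformBr; rewrite -[b in a + b]opprK in h.
rewrite !bformBl !bformBr !bformNl !bformNr in h.
by rewrite (bformC b a sMk) in h *; lra.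
Qed.

Lemma Phi_le_pair_sum k : ~~ odd k ->
  Phi (M f ^+ k) <= 4 * s ^+ 2 * pair_sum f x y (fun i => (M f ^+ k) i i).
Proof.
move=> ek; rewrite /Phi [4 * _]mulrC -[leRHS]mulrA; apply: ler_wpM2l; first exact: sqr_ge0.
have e0 : ~~ odd 0 by [].
have h1 := bform_sub_le (u x) (u y) ek.
have h2 := bform_sub_le (u (pi f x)) (u (pi f y)) ek.
have h3 := bform_sub_le (u x) (u y) e0.
have h4 := bform_sub_le (u (pi f x)) (u (pi f y)) e0.
rewrite !expr0 in h3 h4; rewrite !bform_uvec_diag// in h1 h2 h3 h4.
rewrite !mxE !eqxx !mulr1 in h3 h4.
have g (w : 'rV[R]_n) := @bform_even_ge0 R n (M f) w k (lapm_sym v deg s f) ek.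
have := ler_pM (bform1_ge0 q) (g p) h4 h1.
have := ler_pM (bform1_ge0 p) (g q) h3 h2.
rewrite /pair_sum -/p -/q; lra.
Qed.

End Perturbation.

(** A nontrivial switching keeps [p] and replaces [q] by its opposite. With exchangeability, the
    terms of [tr_diffX_le] at the new matrix have the same mean as those at the old one. *)
Lemma Phi_switch x y f A : Phi x y (switch x y f) A = Phi x y f A.
Proof.
rewrite /Phi !switchE tpermL tpermR.
case: (eqVneq (pi f x) y) => [fxy|fxy].
  have fyx : pi f y = x by rewrite -fxy partnerK.
  by rewrite fyx fxy tpermL tpermR.
have fyx : pi f y != x by rewrite eq_partner eq_sym.
rewrite !tpermD 1?eq_sym ?partner_neq//.
set p := u x - u y; set q := u (pi f x) - u (pi f y).
have -> : u (pi f y) - u (pi f x) = - q by rewrite opprB.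
by rewrite !bformNl !bformNr !opprK.
Qed.

(** [lapm_Stein] for the power [k.+1]: the degree drops by two, at the price of the random weight
    [ell + 1] on the diagonal. *)
Lemma mean_moment_step k : ~~ odd k ->
  mean (fun f => \tr (M f ^+ k.+2) + eps * \tr (M f ^+ k.+1)) <=
  16 * k.+1%:R * mean (fun f => \sum_i (ell f i + 1) * (M f ^+ k) i i).
Proof.
move=> ek; have D1 := @card_H_sub1 R H card_H.
have S := @lapm_Stein R n H v deg s deg_gt0 card_fiber card_H (fun A => A ^+ k.+1)
  (fun f => exprmx_sym k.+1 (lapm_sym v deg s f)).
rewrite /= (eq_mean (Y := fun f => \tr (M f ^+ k.+2) + eps * \tr (M f ^+ k.+1))) in S;
  last by move=> f; rewrite -exprmxS.
set E := mean _ in S *; set E' := mean (fun f => \sum_i _).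
have key : 8 * ((#|H|%:R - 1) * E) <= 4 * k.+1%:R * (16 * #|H|%:R * E').
  rewrite S.
  apply: (@le_trans _ _ (\sum_x \sum_y (2 * k.+1%:R *
     (mean (fun f => Phi x y f (M f ^+ k)) + mean (fun f => Phi x y f (M f ^+ k)))))).
    rewrite mean_sum; apply: ler_sum => x _; rewrite mean_sum; apply: ler_sum => y _.
    have Ph : mean (fun f => Phi x y f (M (switch x y f) ^+ k)) =
        mean (fun f => Phi x y f (M f ^+ k)).
      transitivity (mean (fun f => Phi x y (switch x y f) (M f ^+ k))).
        exact: (mean_swap x y (fun f f' => Phi x y f (M f' ^+ k))).
      by apply: eq_mean => f; exact: Phi_switch.
    rewrite -{2}Ph; clear Ph.
    rewrite -(meanD (fun f => Phi x y f (M f ^+ k))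
      (fun f => Phi x y f (M (switch x y f) ^+ k))).
    by rewrite -meanZ; apply: ler_mean => f; exact: tr_diffX_le.
  have -> : 16 * #|H|%:R * E' = \sum_x \sum_y mean (fun f =>
      4 * s ^+ 2 * pair_sum f x y (fun i => (M f ^+ k) i i)).
    rewrite -meanZ -[RHS](eq_bigr _ (fun x _ => mean_sum _ _ _)) -mean_sum.
    apply: eq_mean => f.
    transitivity (4 * (4 * #|H|%:R * \sum_i (ell f i + 1) * (M f ^+ k) i i)); first by ring.
    rewrite -sum_pair_sum mulrA mulr_sumr; apply: eq_bigr => x _.
    by rewrite mulr_sumr.
  rewrite mulr_sumr; apply: ler_sum => x _; rewrite mulr_sumr; apply: ler_sum => y _.
  set m := mean _; have -> : 2 * k.+1%:R * (m + m) = 4 * k.+1%:R * m by ring.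
  apply: ler_wpM2l; first by rewrite mulr_ge0.
  by apply: ler_mean => f; exact: Phi_le_pair_sum.
have E'0 : 0 <= E'.
  apply: mean_ge0 => f; apply: sumr_ge0 => i _; rewrite mulr_ge0 ?addr_ge0 ?ell_ge0//.
  have := @bform_even_ge0 R n (M f) (delta_mx 0 i) k (lapm_sym v deg s f) ek.
  by rewrite /bform -rowE trmx_delta -colE !mxE.
have : #|H|%:R / (#|H|%:R - 1) * (8 * k.+1%:R * E') <= 2 * (8 * k.+1%:R * E').
  by apply: ler_wpM2r; [apply: mulr_ge0 => //; apply: mulr_ge0|exact: card_ratio_le2].
have -> : 2 * (8 * k.+1%:R * E') = 16 * k.+1%:R * E' by ring.
apply: le_trans; rewrite mulrAC ler_pdivlMr// mulrC.
have : 4 * k.+1%:R * (16 * #|H|%:R * E') = 8 * (#|H|%:R * (8 * k.+1%:R * E')) by ring.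
by move=> eq; rewrite eq in key; lra.
Qed.

Lemma bform_delta (A : 'M[R]_n) i : bform A (delta_mx 0 i) (delta_mx 0 i) = A i i.
Proof. by rewrite /bform -rowE trmx_delta -colE !mxE. Qed.

Lemma moment_const_ge0 p : 0 <= moment_const R p.
Proof.
elim: p => //= p IH; rewrite addr_ge0 ?mulr_ge0 ?invr_ge0 ?exprn_ge0//.
by apply: prodr_ge0 => i _; rewrite addr_ge0 ?exprn_ge0.
Qed.

Lemma mean_trX_le p : mean (fun f => \tr (M f ^+ p.*2)) <= moment_const R p * n%:R.
Proof.
elim: p => [|p IH].
  under eq_mean do rewrite double0 expr0 mxtrace1.
  by rewrite mean_cst// mul1r.
set k := p.*2 in IH *; have ek : ~~ odd k by rewrite odd_double.
set K : R := k.+1%:R.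
have K0 : 0 < K by rewrite ltr0n.
have step := mean_moment_step ek.
have eps0 : 0 <= eps by rewrite mulr_ge0// invr_ge0 ltW// card_H_sub1.
(* The choice [eta = (64 * K)^-1] in [bform_interpolate] makes the weighted sum cost only a quarter
   of the top moment. *)
have bnd f : 16 * K * (\sum_i (ell f i + 1) * (M f ^+ k) i i) <=
    4^-1 * \tr (M f ^+ k.+2) + 16 * K * (64 * K) ^+ p * \sum_i (ell f i + 4) ^+ p.+1.
  rewrite /mxtrace !mulr_sumr -big_split; apply: ler_sum => i _ /=.
  have e0 : 0 < (64 * K)^-1 by rewrite invr_gt0 mulr_gt0.
  have x0 : 0 <= ell f i + 1 by rewrite addr_ge0// ell_ge0.
  have := bform_interpolate p (delta_mx 0 i) (lapm_sym v deg s f) x0 e0.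
  have one : bform 1 (delta_mx 0 i) (delta_mx 0 i) = 1 :> R.
    by rewrite bform_delta mxE eqxx.
  rewrite one !bform_delta mulr1 exprVn invrK -/k doubleS -/k.
  have K16 : 0 <= 16 * K by rewrite mulr_ge0// ltW.
  move=> /(ler_wpM2l K16)/le_trans; apply.
  rewrite mulrDr; apply: lerD.
    rewrite mulrA; have -> : 16 * K / (64 * K) = 4^-1 by field; rewrite lt0r_neq0.
    by [].
  rewrite !mulrA ler_wpM2l ?mulr_ge0 ?exprn_ge0 ?mulr_ge0 ?(ltW K0)//.
  by rewrite lerXn2r ?nnegrE ?addr_ge0 ?ell_ge0// lerD2l ler1n.
(* As [eps <= 1/2], the odd moment costs another quarter of the top moment. *)
have odd_bnd f : - (4^-1 * (\tr (M f ^+ k) + \tr (M f ^+ k.+2))) <= eps * \tr (M f ^+ k.+1).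
  have h := @norm_trX_odd_le R n (M f) p (lapm_sym v deg s f).
  rewrite doubleS -/k in h.
  have h2 : eps * `|\tr (M f ^+ k.+1)| <= 2^-1 * `|\tr (M f ^+ k.+1)|.
    by rewrite ler_wpM2r.
  have h3 : - (eps * `|\tr (M f ^+ k.+1)|) <= eps * \tr (M f ^+ k.+1).
    by rewrite -mulrN ler_wpM2l// lerNl -normrN ler_norm.
  by lra.
rewrite doubleS -/k /=.
set T := mean (fun f => \tr (M f ^+ k.+2)).
have l1 : T - 4^-1 * (mean (fun f => \tr (M f ^+ k)) + T) <=
    mean (fun f => \tr (M f ^+ k.+2) + eps * \tr (M f ^+ k.+1)).
  rewrite /T -meanD -meanZ -meanB; apply: ler_mean => f; rewrite lerD2l.
  exact: odd_bnd.
have l2 : 16 * K * mean (fun f => \sum_i (ell f i + 1) * (M f ^+ k) i i) <=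
    4^-1 * T + 16 * K * (64 * K) ^+ p * (ell_const R p.+1 * n%:R).
  apply: (@le_trans _ _ (4^-1 * T + 16 * K * (64 * K) ^+ p *
     mean (fun f => \sum_i (ell f i + 4) ^+ p.+1))).
    by rewrite /T -!meanZ -meanD; apply: ler_mean.
  rewrite lerD2l ler_wpM2l ?mulr_ge0 ?exprn_ge0 ?mulr_ge0 ?(ltW K0)//.
  rewrite mean_sum mulr_natr -[n in leRHS]card_ord -sumr_const.
  by apply: ler_sum => i _; exact: mean_ell_le.
rewrite -/K in step; rewrite mulrDl.
by move: IH l1 l2 step; set a := mean _; set b := mean _; set c := mean _; lra.
Qed.

End MomentBound.

(** * The loop equation *)

Section PairBounds.
Variable R : realType.
Implicit Types (a b c d m t : R).

Lemma sum4_sqr_le a b c d :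
  (a + b + c + d) ^+ 2 <= 4 * (a ^+ 2 + b ^+ 2 + c ^+ 2 + d ^+ 2).
Proof.
have := sqr_ge0 (a - b); have := sqr_ge0 (a - c); have := sqr_ge0 (a - d).
have := sqr_ge0 (b - c); have := sqr_ge0 (b - d); have := sqr_ge0 (c - d).
rewrite !expr2; lra.
Qed.

Lemma sum2_cube_le a b : 0 <= a -> 0 <= b ->
  (a + b) ^+ 3 <= 4 * (a ^+ 3 + b ^+ 3).
Proof.
move=> a0 b0; have : 0 <= (a + b) * (a - b) ^+ 2.
  by rewrite mulr_ge0 ?sqr_ge0 ?addr_ge0.
rewrite !exprS !expr0; lra.
Qed.

Lemma sum4_cube_le a b c d : 0 <= a -> 0 <= b -> 0 <= c -> 0 <= d ->
  (a + b + c + d) ^+ 3 <= 16 * (a ^+ 3 + b ^+ 3 + c ^+ 3 + d ^+ 3).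
Proof.
move=> a0 b0 c0 d0; rewrite -addrA.
have h := sum2_cube_le (addr_ge0 a0 b0) (addr_ge0 c0 d0).
have h1 := sum2_cube_le a0 b0; have h2 := sum2_cube_le c0 d0.
by move: h h1 h2; lra.
Qed.

Lemma mulr_le_cubes a b : 0 <= a -> 0 <= b ->
  a * b * (a + b) <= a ^+ 3 + b ^+ 3.
Proof.
move=> a0 b0; have : 0 <= (a + b) * (a - b) ^+ 2.
  by rewrite mulr_ge0 ?sqr_ge0 ?addr_ge0.
rewrite !exprS !expr0; lra.
Qed.

Lemma ge1_le_cubes a b : 1 <= a -> 1 <= b -> 2 * (a * b) <= a ^+ 3 + b ^+ 3.
Proof.
move=> a1 b1; have a0 : 0 <= a by lra.
have b0 : 0 <= b by lra.
apply: le_trans (mulr_le_cubes a0 b0); rewrite mulrC ler_wpM2l ?mulr_ge0//.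
by lra.
Qed.

(** Products of weights are replaced by sums of cubes, additive in the two half-edges and in the old
    and new matrix; only such sums can be averaged by [sum_pair_sum]. *)
Lemma cubes_bound1 a b c d c' d' : 1 <= a -> 1 <= b ->
  a ^+ 3 <= 4 * (c + d) -> b ^+ 3 <= 4 * (c' + d') ->
  a * b <= 2 * (c + c') + 2 * (d + d').
Proof. by move=> a1 b1; have := ge1_le_cubes a1 b1; lra. Qed.

Lemma cubes_bound2 a b c d c' d' : 0 <= a -> 0 <= b ->
  a ^+ 3 <= 4 * (c + d) -> b ^+ 3 <= 4 * (c' + d') ->
  2^-1 * (a * b * (a + b)) <= 2 * (c + c') + 2 * (d + d').
Proof. by move=> a1 b1; have := mulr_le_cubes a1 b1; lra. Qed.

Lemma sqrt_mul_le a b : 0 <= a -> 0 <= b ->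
  Num.sqrt a * Num.sqrt b <= 2^-1 * (a + b).
Proof.
move=> a0 b0; have := sqr_ge0 (Num.sqrt a - Num.sqrt b).
by rewrite sqrrB !sqr_sqrtr//; lra.
Qed.

End PairBounds.

Section LoopEquation.
Variables (R : realType) (n : nat) (H : finType).
Variables (v : H -> 'I_n) (deg : 'I_n -> nat) (s dmin : R).
Hypothesis deg_gt0 : forall i, (0 < deg i)%N.
Hypothesis card_fiber : forall i, #|[set x | v x == i]%SET| = deg i.
Hypothesis card_H : (1 < #|H|)%N.
Hypothesis card_matching : (0 < #|{: matching H}|)%N.
Hypothesis s_ge0 : 0 <= s.
Hypothesis s_sqr : s ^+ 2 * n%:R = #|H|%:R.
Hypothesis dmin_gt0 : 0 < dmin.
Hypothesis dmin_le : forall i, dmin <= (deg i)%:R.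
Hypothesis s_le_dmin : s <= dmin.
Hypothesis eps_le : shift_coef H s <= 2^-1.
Variable k : nat.

Local Notation M := (lapm v deg s).
Local Notation u := (uvec R v deg).
Local Notation kap := (@kap R n H v deg).
Local Notation pi := (@partner H).
Local Notation eps := (shift_coef H s).
Implicit Types (f : matching H) (x y z : H) (i : 'I_n).

Let kap_ge0 := kap_ge0 R v deg_gt0.
Let sM := lapm_sym v deg s.
Let sMX f j := exprmx_sym j (sM f).

(** Powers up to [k.+1] of both matrices occur in one product, and [bform_le_bound_mix] doubles the
    exponents. *)
Let N := k.+1.*2.
Let oddN : ~~ odd N. Proof. by rewrite odd_double. Qed.

(** * The effect of one switching up to second order *)

Section Pair.
Variables (x y : H) (f : matching H).
Let p := u x - u y.
Let q := u (pi f x) - u (pi f y).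
Variables (A A' : 'M[R]_n) (b0 b0' : 'I_n -> R).
Hypotheses (sA : A^T = A) (sA' : A'^T = A').
Hypotheses (b0_ge1 : forall i, 1 <= b0 i) (b0'_ge1 : forall i, 1 <= b0' i).
Hypothesis b0E : forall z, bform_bound N A (u z) = kap z * b0 (v z).
Hypothesis b0'E : forall z, bform_bound N A' (u z) = kap z * b0' (v z).
Let b z : R := b0 (v z) + b0' (v z).
Let Th z : R := Num.sqrt (kap z * b z).

Let b0_ge0 i : 0 <= b0 i. Proof. exact: le_trans ler01 (b0_ge1 i). Qed.
Let b0'_ge0 i : 0 <= b0' i. Proof. exact: le_trans ler01 (b0'_ge1 i). Qed.

Let b_ge1 z : 1 <= b z.
Proof. by apply: (le_trans (b0_ge1 (v z))); rewrite lerDl. Qed.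

Let b_ge0 z : 0 <= b z. Proof. exact: le_trans ler01 (b_ge1 z). Qed.

Let Th_ge0 z : 0 <= Th z. Proof. exact: sqrtr_ge0. Qed.

(** Domination by a rank-one kernel in the frame. Powers of [A] and [A'] satisfy it with [c = 1],
    and it is stable under inserting [Ediff]. *)
Let dom (c : R) (B : 'M[R]_n) :=
  forall z w, `|bform B (u z) (u w)| <= c * (Th z * Th w).

Let sqrt_bound_le z : Num.sqrt (bform_bound N A (u z)) <= Th z.
Proof. by rewrite ler_wsqrtr// b0E ler_wpM2l// lerDl. Qed.

Let sqrt_bound_le' z : Num.sqrt (bform_bound N A' (u z)) <= Th z.
Proof. by rewrite ler_wsqrtr// b0'E ler_wpM2l// lerDr. Qed.

Let dom_pow j : (j <= N)%N -> dom 1 (A ^+ j).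
Proof.
move=> jN z w; rewrite mul1r.
apply: (le_trans (bform_le_bound _ _ sA oddN jN)).
exact: ler_pM (sqrtr_ge0 _) (sqrtr_ge0 _) _ _.
Qed.

Let dom_pow' j : (j <= N)%N -> dom 1 (A' ^+ j).
Proof.
move=> jN z w; rewrite mul1r.
apply: (le_trans (bform_le_bound _ _ sA' oddN jN)).
exact: ler_pM (sqrtr_ge0 _) (sqrtr_ge0 _) _ _.
Qed.

Let dom_mix (i j : nat) : (i <= k.+1)%N -> (j <= k.+1)%N -> dom 1 (A' ^+ i *m A ^+ j).
Proof.
move=> ik jk z w; rewrite mul1r.
have iN : (i.*2 <= N)%N by rewrite leq_double.
have jN : (j.*2 <= N)%N by rewrite leq_double.
apply: (le_trans (bform_le_bound_mix _ _ sA' sA oddN iN jN)).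
exact: ler_pM (sqrtr_ge0 _) (sqrtr_ge0 _) _ _.
Qed.

Let T : R := (Th x + Th y) * (Th (pi f x) + Th (pi f y)).

Let T_ge0 : 0 <= T.
Proof. by rewrite mulr_ge0 ?addr_ge0. Qed.

Let ThT : Th x * Th (pi f y) <= T.
Proof. by apply: ler_pM => //; rewrite ?lerDl ?lerDr. Qed.

(** Kept in this form even if [x] and [y] are matched, although the actual change is then zero, so
    that sums can run over all pairs. *)
Definition Ediff : 'M[R]_n := - s *: (p^T *m q + q^T *m p).

Let dom_p c B z : dom c B -> `|bform B (u z) p| <= c * (Th z * (Th x + Th y)).
Proof.
move=> dA; rewrite bformBr; apply: (le_trans (ler_normB _ _)).
by rewrite mulrDr mulrDr lerD.
Qed.

Let dom_q c B z : dom c B ->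
  `|bform B (u z) q| <= c * (Th z * (Th (pi f x) + Th (pi f y))).
Proof.
move=> dA; rewrite bformBr; apply: (le_trans (ler_normB _ _)).
by rewrite mulrDr mulrDr lerD.
Qed.

Let dom_p' c B z : dom c B -> `|bform B p (u z)| <= c * ((Th x + Th y) * Th z).
Proof.
move=> dA; rewrite bformBl; apply: (le_trans (ler_normB _ _)).
by rewrite mulrDl mulrDr lerD.
Qed.

Let dom_q' c B z : dom c B ->
  `|bform B q (u z)| <= c * ((Th (pi f x) + Th (pi f y)) * Th z).
Proof.
move=> dA; rewrite bformBl; apply: (le_trans (ler_normB _ _)).
by rewrite mulrDl mulrDr lerD.
Qed.

Let bform_Ediff B C (a c : 'rV[R]_n) : bform (B *m Ediff *m C) a c =
  - s * (bform B a p * bform C q c + bform B a q * bform C p c).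
Proof.
rewrite /Ediff -scalemxAr -scalemxAl bformZm mulmxDr mulmxDl bformDm.
by rewrite !bform_outer.
Qed.

(** Each insertion of the perturbation costs a factor [2 * s * T]. *)
Let dom_sandwich c c' B C : 0 <= c -> 0 <= c' -> dom c B -> dom c' C ->
  dom (2 * s * T * (c * c')) (B *m Ediff *m C).
Proof.
move=> c0 c'0 dA dB z w; rewrite bform_Ediff normrM normrN (ger0_norm s_ge0).
have h1 := ler_pM (normr_ge0 _) (normr_ge0 _) (dom_p z dA) (dom_q' w dB).
have h2 := ler_pM (normr_ge0 _) (normr_ge0 _) (dom_q z dA) (dom_p' w dB).
have h3 := le_trans (ler_normD (bform B (u z) p * bform C q (u w))
                     (bform B (u z) q * bform C p (u w))) (lerD _ _).
have h := ler_wpM2l s_ge0 (h3 _ _ _ _); rewrite !normrM in h.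
apply: (le_trans (h _ _ h1 h2)); rewrite /T le_eqVlt; apply/orP; left; apply/eqP.
ring.
Qed.

Let tr_dom c B : 0 <= c -> dom c B -> `|\tr (Ediff *m B)| <= 2 * s * T * c.
Proof.
move=> c0 dA; rewrite /Ediff -scalemxAl mxtraceZ normrM normrN (ger0_norm s_ge0).
rewrite mulmxDl mxtraceD !mxtrace_outer.
have h1 : `|bform B q p| <= c * T.
  rewrite {1}/q bformBl; apply: (le_trans (ler_normB _ _)).
  apply: (le_trans (lerD (dom_p _ dA) (dom_p _ dA))).
  by rewrite /T le_eqVlt; apply/orP; left; apply/eqP; ring.
have h2 : `|bform B p q| <= c * T.
  rewrite {1}/p bformBl; apply: (le_trans (ler_normB _ _)).
  apply: (le_trans (lerD (dom_q _ dA) (dom_q _ dA))).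
  by rewrite /T le_eqVlt; apply/orP; left; apply/eqP; ring.
have h := ler_wpM2l s_ge0 (le_trans (ler_normD _ _) (lerD h1 h2)).
apply: (le_trans h); rewrite le_eqVlt; apply/orP; left; apply/eqP; ring.
Qed.

Definition pair_beta : R :=
  pair_sum v deg f x y (fun i => b0 i ^+ 3) +
  pair_sum v deg f x y (fun i => b0' i ^+ 3).

Let sT_ge0 : 0 <= 2 * s * T.
Proof. by apply: mulr_ge0 => //; apply: mulr_ge0. Qed.

(** The cube gains [dmin^-1] over the square, as one more factor [Th z * Th w] contains
    [Num.sqrt (kap z) * Num.sqrt (kap w)]. This gain is the origin of [s / dmin]. *)
Let Th_pair z w : (Th z * Th w) ^+ 2 <=
  kap z * kap w * (2 * (b0 (v z) ^+ 3 + b0 (v w) ^+ 3) +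
    2 * (b0' (v z) ^+ 3 + b0' (v w) ^+ 3)) /\
  (Th z * Th w) ^+ 3 <= dmin^-1 * (kap z * kap w *
    (2 * (b0 (v z) ^+ 3 + b0 (v w) ^+ 3) +
    2 * (b0' (v z) ^+ 3 + b0' (v w) ^+ 3))).
Proof.
have sq : (Th z * Th w) ^+ 2 = kap z * kap w * (b z * b w).
  by rewrite exprMn !sqr_sqrtr ?mulr_ge0// mulrACA.
have kk : 0 <= kap z * kap w by rewrite mulr_ge0.
have cub t : b t ^+ 3 <= 4 * (b0 (v t) ^+ 3 + b0' (v t) ^+ 3).
  by apply: sum2_cube_le.
have d0 : 0 <= dmin^-1 by rewrite invr_ge0 ltW.
split.
  by rewrite sq; apply: ler_wpM2l => //; exact: (cubes_bound1 _ _ (cub z) (cub w)).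
have le1 : Th z * Th w <= dmin^-1 * (2^-1 * (b z + b w)).
  have dk t : Th t <= Num.sqrt (dmin^-1 * b t).
    by rewrite ler_wsqrtr// ler_wpM2r// kap_le_dmin.
  apply: (le_trans (ler_pM (Th_ge0 z) (Th_ge0 w) (dk z) (dk w))).
  rewrite !sqrtrM// mulrACA -expr2 sqr_sqrtr//; apply: ler_wpM2l => //.
  exact: sqrt_mul_le.
rewrite exprS mulrC sq.
apply: (@le_trans _ _ (kap z * kap w * (b z * b w) * (dmin^-1 * (2^-1 * (b z + b w))))).
  by apply: ler_wpM2l => //; rewrite !mulr_ge0.
rewrite [leRHS]mulrCA -!mulrA; do 2 (apply: ler_wpM2l; first exact: kap_ge0).
have -> : b z * (b w * (dmin^-1 * (2^-1 * (b z + b w)))) =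
   dmin^-1 * (2^-1 * (b z * b w * (b z + b w))) by ring.
apply: ler_wpM2l => //.
exact: (cubes_bound2 _ _ (cub z) (cub w)).
Qed.

Let TE : T = Th x * Th (pi f x) + Th x * Th (pi f y) + Th y * Th (pi f x)
  + Th y * Th (pi f y).
Proof. by rewrite /T; ring. Qed.

Let T_sqr : T ^+ 2 <= 8 * pair_beta.
Proof.
rewrite TE; apply: (le_trans (sum4_sqr_le _ _ _ _)).
have [h1 _] := Th_pair x (pi f x); have [h2 _] := Th_pair x (pi f y).
have [h3 _] := Th_pair y (pi f x); have [h4 _] := Th_pair y (pi f y).
have h := lerD (lerD (lerD h1 h2) h3) h4.
apply: (le_trans (ler_wpM2l (ler0n _ 4) h)); rewrite /pair_beta /pair_sum.
by rewrite le_eqVlt; apply/orP; left; apply/eqP; ring.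
Qed.

Let T_cube : T ^+ 3 <= 32 * dmin^-1 * pair_beta.
Proof.
rewrite {1}TE; apply: (le_trans (sum4_cube_le _ _ _ _)); try exact: mulr_ge0.
have [_ h1] := Th_pair x (pi f x); have [_ h2] := Th_pair x (pi f y).
have [_ h3] := Th_pair y (pi f x); have [_ h4] := Th_pair y (pi f y).
have h := lerD (lerD (lerD h1 h2) h3) h4.
apply: (le_trans (ler_wpM2l (ler0n _ 16) h)); rewrite /pair_beta /pair_sum.
by rewrite le_eqVlt; apply/orP; left; apply/eqP; ring.
Qed.

(* The part of A' ^+ k - A ^+ k that is linear in Ediff = A' - A; it produces
   the products of traces in the loop equation. *)
Definition second_order : R :=
  \sum_(i < k) bform (A ^+ i *m Ediff *m A ^+ (k - i.+1)) (u x) (u (pi f y)).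

Let ord_leN (i : 'I_k) : (i <= N)%N.
Proof.
apply: (leq_trans (ltnW (ltn_ord i))).
by rewrite /N -addnn (leq_trans (leqnSn k)) ?leq_addr.
Qed.

Let sub_leN (m : nat) : (k - m <= N)%N.
Proof.
apply: (leq_trans (leq_subr _ _)).
by rewrite /N -addnn (leq_trans (leqnSn k)) ?leq_addr.
Qed.

Let second_order_le : `|second_order| <= k%:R * (2 * s * T ^+ 2).
Proof.
apply: (le_trans (ler_norm_sum _ _ _)).
rewrite mulr_natl -[k in leRHS]card_ord -sumr_const; apply: ler_sum => i _.
have h := dom_sandwich ler01 ler01 (dom_pow (ord_leN i)) (dom_pow (sub_leN i.+1)).
apply: (le_trans (h x (pi f y))).
have -> : 2 * s * T ^+ 2 = 2 * s * T * (1 * 1) * T by ring.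
by apply: ler_wpM2l ThT; rewrite !mulr1.
Qed.

(** Used at [y = pi f x], where nothing changes but the formula of [second_order] still has to be
    subtracted. *)
Lemma second_order_bound c : `|c| <= 1 ->
  `|c * second_order| <= 16 * k%:R * s * pair_beta.
Proof.
move=> c1; rewrite normrM -[leRHS]mul1r; apply: ler_pM => //.
apply: (le_trans second_order_le).
have -> : 16 * k%:R * s * pair_beta = k%:R * (2 * s * (8 * pair_beta)) by ring.
apply: ler_wpM2l => //; apply: ler_wpM2l T_sqr; exact: mulr_ge0.
Qed.

Hypothesis diffE : A' - A = Ediff.

(** Telescoping twice leaves at most [k ^ 2] words with two insertions, each bounded by
    [(2 * s * T) ^+ 2 * T]. *)
Let third_order_le :
  `|bform (A' ^+ k - A ^+ k) (u x) (u (pi f y)) - second_order| <=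
  k%:R ^+ 2 * (4 * s ^+ 2 * T ^+ 3).
Proof.
rewrite exprmx_diff bform_summ diffE /second_order -sumrB.
rewrite (eq_bigr (fun i : 'I_k => \sum_(j < k - i.+1)
  bform (A ^+ i *m Ediff *m (A ^+ j *m Ediff *m A' ^+ (k - i.+1 - j.+1)))
    (u x) (u (pi f y)))); last first.
  move=> i _; rewrite -bformBm -mulmxBr exprmx_diff diffE mulmx_sumr.
  by rewrite bform_summ.
have X0 : 0 <= 4 * s ^+ 2 * T ^+ 3.
  apply: mulr_ge0; last exact: exprn_ge0.
  by apply: mulr_ge0 => //; exact: sqr_ge0.
rewrite expr2 -mulrA mulr_natl -[k in leRHS]card_ord -sumr_const.
apply: (le_trans (ler_norm_sum _ _ _)); apply: ler_sum => i _.
apply: (@le_trans _ _ ((k - i.+1)%:R * (4 * s ^+ 2 * T ^+ 3))); last first.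
  by apply: ler_wpM2r => //; rewrite card_ord ler_nat leq_subr.
rewrite mulr_natl -[(k - _)%N in leRHS]card_ord -sumr_const.
apply: (le_trans (ler_norm_sum _ _ _)); apply: ler_sum => j _.
have jN : (j <= N)%N by rewrite (leq_trans (ltnW (ltn_ord j))).
have lN : (k - i.+1 - j.+1 <= N)%N by rewrite -subnDA.
have c0 : 0 <= 2 * s * T * (1 * 1) by rewrite !mulr1.
have h := dom_sandwich ler01 c0 (dom_pow (ord_leN i))
  (dom_sandwich ler01 ler01 (dom_pow jN) (dom_pow' lN)).
apply: (le_trans (h x (pi f y))).
have -> : 4 * s ^+ 2 * T ^+ 3 = 2 * s * T * (1 * (2 * s * T * (1 * 1))) * T by ring.
by apply: ler_wpM2l ThT; rewrite !mulr1 mul1r; exact: mulr_ge0.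
Qed.

Let tr_diff_le : `|\tr (A' ^+ k.+1) - \tr (A ^+ k.+1)| <= k.+1%:R * (2 * s * T).
Proof.
rewrite -raddfB /= exprmx_diff raddf_sum /= diffE.
apply: (le_trans (ler_norm_sum _ _ _)).
rewrite mulr_natl -[k.+1 in leRHS]card_ord -sumr_const; apply: ler_sum => i _.
rewrite -mulmxA mxtrace_mulC -mulmxA -[2 * s * T]mulr1.
have h := dom_mix (leq_subr i.+1 k.+1) (ltnW (ltn_ord i)).
exact: (tr_dom ler01 h).
Qed.

(** The first error term is the remainder of the expansion, the second the variation of the test
    function. The latter is O(1 / n), because the perturbation has bounded rank and moves the
    unnormalized trace by O([s * T]). *)
Lemma pair_error c c' : `|c| <= 1 ->
  `|c' - c| <= n%:R^-1 * `|\tr (A' ^+ k.+1) - \tr (A ^+ k.+1)| ->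
  `|bform (c' *: A' ^+ k - c *: A ^+ k) (u x) (u (pi f y)) - c * second_order|
  <= (128 * k%:R ^+ 2 * s ^+ 2 * dmin^-1 + 16 * k.+1%:R * s * n%:R^-1) * pair_beta.
Proof.
move=> c1 c'c.
have -> : bform (c' *: A' ^+ k - c *: A ^+ k) (u x) (u (pi f y)) - c * second_order
  = c * (bform (A' ^+ k - A ^+ k) (u x) (u (pi f y)) - second_order) +
    (c' - c) * bform (A' ^+ k) (u x) (u (pi f y)).
  by rewrite !bformBm !bformZm; ring.
apply: (le_trans (ler_normD _ _)); rewrite [leRHS]mulrDl; apply: lerD.
  rewrite normrM -[leRHS]mul1r; apply: ler_pM => //.
  apply: (le_trans third_order_le).
  have -> : 128 * k%:R ^+ 2 * s ^+ 2 * dmin^-1 * pair_beta =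
    k%:R ^+ 2 * (4 * s ^+ 2 * (32 * dmin^-1 * pair_beta)) by ring.
  apply: ler_wpM2l; first exact: sqr_ge0.
  by apply: ler_wpM2l T_cube; rewrite mulr_ge0 ?sqr_ge0.
have n0 : 0 <= n%:R^-1 :> R by rewrite invr_ge0.
have kN : (k <= N)%N by rewrite -[k]subn0 sub_leN.
have Tk : `|bform (A' ^+ k) (u x) (u (pi f y))| <= T.
  by apply: (le_trans (dom_pow' kN _ _)); rewrite mul1r.
rewrite normrM; apply: (le_trans (ler_pM (normr_ge0 _) (normr_ge0 _) c'c Tk)).
have -> : 16 * k.+1%:R * s * n%:R^-1 * pair_beta =
  n%:R^-1 * (k.+1%:R * (2 * s)) * (8 * pair_beta) by ring.
have h := ler_wpM2l n0 tr_diff_le.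
apply: (le_trans (ler_wpM2r T_ge0 h)).
have -> : n%:R^-1 * (k.+1%:R * (2 * s * T)) * T =
  n%:R^-1 * (k.+1%:R * (2 * s)) * T ^+ 2 by ring.
apply: ler_wpM2l T_sqr; apply: mulr_ge0 => //; apply: mulr_ge0 => //; exact: mulr_ge0.
Qed.

End Pair.

Definition beta f i : R := 1 + (M f ^+ k.+1.*2) i i.

Lemma beta_ge1 f i : 1 <= beta f i.
Proof. by rewrite lerDl -bform_delta bform_even_ge0. Qed.

Lemma beta_bound f z : bform_bound N (M f) (u z) = kap z * beta f (v z).
Proof. by rewrite /bform_bound !bform_uvec_diag// mxE eqxx -mulrDr. Qed.

Lemma pair_sum_switch x y f (b : 'I_n -> R) :
  pair_sum v deg (switch x y f) x y b = pair_sum v deg f x y b.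
Proof.
case: (eqVneq (pi f x) y) => [fxy|fxy]; first by rewrite switch_id.
rewrite /pair_sum switch_partnerL// switchE tpermR tpermD; first by ring.
  by rewrite eq_sym partner_neq.
by rewrite eq_sym.
Qed.

Lemma pair_sum_ge0 x y f (b : 'I_n -> R) : (forall i, 0 <= b i) ->
  0 <= pair_sum v deg f x y b.
Proof. by move=> b0; rewrite /pair_sum !addr_ge0 ?mulr_ge0 ?addr_ge0. Qed.

Lemma pair_beta_ge0 x y f (b b' : 'I_n -> R) : (forall i, 0 <= b i) ->
  (forall i, 0 <= b' i) -> 0 <= pair_beta x y f b b'.
Proof.
move=> b0 b'0; apply: addr_ge0; apply: pair_sum_ge0 => i; exact: exprn_ge0.
Qed.

Definition beta_const : R :=
  2^-1 * (ell_const R 2 + 64 * (1 + moment_const R k.+1.*2.*2.*2)).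

(** Three uses of [bform_sqr_le] give the eighth power of a diagonal entry, the first power of two
    above the required sixth. *)
Lemma beta_cube_sqr_le f i :
  (beta f i ^+ 3) ^+ 2 <= 64 * (1 + (M f ^+ k.+1.*2.*2.*2.*2) i i).
Proof.
have one : bform 1 (delta_mx 0 i) (delta_mx 0 i) = 1 :> R.
  by rewrite bform_delta mxE eqxx.
have S j : (M f ^+ j) i i ^+ 2 <= (M f ^+ j.*2) i i.
  have := bform_sqr_le j (delta_mx 0 i) (sM f).
  by rewrite one mul1r !bform_delta.
have m0 : 0 <= (M f ^+ k.+1.*2) i i by rewrite -bform_delta bform_even_ge0.
have S1 := S k.+1.*2; have S2 := S k.+1.*2.*2; have S3 := S k.+1.*2.*2.*2.
rewrite /beta; move: m0 S1 S2 S3.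
move: ((M f ^+ k.+1.*2) i i) ((M f ^+ k.+1.*2.*2) i i) => m a.
move: ((M f ^+ k.+1.*2.*2.*2) i i) ((M f ^+ k.+1.*2.*2.*2.*2) i i) => b c.
move=> m0 ma ab bc.
have m8 : m ^+ 8 <= c.
  apply: le_trans bc; rewrite (_ : 8 = (4 * 2))%N// exprM.
  rewrite lerXn2r ?nnegrE ?exprn_ge0//.
    apply: (le_trans _ ab); exact: sqr_ge0.
  apply: le_trans ab; rewrite (_ : 4 = (2 * 2))%N// exprM.
  rewrite lerXn2r ?nnegrE ?exprn_ge0//; apply: (le_trans _ ma); exact: sqr_ge0.
rewrite -exprM; apply: (@le_trans _ _ (64 * (1 + m ^+ 8))); last first.
  by rewrite ler_wpM2l// lerD2l.
have p6 (t : R) : (2 * t) ^+ 6 = 64 * t ^+ 6 by ring.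
case: (lerP m 1) => h.
  apply: (@le_trans _ _ ((2 * 1) ^+ 6)).
    by rewrite lerXn2r ?nnegrE ?addr_ge0//; lra.
  by rewrite p6 expr1n ler_wpM2l// lerDl exprn_ge0.
apply: (@le_trans _ _ ((2 * m) ^+ 6)).
  by rewrite lerXn2r ?nnegrE ?addr_ge0 ?mulr_ge0//; lra.
rewrite p6 ler_wpM2l//; apply: (@le_trans _ _ (m ^+ 8)).
  by rewrite ler_weXn2l// ltW.
by rewrite lerDr.
Qed.

Let mean_ell2 := mean_ell_le deg_gt0 card_fiber card_H card_matching s_ge0 s_sqr
  dmin_gt0 dmin_le s_le_dmin.
Let mean_tr := mean_trX_le deg_gt0 card_fiber card_H card_matching s_ge0 s_sqr
  dmin_gt0 dmin_le s_le_dmin eps_le.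
Let ell0 := ell_ge0 v deg_gt0 s_ge0.

(** [ell] and [beta] both depend on the matching, so they are separated by
    [a * b <= (a ^+ 2 + b ^+ 2) / 2]; each square then has a known mean bound. *)
Lemma mean_ell_beta_le :
  mean (fun f => \sum_i (ell v deg s f i + 1) * beta f i ^+ 3) <= beta_const * n%:R.
Proof.
apply: (@le_trans _ _ (2^-1 * (\sum_i mean (fun f => (ell v deg s f i + 4) ^+ 2) +
   64 * (n%:R + mean (fun f => \tr (M f ^+ k.+1.*2.*2.*2.*2)))))).
  have -> : n%:R + mean (fun f => \tr (M f ^+ k.+1.*2.*2.*2.*2)) =
      mean (fun f => n%:R + \tr (M f ^+ k.+1.*2.*2.*2.*2)).
    by rewrite meanD mean_cst.
  rewrite -mean_sum -meanZ -meanD -meanZ; apply: ler_mean => f.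
  have -> : n%:R = \sum_(i < n) 1 :> R by rewrite sumr_const card_ord.
  rewrite /mxtrace -big_split /= mulr_sumr -big_split mulr_sumr.
  apply: ler_sum => i _ /=.
  apply: (@le_trans _ _ (2^-1 * ((ell v deg s f i + 4) ^+ 2 + (beta f i ^+ 3) ^+ 2))).
    have L0 := ell0 f i.
    have B0 : 0 <= beta f i ^+ 3 by rewrite exprn_ge0// (le_trans ler01)// beta_ge1.
    move: L0 B0; move: (ell v deg s f i) (beta f i ^+ 3) => a c a0 c0.
    by have := sqr_ge0 (a + 4 - c); rewrite !expr2; nra.
  by rewrite ler_wpM2l ?invr_ge0// lerD2l beta_cube_sqr_le.
have -> : beta_const * n%:R = 2^-1 * (ell_const R 2 * n%:R +
   64 * (n%:R + moment_const R k.+1.*2.*2.*2 * n%:R)) by rewrite /beta_const; ring.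
apply: ler_wpM2l; first by rewrite invr_ge0.
apply: lerD; last by apply: ler_wpM2l => //; rewrite lerD2l; exact: mean_tr.
rewrite mulr_natr -[n in leRHS]card_ord -sumr_const.
by apply: ler_sum => i _; exact: mean_ell2.
Qed.

Lemma mean_pair_sum_switch (b : matching H -> 'I_n -> R) :
  mean (fun f => \sum_x \sum_y (pair_sum v deg f x y (b f) +
     pair_sum v deg f x y (b (switch x y f)))) =
  2 * mean (fun f => \sum_x \sum_y pair_sum v deg f x y (b f)).
Proof.
rewrite !mean_sum mulr_sumr; apply: eq_bigr => x _.
rewrite !mean_sum mulr_sumr; apply: eq_bigr => y _.
rewrite meanD mulrDl mul1r; congr (_ + _).
transitivity (mean (fun f => pair_sum v deg (switch x y f) x y (b f))).
  exact: (mean_swap x y (fun f f' => pair_sum v deg f x y (b f'))).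
by apply: eq_mean => f; exact: pair_sum_switch.
Qed.

Lemma mean_pair_beta_le : s ^+ 2 * mean (fun f => \sum_x \sum_y
    pair_beta x y f (beta f) (beta (switch x y f))) <=
  8 * #|H|%:R * (beta_const * n%:R).
Proof.
rewrite (mean_pair_sum_switch (fun f i => beta f i ^+ 3)) mulrCA -meanZ.
have -> : mean (fun f => s ^+ 2 * (\sum_x \sum_y
      pair_sum v deg f x y (fun i => beta f i ^+ 3))) =
   4 * #|H|%:R * mean (fun f => \sum_i (ell v deg s f i + 1) * beta f i ^+ 3).
  rewrite -meanZ; apply: eq_mean => f.
  exact: (sum_pair_sum deg_gt0 card_fiber s_sqr).
have -> : 8 * #|H|%:R * (beta_const * n%:R) =
  2 * (4 * #|H|%:R * (beta_const * n%:R)) by ring.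
by do 2 (apply: ler_wpM2l; first by rewrite ?mulr_ge0); exact: mean_ell_beta_le.
Qed.

Lemma mean_pair_beta_diag_le : mean (fun f => \sum_x
    pair_beta x (pi f x) f (beta f) (beta f)) <= 16 * (beta_const * n%:R).
Proof.
apply: le_trans (ler_wpM2l (ler0n _ 16) mean_ell_beta_le).
rewrite -meanZ; apply: ler_mean => f.
have c0 i : 0 <= beta f i ^+ 3 by rewrite exprn_ge0// (le_trans ler01)// beta_ge1.
apply: (@le_trans _ _ (\sum_x 8 * (kap x * beta f (v x) ^+ 3 +
   kap (pi f x) * beta f (v (pi f x)) ^+ 3))).
  apply: ler_sum => x _.
  have pr z w : kap z * kap w * (beta f (v z) ^+ 3 + beta f (v w) ^+ 3) <=
     kap z * beta f (v z) ^+ 3 + kap w * beta f (v w) ^+ 3.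
    rewrite mulrDr; apply: lerD; apply: ler_wpM2r => //.
      by rewrite ler_piMr ?kap_ge0 ?kap_le1.
    by rewrite ler_piMl ?kap_ge0 ?kap_le1.
  rewrite /pair_beta /pair_sum partnerK.
  have := pr x (pi f x); have := pr x x; have := pr (pi f x) (pi f x).
  have := pr (pi f x) x.
  move: (kap x) (kap (pi f x)) (beta f (v x) ^+ 3) (beta f (v (pi f x)) ^+ 3).
  by move=> a a' b b'; lra.
rewrite -mulr_sumr big_split /=.
rewrite (reindex_partner f (fun z => kap z * beta f (v z) ^+ 3)).
rewrite (sum_kap deg_gt0 card_fiber (fun i => beta f i ^+ 3)).
have : \sum_i beta f i ^+ 3 <= \sum_i (ell v deg s f i + 1) * beta f i ^+ 3.
  apply: ler_sum => i _; rewrite mulrDl mul1r lerDr; exact: mulr_ge0.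
by move: (\sum_i _) (\sum_i (_ + 1) * _) => a b; lra.
Qed.

(** * Summing the linear part of the switching over all pairs *)

Section SecondOrderSum.
Variables (f : matching H) (A B : 'M[R]_n) (ra rb : R).
Hypotheses (sA : A^T = A) (sB : B^T = B).
Hypothesis sumA : forall x, \sum_y bform A (u x) (u y) = ra.
Hypothesis sumB : forall x, \sum_y bform B (u x) (u y) = rb.
Let a x y := bform A (u x) (u y).
Let b x y := bform B (u x) (u y).
Let SA := \sum_x a x (pi f x).
Let SB := \sum_x b x (pi f x).
Let X1 := \sum_x \sum_y a x y * b (pi f x) (pi f y).

(** Expanding [p] and [q] gives eight sums. Only the one with both forms on the diagonal factorizes
    into two full traces; the others involve matched pairs or constant row sums and are of lower
    order. *)
Lemma sum_second_order :
  \sum_x \sum_y bform (A *m Ediff x y f *m B) (u x) (u (pi f y)) =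
  s * (\tr A * \tr B + (X1 + SA * SB + \tr (A *m B)
       - rb * \tr A - ra * \tr B - rb * SA - ra * SB)).
Proof.
have bC x y : b x y = b y x by exact: bformC.
have aC x y : a x y = a y x by exact: bformC.
have dist (F G : H -> R) : \sum_x \sum_y F x * G y = (\sum_x F x) * (\sum_y G y).
  by rewrite mulr_suml; apply: eq_bigr => x _; rewrite mulr_sumr.
have E1 : \sum_x \sum_y a x x * b (pi f y) (pi f y) = \tr A * \tr B.
  rewrite (dist (fun x => a x x) (fun y => b (pi f y) (pi f y))).
  by rewrite (reindex_partner f (fun z => b z z)) -!(trE deg_gt0 card_fiber).
have E2 : \sum_x \sum_y a x (pi f x) * b y (pi f y) = SA * SB.
  exact: (dist (fun x => a x (pi f x)) (fun y => b y (pi f y))).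
have E3 : \sum_x \sum_y a x (pi f y) * b x (pi f y) = \tr (A *m B).
  rewrite -(sum_uvec_prod deg_gt0 card_fiber A sB); apply: eq_bigr => x _.
  by rewrite (reindex_partner f (fun z => a x z * b x z)).
have E4 : \sum_x \sum_y a x x * b (pi f x) (pi f y) = rb * \tr A.
  rewrite mulrC (trE deg_gt0 card_fiber) mulr_suml; apply: eq_bigr => x _.
  by rewrite -mulr_sumr (reindex_partner f (b (pi f x))) sumB.
have E5 : \sum_x \sum_y a x y * b (pi f y) (pi f y) = ra * \tr B.
  transitivity (\sum_y ra * b (pi f y) (pi f y)); last first.
    rewrite -mulr_sumr (reindex_partner f (fun z => b z z)).
    by rewrite -(trE deg_gt0 card_fiber).
  rewrite exchange_big; apply: eq_bigr => y _.
  rewrite -mulr_suml -(sumA y); congr (_ * _).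
  by apply: eq_bigr => x _; exact: aC.
have E6 : \sum_x \sum_y a x (pi f x) * b x (pi f y) = rb * SA.
  rewrite mulrC mulr_suml; apply: eq_bigr => x _.
  by rewrite -mulr_sumr (reindex_partner f (b x)) sumB.
have E7 : \sum_x \sum_y a x (pi f y) * b y (pi f y) = ra * SB.
  rewrite exchange_big mulr_sumr; apply: eq_bigr => y _.
  rewrite -mulr_suml -(sumA (pi f y)); congr (_ * _).
  by apply: eq_bigr => x _; exact: aC.
rewrite -E1 -E2 -E3 -E4 -E5 -E6 -E7 /X1.
rewrite -!sumrN -!big_split mulr_sumr; apply: eq_bigr => x _ /=.
rewrite -!sumrN -!big_split mulr_sumr; apply: eq_bigr => y _ /=.
rewrite /Ediff -scalemxAr -scalemxAl bformZm mulmxDr mulmxDl bformDm !bform_outer.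
rewrite !bformBr !bformBl -/(a _ _) -/(b _ _).
rewrite -!/(a _ _) -!/(b _ _).
ring.
Qed.

Lemma X1_le : `|X1| <= 2^-1 * (\tr (A *m A) + \tr (B *m B)).
Proof.
rewrite -(sum_uvec_prod deg_gt0 card_fiber A sA).
rewrite -(sum_uvec_prod deg_gt0 card_fiber B sB).
rewrite -[X in _ + X](reindex_partner f).
rewrite -big_split mulr_sumr; apply: (le_trans (ler_norm_sum _ _ _)).
apply: ler_sum => x _ /=; rewrite -[X in _ + X](reindex_partner f) -big_split mulr_sumr.
apply: (le_trans (ler_norm_sum _ _ _)); apply: ler_sum => y _ /=.
rewrite -/(a x y) -/(b (pi f x) (pi f y)) normrM.
move: (a x y) (b _ _) => t w.
rewrite -!expr2 -[t ^+ 2]real_normK ?num_real// -[w ^+ 2]real_normK ?num_real//.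
by have := sqr_ge0 (`|t| - `|w|); rewrite !expr2; lra.
Qed.

End SecondOrderSum.

Definition tau j f : R := \tr (M f ^+ j) / n%:R.

Lemma n_gt0 : (0 < n)%N.
Proof.
rewrite lt0n; apply/eqP => n0; move: card_H s_sqr; rewrite n0 mulr0.
by move=> h /esym/eqP; rewrite pnatr_eq0 => /eqP h'; rewrite h' in h.
Qed.

Let nR_gt0 : 0 < n%:R :> R. Proof. by rewrite ltr0n n_gt0. Qed.
Let D1 : 0 < #|H|%:R - 1 :> R := card_H_sub1 R card_H.

(** [s ^+ 2] is the average degree. With [s <= dmin] it also forces [s >= 1]. *)
Lemma dmin_le_sqr : dmin <= s ^+ 2.
Proof.
rewrite -(ler_pM2r nR_gt0) s_sqr.
have -> : #|H|%:R = \sum_i (deg i)%:R :> R.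
  rewrite -[RHS](sum_kap deg_gt0 card_fiber) (eq_bigr (fun=> 1)).
    by rewrite sumr_const.
  by move=> x _; rewrite /kap mulVf// pnatr_eq0 -lt0n.
rewrite mulr_natr -[n in leLHS]card_ord -sumr_const; exact: ler_sum.
Qed.

Let s_gt0 : 0 < s.
Proof.
rewrite lt_neqAle s_ge0 andbT eq_sym; apply/eqP => s0.
by have := lt_le_trans dmin_gt0 dmin_le_sqr; rewrite s0 expr0n ltxx.
Qed.

Let s_ge1 : 1 <= s.
Proof.
have : s * 1 <= s * s by rewrite mulr1 -expr2 (le_trans s_le_dmin)// dmin_le_sqr.
by rewrite ler_pM2l.
Qed.

Let eps_ge0 : 0 <= eps.
Proof. by rewrite mulr_ge0// invr_ge0 ltW. Qed.

Let eps_pow j : `|(- eps) ^+ j| <= 1.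
Proof.
rewrite normrX normrN ger0_norm// exprn_ile1//.
by apply: (le_trans eps_le); rewrite invf_le1// ler1n.
Qed.

Local Notation t j f := (\tr (M f ^+ j)).

Let tr_even_ge0 j f : 0 <= t j.*2 f.
Proof. by apply: trX_even_ge0 => //; rewrite odd_double. Qed.

Let tr_sqr_le j f : t j f ^+ 2 <= n%:R * t j.*2 f.
Proof. exact: trX_sqr_le. Qed.

Let norm_tr_le j f : `|t j f| <= 2^-1 * (n%:R + t j.*2 f).
Proof.
have := tr_sqr_le j f; rewrite -real_normK ?num_real//.
move: (normr_ge0 (t j f)); move: (`|_|) (t j.*2 f) => a b a0 h.
have := sqr_ge0 (a - n%:R); move: nR_gt0 h; move: (n%:R : R) => m m0 h.
rewrite sqrrB => h2; rewrite -(ler_pM2r m0); move: h h2; rewrite !expr2; lra.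
Qed.

Definition off_trace j f : R := \sum_x bform (M f ^+ j) (u x) (u (pi f x)).

(** Summing a form over matched pairs is tracing it against the adjacency part of [M f], so it
    raises the power by one and gains [s^-1], up to the contribution of [gvec]. *)
Lemma off_traceE j f :
  off_trace j f = t j.+1 f / s + csub R H * (- eps) ^+ j * #|H|%:R.
Proof.
have := trM_lapm v deg s f (sMX f j).
rewrite bform_lapmX_gvecl// gvec_gvec// -exprmxS -/(off_trace j f) => ->.
by field; rewrite lt0r_neq0.
Qed.

Lemma off_trace_sqr_le j f :
  off_trace j f ^+ 2 <= 2 * (n%:R * t j.+1.*2 f) / s ^+ 2 + 8.
Proof.
rewrite off_traceE.
have h1 : (t j.+1 f / s) ^+ 2 <= n%:R * t j.+1.*2 f / s ^+ 2.
  by rewrite exprMn exprVn ler_wpM2r ?invr_ge0 ?exprn_ge0// tr_sqr_le.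
have h2 : (csub R H * (- eps) ^+ j * #|H|%:R) ^+ 2 <= 4.
  rewrite mulrAC exprMn -[4]mulr1; apply: ler_pM; rewrite ?sqr_ge0//.
    have -> : 4 = 2 ^+ 2 :> R by ring.
    have c0 : 0 <= csub R H by rewrite invr_ge0 ltW.
    rewrite lerXn2r ?nnegrE ?mulr_ge0//.
    by rewrite mulrC; exact: (card_ratio_le2 R card_H).
  by rewrite -[X in X <= _]ger0_norm ?sqr_ge0// normrX exprn_ile1.
move: h1 h2; move: (t j.+1 f / s) (csub R H * _ * _) => a b h1 h2.
have := sqr_ge0 (a - b); rewrite -mulrA; move: h1 h2.
move: (n%:R * _ / _) => c; rewrite !expr2; lra.
Qed.

Definition loop_Q : R := 1 + beta_const + \sum_(j < k.+1) moment_const R j.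

Let ell_const_ge0 q : 0 <= ell_const R q.
Proof. by apply: prodr_ge0 => i _; rewrite addr_ge0 ?exprn_ge0. Qed.

Let beta_const_ge0 : 0 <= beta_const.
Proof.
apply: mulr_ge0; first by rewrite invr_ge0.
apply: addr_ge0 => //; apply: mulr_ge0 => //; apply: addr_ge0 => //.
exact: moment_const_ge0.
Qed.

Let sum_moment_ge0 : 0 <= \sum_(j < k.+1) moment_const R j.
Proof. by apply: sumr_ge0 => j _; exact: moment_const_ge0. Qed.

Lemma loop_Q_ge1 : 1 <= loop_Q.
Proof. by rewrite /loop_Q -addrA lerDl addr_ge0. Qed.

Let beta_const_le : beta_const <= loop_Q.
Proof. by rewrite /loop_Q addrAC lerDr addr_ge0. Qed.

Lemma mean_tr_le_Q j : (j <= k)%N -> mean (fun f => t j.*2 f) <= loop_Q * n%:R.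
Proof.
move=> jk; apply: (le_trans (mean_tr j)); apply: ler_wpM2r => //.
have jk' : (j < k.+1)%N by [].
rewrite /loop_Q (bigD1 (Ordinal jk'))//= addrCA lerDl addr_ge0 ?addr_ge0//.
by apply: sumr_ge0 => i _; exact: moment_const_ge0.
Qed.

(** All of [sum_second_order] except the product of the two traces, with the row sums replaced by
    their values [(- eps) ^+ j]. *)
Definition rem (i : nat) f : R :=
  let l := (k - i.+1)%N in
  (\sum_x \sum_y bform (M f ^+ i) (u x) (u y) * bform (M f ^+ l) (u (pi f x)) (u (pi f y)))
  + off_trace i f * off_trace l f + \tr (M f ^+ i *m M f ^+ l)
  - (- eps) ^+ l * t i f - (- eps) ^+ i * t l f
  - (- eps) ^+ l * off_trace i f - (- eps) ^+ i * off_trace l f.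

Lemma sum_second_orderE f :
  \sum_x \sum_y second_order x y f (M f) =
  s * \sum_(i < k) (t i f * t (k - i.+1) f + rem i f).
Proof.
transitivity (\sum_(i < k) \sum_x \sum_y bform (M f ^+ i *m Ediff x y f *m
    M f ^+ (k - i.+1)) (u x) (u (pi f y))).
  by rewrite [RHS]exchange_big; apply: eq_bigr => x _; rewrite [RHS]exchange_big.
rewrite mulr_sumr; apply: eq_bigr => i _.
exact: (sum_second_order f (sMX f _) (sMX f _)
  (sum_bform_lapmX s deg_gt0 card_fiber card_H f i)
  (sum_bform_lapmX s deg_gt0 card_fiber card_H f (k - i.+1))).
Qed.

Let norm_le_sqr (a : R) : `|a| <= 2^-1 * (1 + a ^+ 2).
Proof.
rewrite -real_normK ?num_real//; have := sqr_ge0 (`|a| - 1).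
by rewrite !expr2; lra.
Qed.

Let norm_mul_le_sqr (a b : R) : `|a * b| <= 2^-1 * (a ^+ 2 + b ^+ 2).
Proof.
rewrite normrM -[a ^+ 2]real_normK ?num_real// -[b ^+ 2]real_normK ?num_real//.
by have := sqr_ge0 (`|a| - `|b|); rewrite !expr2; lra.
Qed.

Let norm_mul_le1 (a b : R) : `|a| <= 1 -> `|a * b| <= `|b|.
Proof. by move=> a1; rewrite normrM ler_piMl. Qed.

Lemma norm_rem_le (i : nat) f : (i < k)%N -> `|rem i f| <=
  (t i.*2 f + t (k - i.+1).*2 f) + 2^-1 * t k.-1.*2 f + 2 * n%:R + 18
  + 2 * (n%:R * (t i.+1.*2 f + t (k - i).*2 f)) / s ^+ 2.
Proof.
move=> ik; rewrite /rem; set l := (k - i.+1)%N.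
have lE : (k - i)%N = l.+1 by rewrite /l subnSK.
have ilE : k.-1 = (i + l)%N by rewrite -[k in LHS](subnKC ik).
rewrite lE.
have h1 := X1_le f (sMX f i) (sMX f l).
rewrite -!exprmxD !addnn in h1.
have h2 := norm_mul_le_sqr (off_trace i f) (off_trace l f).
have h3 := norm_tr_le k.-1 f; rewrite {1}ilE exprmxD in h3.
have h4 := le_trans (norm_mul_le1 (t i f) (eps_pow l)) (norm_tr_le i f).
have h5 := le_trans (norm_mul_le1 (t l f) (eps_pow i)) (norm_tr_le l f).
have h6 := le_trans (norm_mul_le1 (off_trace i f) (eps_pow l)) (norm_le_sqr _).
have h7 := le_trans (norm_mul_le1 (off_trace l f) (eps_pow i)) (norm_le_sqr _).
have h8 := off_trace_sqr_le i f; have h9 := off_trace_sqr_le l f.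
have -> : 2 * (n%:R * (t i.+1.*2 f + t l.+1.*2 f)) / s ^+ 2 =
  2 * (n%:R * t i.+1.*2 f) / s ^+ 2 + 2 * (n%:R * t l.+1.*2 f) / s ^+ 2 by ring.
apply: (le_trans (ler_normB _ _)); apply: (le_trans (lerD (ler_normB _ _) (lexx _))).
apply: (le_trans (lerD (lerD (ler_normB _ _) (lexx _)) (lexx _))).
apply: (le_trans (lerD (lerD (lerD (ler_normB _ _) (lexx _)) (lexx _)) (lexx _))).
apply: (le_trans (lerD (lerD (lerD (lerD (ler_normD _ _)
  (lexx _)) (lexx _)) (lexx _)) (lexx _))).
apply: (le_trans (lerD (lerD (lerD (lerD (lerD (ler_normD _ _)
  (lexx _)) (lexx _)) (lexx _)) (lexx _)) (lexx _))).
apply: (le_trans (lerD (lerD (lerD (lerD (lerD (lerD h1 h2) h3) h4) h5) h6) h7)).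
move: h8 h9 (ltW nR_gt0); move: (off_trace i f ^+ 2) (off_trace l f ^+ 2).
move: (_ / s ^+ 2) (_ / s ^+ 2).
move: (t i.*2 f) (t l.*2 f) (t k.-1.*2 f) (n%:R : R) => a b c m x1 x2 y1 y2.
lra.
Qed.

Lemma mean_norm_rem_le (i : nat) : (i < k)%N -> mean (fun f => `|rem i f|) <=
  38 * (loop_Q * n%:R) + 8 * (n%:R * (loop_Q * n%:R)) / s ^+ 2.
Proof.
move=> ik; apply: (le_trans (ler_mean (fun f => norm_rem_le f ik))).
have i1 : (i.+1 <= k)%N by [].
have q1 := mean_tr_le_Q (ltnW ik).
have q2 := mean_tr_le_Q (leq_subr i.+1 k).
have q3 := mean_tr_le_Q (leq_pred k).
have q4 := mean_tr_le_Q i1.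
have q5 := mean_tr_le_Q (leq_subr i k).
have -> : mean (fun f => t i.*2 f + t (k - i.+1).*2 f + 2^-1 * t k.-1.*2 f + 2 * n%:R + 18
  + 2 * (n%:R * (t i.+1.*2 f + t (k - i).*2 f)) / s ^+ 2) =
  mean (fun f => t i.*2 f) + mean (fun f => t (k - i.+1).*2 f) +
  2^-1 * mean (fun f => t k.-1.*2 f) + (2 * n%:R + 18) +
  2 * n%:R / s ^+ 2 * (mean (fun f => t i.+1.*2 f) + mean (fun f => t (k - i).*2 f)).
  rewrite -(mean_cst (2 * n%:R + 18) card_matching) -!meanD -!meanZ -!meanD.
  by apply: eq_mean => f; ring.
have c0 : 0 <= 2 * n%:R / s ^+ 2 :> R.
  by apply: mulr_ge0; rewrite ?invr_ge0 ?exprn_ge0 ?mulr_ge0.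
apply: (le_trans (lerD (lexx _) (ler_wpM2l c0 (lerD q4 q5)))).
have Qn : n%:R <= loop_Q * n%:R by rewrite ler_peMl// loop_Q_ge1.
have n1 : 1 <= n%:R :> R by rewrite ler1n n_gt0.
have -> : 2 * n%:R / s ^+ 2 * (loop_Q * n%:R + loop_Q * n%:R) =
  4 * (n%:R * (loop_Q * n%:R)) / s ^+ 2 by ring.
have Y0 : 0 <= n%:R * (loop_Q * n%:R) / s ^+ 2.
  apply: mulr_ge0; last by rewrite invr_ge0 exprn_ge0.
  by apply: mulr_ge0 => //; apply: le_trans Qn.
rewrite -[4 * _ / _]mulrA -[8 * _ / _]mulrA.
move: Y0 q1 q2 q3 Qn n1; move: (_ / s ^+ 2) (mean _) (mean _) (mean _).
by move: (loop_Q * n%:R) (n%:R : R) => a b c d e g; lra.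
Qed.

Lemma mean_norm_tr_le (j : nat) : (j <= k)%N ->
  mean (fun f => `|t j f|) <= loop_Q * n%:R.
Proof.
move=> jk; apply: (le_trans (ler_mean (norm_tr_le j))).
rewrite meanZ meanD mean_cst//; have := mean_tr_le_Q jk.
have : n%:R <= loop_Q * n%:R by rewrite ler_peMl// loop_Q_ge1.
by move: (mean (fun f => t j.*2 f)) (loop_Q * n%:R) (n%:R : R) => a b c; lra.
Qed.

Lemma mean_norm_trtr_le (i j : nat) : (i <= k)%N -> (j <= k)%N ->
  mean (fun f => `|t i f * t j f|) <= n%:R * (loop_Q * n%:R).
Proof.
move=> ik jk.
apply: (@le_trans _ _ (mean (fun f => 2^-1 * (n%:R * t i.*2 f + n%:R * t j.*2 f)))).
  apply: ler_mean => f; apply: (le_trans (norm_mul_le_sqr _ _)).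
  by apply: ler_wpM2l; [rewrite invr_ge0|apply: lerD; exact: tr_sqr_le].
rewrite meanZ meanD !meanZ.
have := ler_wpM2l (ltW nR_gt0) (mean_tr_le_Q ik).
have := ler_wpM2l (ltW nR_gt0) (mean_tr_le_Q jk).
move: (mean (fun f => t i.*2 f)) (mean (fun f => t j.*2 f)) (loop_Q * n%:R).
by move: (n%:R : R) => m a b c; lra.
Qed.

(** * The loop equation against a bounded Lipschitz function *)

Section TestFunction.
Variable phi : R -> R.
Hypothesis phi_le1 : forall a, `|phi a| <= 1.
Hypothesis phi_lip : forall a b, `|phi a - phi b| <= `|a - b|.

Let c f : R := phi (tau k.+1 f).
Let F f : 'M[R]_n := c f *: M f ^+ k.
Let sF f : (F f)^T = F f.
Proof. by rewrite /F linearZ /= sMX. Qed.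

Let err f : R := \sum_x \sum_y
  (bform (F (switch x y f) - F f) (u x) (u (pi f y)) - c f * second_order x y f (M f)).

Let C1 : R := 128 * k%:R ^+ 2 * s ^+ 2 * dmin^-1 + 16 * k.+1%:R * s * n%:R^-1.
Let C2 : R := 16 * k%:R * s.

Let beta_ge0 f i : 0 <= beta f i.
Proof. exact: le_trans ler01 (beta_ge1 f i). Qed.

Let C1_ge0 : 0 <= C1.
Proof.
have d0 : 0 <= dmin^-1 by rewrite invr_ge0 ltW.
have n0 : 0 <= n%:R^-1 :> R by rewrite invr_ge0.
apply: addr_ge0; apply: mulr_ge0 => //; apply: mulr_ge0 => //; rewrite ?sqr_ge0//;
  by apply: mulr_ge0; rewrite ?sqr_ge0.
Qed.

Let err_le f : `|err f| <=
  C1 * (\sum_x \sum_y pair_beta x y f (beta f) (beta (switch x y f))) +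
  C2 * \sum_x pair_beta x (pi f x) f (beta f) (beta f).
Proof.
rewrite /err !mulr_sumr -big_split.
apply: (le_trans (ler_norm_sum _ _ _)); apply: ler_sum => x _ /=.
(* The degenerate pair is isolated: there the actual difference is zero and only [second_order]
   remains, whence the coefficient [C2]. *)
rewrite (bigD1 (pi f x))//= [X in _ <= C1 * X + _](bigD1 (pi f x))//= mulrDr.
rewrite addrC; apply: (le_trans (ler_normD _ _)).
rewrite [C1 * _ + C1 * _]addrC -addrA; apply: lerD.
  rewrite mulr_sumr.
  apply: (le_trans (ler_norm_sum _ _ _)); apply: ler_sum => y yfx.
  have fxy : pi f x != y by rewrite eq_sym.
  apply: (@pair_error x y f (M f) (M (switch x y f)) (beta f) (beta (switch x y f))
    (sM f) (sM _) (beta_ge1 f) (beta_ge1 _) (beta_bound f) (beta_bound _)).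
  - exact: lapm_switchN.
  - exact: phi_le1.
  - apply: (le_trans (phi_lip (tau k.+1 (switch x y f)) (tau k.+1 f))).
    rewrite /tau -mulrBl normrM mulrC.
    by rewrite [`|n%:R^-1|]ger0_norm// invr_ge0.
have -> : switch x (pi f x) f = f by rewrite switch_id.
rewrite subrr {1}/bform mulmx0 mul0mx mxE sub0r normrN.
apply: ler_wpDl.
  by apply: mulr_ge0 => //; apply: pair_beta_ge0.
apply: (@second_order_bound x (pi f x) f (M f) (beta f) (beta f)
    (sM f) (beta_ge1 f) (beta_ge1 f) (beta_bound f)); exact: phi_le1.
Qed.

Let E1 := mean (fun f => \sum_x \sum_y pair_beta x y f (beta f) (beta (switch x y f))).
Let E2 := mean (fun f => \sum_x pair_beta x (pi f x) f (beta f) (beta f)).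

(** Since [s ^+ 2 * n = #|H|], the products of traces coming from the linear part cancel those on
    the left, except for one unit of [#|H| - (#|H| - 1)]; this is the last term. *)
Let loop_identity :
  n%:R * (#|H|%:R - 1) * mean (fun f => c f * (tau k.+1 f -
     \sum_(i < k) tau i f * tau (k - i.+1) f)) =
  s * mean err - s * mean (fun f => c f * t k f)
  + s ^+ 2 * mean (fun f => c f * \sum_(i < k) rem i f)
  + n%:R^-1 * mean (fun f => c f * \sum_(i < k) (t i f * t (k - i.+1) f)).
Proof.
have L := lapm_loop s deg_gt0 card_fiber card_H sF.
have E3 : mean (fun f => \tr (M f *m F f) + eps * \tr (F f)) =
   mean (fun f => c f * t k.+1 f) + eps * mean (fun f => c f * t k f).
  rewrite -meanZ -meanD; apply: eq_mean => f.
  by rewrite /F -scalemxAr !mxtraceZ exprmxS.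
have E4 : mean (fun f => \sum_x \sum_y
      bform (F (switch x y f) - F f) (u x) (u (pi f y))) =
    mean err + s * mean (fun f => c f * \sum_(i < k) (t i f * t (k - i.+1) f))
    + s * mean (fun f => c f * \sum_(i < k) rem i f).
  rewrite -addrA -mulrDr -meanD -meanZ -meanD; apply: eq_mean => f.
  rewrite -mulrDr -big_split /= mulrCA -sum_second_orderE /err.
  rewrite mulr_sumr -big_split; apply: eq_bigr => x _ /=.
  by rewrite mulr_sumr -big_split; apply: eq_bigr => y _ /=; rewrite subrK.
have E5 : mean (fun f => c f * (tau k.+1 f - \sum_(i < k) tau i f * tau (k - i.+1) f)) =
   n%:R^-1 * mean (fun f => c f * t k.+1 f) -
   n%:R^-1 ^+ 2 * mean (fun f => c f * \sum_(i < k) (t i f * t (k - i.+1) f)).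
  rewrite -!meanZ -meanB; apply: eq_mean => f.
  have -> : \sum_(i < k) tau i f * tau (k - i.+1) f =
     n%:R^-1 ^+ 2 * \sum_(i < k) (t i f * t (k - i.+1) f).
    by rewrite mulr_sumr; apply: eq_bigr => i _; rewrite /tau; ring.
  by rewrite /tau; ring.
rewrite E3 E4 in L; rewrite E5; move: L.
move: (mean err) (mean (fun f => c f * t k.+1 f)) (mean (fun f => c f * t k f)).
move: (mean (fun f => c f * \sum_(i < k) (t i f * t (k - i.+1) f))).
move: (mean (fun f => c f * \sum_(i < k) rem i f)) => a b e x y L.
have n0 : n%:R != 0 :> R by rewrite lt0r_neq0.
have D0 : #|H|%:R - 1 != 0 :> R by rewrite lt0r_neq0.
have -> : n%:R * (#|H|%:R - 1) * (n%:R^-1 * x - n%:R^-1 ^+ 2 * b) =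
  (#|H|%:R - 1) * x - (#|H|%:R - 1) * n%:R^-1 * b by field.
have -> : (#|H|%:R - 1) * x = s * (e + s * b + s * a) - s * y.
  by rewrite -L /shift_coef /csub; field.
by rewrite -s_sqr; field.
Qed.

Let mean_c_le (X : matching H -> R) (B : R) : mean (fun f => `|X f|) <= B ->
  `|mean (fun f => c f * X f)| <= B.
Proof.
apply: le_trans; apply: (le_trans (ler_norm_mean _)); apply: ler_mean => f.
by apply: norm_mul_le1; exact: phi_le1.
Qed.

(** With [a = s / dmin], every error is compared with [(a + 1 / n) * (n * #|H|)]. The hypothesis
    [N0 <= a * D] holds since [dmin <= s ^+ 2 <= s ^+ 3]. *)
Let final_arith (K a D s2 Q N0 : R) : 0 <= K -> 1 <= s -> 0 <= Q -> 0 < N0 ->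
  s ^+ 2 * N0 = D -> N0 <= a * D -> s2 = s ^+ 2 -> 0 <= a ->
  (128 * K ^+ 2 * a + 16 * (K + 1) / N0) * (8 * D * (Q * N0)) +
  16 * K * s2 * (16 * (Q * N0)) + s * (Q * N0) +
  s2 * (K * (38 * (Q * N0) + 8 * (N0 * (Q * N0)) / s2)) + N0^-1 * (K * (N0 * (Q * N0)))
  <= 1500 * (K + 1) ^+ 2 * Q * (a + N0^-1) * (N0 * D).
Proof.
move=> K0 s1 Q0 N00 sD ND s2E a0.
have s20 : 0 < s2 by rewrite s2E exprn_gt0// (lt_le_trans ltr01).
have ss2 : s <= s2 by rewrite s2E expr2 ler_peMl// (le_trans ler01).
have DN : D = s2 * N0 by rewrite s2E.
have N0' := lt0r_neq0 N00; have s2' := lt0r_neq0 s20.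
have -> : 1500 * (K + 1) ^+ 2 * Q * (a + N0^-1) * (N0 * D) =
  (Q * N0) * (1500 * (K + 1) ^+ 2 * (a * D + s2)) by rewrite DN; field.
have -> : (128 * K ^+ 2 * a + 16 * (K + 1) / N0) * (8 * D * (Q * N0)) +
  16 * K * s2 * (16 * (Q * N0)) + s * (Q * N0) +
  s2 * (K * (38 * (Q * N0) + 8 * (N0 * (Q * N0)) / s2)) + N0^-1 * (K * (N0 * (Q * N0)))
  = (Q * N0) * (1024 * K ^+ 2 * (a * D) + 128 * (K + 1) * s2 + 256 * K * s2 + s
     + 38 * K * s2 + 8 * K * N0 + K).
  by rewrite DN; field; rewrite s2' N0'.
apply: ler_wpM2l; first by rewrite mulr_ge0// ltW.
have s21 : 1 <= s2 by apply: le_trans ss2.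
have aD0 : 0 <= a * D by apply: le_trans ND; exact: ltW.
move: ND aD0; move: (a * D) => X NX X0.
have := mulr_ge0 K0 X0; have := mulr_ge0 (sqr_ge0 K) X0.
have := mulr_ge0 K0 (ltW s20); have := mulr_ge0 (sqr_ge0 K) (ltW s20).
have := ler_wpM2l K0 NX; have := ler_wpM2l K0 s21.
rewrite !expr2; lra.
Qed.

Lemma loop_bound :
  `|mean (fun f => c f * (tau k.+1 f - \sum_(i < k) tau i f * tau (k - i.+1) f))| <=
  3000 * k.+1%:R ^+ 2 * loop_Q * (s / dmin + n%:R^-1).
Proof.
have D0 : 0 < n%:R * (#|H|%:R - 1) :> R by rewrite mulr_gt0.
set G := mean _.
(* Dividing by [#|H| - 1] instead of [#|H|] doubles the constant 1500. *)
have half : n%:R * #|H|%:R <= 2 * (n%:R * (#|H|%:R - 1)) :> R.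
  rewrite mulrCA; apply: ler_wpM2l => //.
  by have := card_ratio_le2 R card_H; rewrite ler_pdivrMr.
have Q0 : 0 <= loop_Q := le_trans ler01 loop_Q_ge1.
have sd0 : 0 <= s / dmin by rewrite divr_ge0// ltW.
have nD : n%:R <= s / dmin * #|H|%:R.
  rewrite -s_sqr mulrA -[leLHS]mul1r; apply: ler_wpM2r => //.
  rewrite mulrAC ler_pdivlMr// mul1r (le_trans dmin_le_sqr)//.
  by rewrite ler_peMl ?sqr_ge0.
have b1 : `|s * mean err| <=
   (128 * k%:R ^+ 2 * (s / dmin) + 16 * (k%:R + 1) / n%:R) * (8 * #|H|%:R * (loop_Q * n%:R))
   + 16 * k%:R * s ^+ 2 * (16 * (loop_Q * n%:R)).
  have Qb : beta_const * n%:R <= loop_Q * n%:R by rewrite ler_wpM2r.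
  have h1 : s ^+ 2 * E1 <= 8 * #|H|%:R * (loop_Q * n%:R).
    by apply: (le_trans mean_pair_beta_le); apply: ler_wpM2l => //; rewrite mulr_ge0.
  have h2 : E2 <= 16 * (loop_Q * n%:R).
    by apply: (le_trans mean_pair_beta_diag_le); apply: ler_wpM2l.
  rewrite normrM (ger0_norm s_ge0).
  have h3 : `|mean err| <= C1 * E1 + C2 * E2.
    apply: (le_trans (ler_norm_mean _)); apply: (le_trans (ler_mean err_le)).
    by rewrite meanD !meanZ.
  apply: (le_trans (ler_wpM2l s_ge0 h3)).
  have -> : s * (C1 * E1 + C2 * E2) =
    (128 * k%:R ^+ 2 * (s / dmin) + 16 * (k%:R + 1) / n%:R) * (s ^+ 2 * E1) +
    16 * k%:R * s ^+ 2 * E2.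
    by rewrite /C1 /C2 -[k.+1]addn1 natrD; ring.
  have n0 : 0 <= n%:R^-1 :> R by rewrite invr_ge0.
  apply: lerD; apply: ler_wpM2l => //; last first.
    by apply: mulr_ge0; rewrite ?sqr_ge0 ?mulr_ge0.
  apply: addr_ge0.
    by apply: mulr_ge0 => //; apply: mulr_ge0 => //; exact: sqr_ge0.
  by apply: mulr_ge0 => //; apply: mulr_ge0 => //; apply: addr_ge0.
have b2 : `|s * mean (fun f => c f * t k f)| <= s * (loop_Q * n%:R).
  rewrite normrM (ger0_norm s_ge0); apply: ler_wpM2l => //.
  by apply: mean_c_le; exact: mean_norm_tr_le.
have b3 : `|s ^+ 2 * mean (fun f => c f * \sum_(i < k) rem i f)| <=
    s ^+ 2 * (k%:R * (38 * (loop_Q * n%:R) + 8 * (n%:R * (loop_Q * n%:R)) / s ^+ 2)).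
  rewrite normrM (ger0_norm (sqr_ge0 s)); apply: ler_wpM2l; first exact: sqr_ge0.
  apply: mean_c_le.
  apply: (le_trans (ler_mean (fun f => ler_norm_sum _ _ _))).
  rewrite mean_sum mulr_natl -[k in leRHS]card_ord -sumr_const.
  by apply: ler_sum => i _; apply: mean_norm_rem_le.
have b4 : `|n%:R^-1 * mean (fun f => c f * \sum_(i < k) (t i f * t (k - i.+1) f))| <=
    n%:R^-1 * (k%:R * (n%:R * (loop_Q * n%:R))).
  rewrite normrM [`|n%:R^-1|]ger0_norm ?invr_ge0//.
  apply: ler_wpM2l; first by rewrite invr_ge0.
  apply: mean_c_le.
  apply: (le_trans (ler_mean (fun f => ler_norm_sum _ _ _))).
  rewrite mean_sum mulr_natl -[k in leRHS]card_ord -sumr_const.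
  apply: ler_sum => i _; apply: mean_norm_trtr_le; last exact: leq_subr.
  exact: ltnW (ltn_ord i).
have tot : n%:R * (#|H|%:R - 1) * `|G| <=
   1500 * (k%:R + 1) ^+ 2 * loop_Q * (s / dmin + n%:R^-1) * (n%:R * #|H|%:R).
  apply: le_trans (final_arith (ler0n _ k) s_ge1 Q0 nR_gt0 s_sqr nD erefl sd0).
  rewrite -[X in X * `|_|]gtr0_norm// -normrM loop_identity.
  apply: (le_trans (ler_normD _ _)); apply: lerD b4.
  apply: (le_trans (ler_normD _ _)); apply: lerD b3.
  by apply: (le_trans (ler_normB _ _)); apply: lerD b2.
rewrite -(ler_pM2l D0); apply: (le_trans tot).
have -> : n%:R * (#|H|%:R - 1) * (3000 * k.+1%:R ^+ 2 * loop_Q * (s / dmin + n%:R^-1)) =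
  1500 * (k%:R + 1) ^+ 2 * loop_Q * (s / dmin + n%:R^-1) * (2 * (n%:R * (#|H|%:R - 1))).
  by rewrite -[k.+1]addn1 natrD; ring.
refine (ler_wpM2l _ half); apply: mulr_ge0.
  apply: mulr_ge0 Q0; apply: mulr_ge0 (ler0n _ 1500) _; exact: sqr_ge0.
by apply: addr_ge0 sd0 _; rewrite invr_ge0 ler0n.
Qed.

End TestFunction.

End LoopEquation.

(** * Convergence of the spectral moments *)

Section Catalan.
Variable R : realType.

Lemma catalan0 : catalan R 0 = 1.
Proof. by rewrite /catalan muln0 bin0 invr1 mulr1. Qed.

Lemma catalanS m : m.+2%:R * catalan R m.+1 = (4 * m%:R + 2) * catalan R m.
Proof.
have E : (m.+1 * 'C(2 * m.+1, m.+1) = (4 * m + 2) * 'C(2 * m, m))%N.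
  have e1 : (m.+1 * 'C(2 * m.+1, m.+1) = 2 * m.+1 * 'C((2 * m).+1, m))%N.
    by rewrite -mul_bin_diag mulnS.
  have e2 : (m.+1 * 'C((2 * m).+1, m) = (2 * m).+1 * 'C(2 * m, m))%N.
    by have := mul_bin_down (2 * m).+1 m; rewrite /= => ->; congr (_ * _)%N; lia.
  by rewrite e1 -mulnA e2; ring.
have Er : m.+1%:R * 'C(2 * m.+1, m.+1)%:R = (4 * m%:R + 2) * 'C(2 * m, m)%:R :> R.
  by rewrite -natrM E natrM natrD natrM.
have n2 : m.+2%:R != 0 :> R by rewrite (@pnatr_eq0 R).
have n1 : m.+1%:R != 0 :> R by rewrite (@pnatr_eq0 R).
rewrite /catalan (mulVKf n2).
apply: (mulfI n1).
by rewrite Er; field.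
Qed.

(** No generating function is used. The reflection [i -> j - i] gives [2 * T j = j%:R * S j], and
    [catalanS] inside the weighted sum gives [rec]; together they make the convolution satisfy the
    same first-order recursion as the Catalan numbers. *)
Lemma catalan_conv m :
  catalan R m.+1 = \sum_(i < m.+1) catalan R i * catalan R (m - i).
Proof.
pose S m := \sum_(i < m.+1) catalan R i * catalan R (m - i).
pose T m := \sum_(i < m.+1) i%:R * (catalan R i * catalan R (m - i)).
have TS j : 2 * T j = j%:R * S j.
  have T' : T j = \sum_(i < j.+1) (j - i)%:R * (catalan R i * catalan R (j - i)).
    rewrite /T (reindex_inj rev_ord_inj); apply: eq_bigr => i _ /=.
    by rewrite subSS subKn -1?ltnS// [catalan R (j - i) * _]mulrC.
  rewrite mulr2n mulrDl mul1r {2}T' -big_split /S mulr_sumr.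
  apply: eq_bigr => i _ /=; rewrite -mulrDl -natrD subnKC// -ltnS; exact: ltn_ord.
have rec j : S j.+1 + T j.+1 = catalan R j.+1 + 4 * T j + 2 * S j.
  have -> : S j.+1 + T j.+1 =
     \sum_(i < j.+2) (i.+1%:R * catalan R i) * catalan R (j.+1 - i).
    by rewrite -big_split; apply: eq_bigr => i _ /=; rewrite -[i.+1]addn1 natrD; ring.
  rewrite big_ord_recl /= catalan0 subn0 !mul1r -addrA; congr (_ + _).
  rewrite /T /S !mulr_sumr -big_split; apply: eq_bigr => i _ /=.
  by rewrite /bump /= add1n subSS catalanS; ring.
suff SE j : S j = catalan R j.+1 by rewrite -SE.
elim: j => [|j IH].
  rewrite /S big_ord1 /= subn0 catalan0 mulr1.
  by apply: (@mulfI _ (2%:R : R)); rewrite ?pnatr_eq0// catalanS catalan0; ring.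
have h := rec j; have h2 := TS j.+1; have h3 := TS j; have h4 := catalanS j.+1.
rewrite IH in h h3.
apply: (@mulfI _ (j.+3%:R : R)); first by rewrite pnatr_eq0.
rewrite h4; move: h h2 h3; rewrite -[j.+3]addn3 -[j.+1]addn1 !natrD.
move: (S _) (T _) (T j) (catalan R _) (j%:R : R) => a b c d e; lra.
Qed.

Definition semicircle_moment k : R := if odd k then 0 else catalan R k./2.

Lemma sum_even_ord (F : nat -> R) m : (forall i, odd i -> F i = 0) ->
  \sum_(i < m.*2.+1) F i = \sum_(j < m.+1) F j.*2.
Proof.
move=> F0; elim: m => [|m IH]; first by rewrite !big_ord1.
rewrite doubleS !big_ord_recr /= in IH *; rewrite IH (F0 m.*2.+1) ?addr0//=.
by rewrite odd_double.
Qed.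

(** The semicircle moments solve the limiting loop equation exactly; by parity only even indices
    contribute. *)
Lemma semicircle_momentS k : semicircle_moment k.+1 =
  \sum_(i < k) semicircle_moment i * semicircle_moment (k - i.+1).
Proof.
have [ok|ek] := boolP (odd k); last first.
  rewrite /semicircle_moment /= ek big1// => i _.
  case: ifP => oi; first by rewrite mul0r.
  by rewrite oddB// (negbTE ek) /= oi mulr0.
rewrite -(odd_double_half k) ok add1n; set m := k./2.
rewrite (sum_even_ord (F := fun i => semicircle_moment i * semicircle_moment (m.*2.+1 - i.+1))).
  rewrite /semicircle_moment /= odd_double /= doubleK catalan_conv.
  apply: eq_bigr => j _; rewrite subSS -doubleB !odd_double /= doubleK.
  by congr (_ * catalan R _); rewrite doubleK.
by move=> i oi; rewrite /semicircle_moment oi mul0r.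
Qed.

Lemma semicircle_moment_even_le r : 0 <= semicircle_moment r.*2 <= 4 ^+ r.
Proof.
rewrite /semicircle_moment odd_double doubleK /catalan; apply/andP; split.
  by rewrite mulr_ge0 ?invr_ge0.
apply: (@le_trans _ _ ('C(2 * r, r)%:R)).
  by rewrite ler_piMl// invf_le1 ?ltr0n// ler1n.
have -> : 4 ^+ r = (2 ^ (2 * r))%:R :> R.
  by rewrite natrX exprM; congr (_ ^+ r); ring.
rewrite ler_nat (_ : 2 = 1 + 1)%N// expnDn.
have rlt : (r < (2 * r).+1)%N by lia.
rewrite (bigD1 (Ordinal rlt))//= !exp1n !muln1; exact: leq_addr.
Qed.

End Catalan.

Section Vanishing.
Variable R : realType.
Implicit Types u w : nat -> R.

(** One-sided on purpose: it is used for upper bounds, which can then be chained by [<=] alone. *)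
Definition vanishing u :=
  forall e : R, 0 < e -> exists N, forall n, (N <= n)%N -> u n <= e.

Lemma vanishing0 : vanishing (fun=> 0).
Proof. by move=> e e0; exists 0%N => n _; exact: ltW. Qed.

Lemma vanishing_le u w : (exists N, forall n, (N <= n)%N -> u n <= w n) ->
  vanishing w -> vanishing u.
Proof.
move=> [N1 uw] vw e e0; have [N2 wN] := vw e e0; exists (maxn N1 N2) => n.
by rewrite geq_max => /andP[n1 n2]; apply: le_trans (uw n n1) (wN n n2).
Qed.

Lemma vanishingD u w : vanishing u -> vanishing w -> vanishing (fun n => u n + w n).
Proof.
move=> vu vw e e0; have e2 : 0 < e / 2 by rewrite divr_gt0.
have [N1 h1] := vu _ e2; have [N2 h2] := vw _ e2; exists (maxn N1 N2) => n.
rewrite geq_max => /andP[n1 n2].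
by have := h1 n n1; have := h2 n n2; lra.
Qed.

Lemma vanishingZ c u : 0 <= c -> vanishing u -> vanishing (fun n => c * u n).
Proof.
move=> c0 vu e e0; have c1 : 0 < c + 1 by lra.
have [N h] := vu (e / (c + 1)) (divr_gt0 e0 c1); exists N => n /h un.
apply: (le_trans (ler_wpM2l c0 un)); rewrite mulrCA ler_piMr ?(ltW e0)//.
by rewrite ler_pdivrMr// mul1r; lra.
Qed.

Lemma vanishing_sum (I : Type) (r : seq I) (F : I -> nat -> R) :
  (forall i, vanishing (F i)) -> vanishing (fun n => \sum_(i <- r) F i n).
Proof.
move=> vF; elim: r => [|i r IH].
  by apply: vanishing_le vanishing0; exists 0%N => n _; rewrite big_nil.
apply: vanishing_le (vanishingD (vF i) IH).
by exists 0%N => n _; rewrite big_cons.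
Qed.

Lemma vanishing_approx u : (forall d : R, 0 < d -> exists2 w, vanishing w &
    exists N, forall n, (N <= n)%N -> u n <= d + w n) -> vanishing u.
Proof.
move=> h e e0; have e2 : 0 < e / 2 by rewrite divr_gt0.
have [w vw [N1 h1]] := h _ e2; have [N2 h2] := vw _ e2; exists (maxn N1 N2) => n.
rewrite geq_max => /andP[n1 n2].
by have := h1 n n1; have := h2 n n2; lra.
Qed.

Lemma vanishing_cvg u w : (exists N, forall n, (N <= n)%N -> `|u n| <= w n) ->
  vanishing w -> u @ \oo --> (0 : R).
Proof.
move=> [N1 uw] vw; apply/cvgr0Pnorm_le => e e0.
have [N2 h2] := vw e e0; exists (maxn N1 N2) => // n /=.
rewrite geq_max => /andP[n1 n2]; exact: le_trans (uw n n1) (h2 n n2).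
Qed.

Lemma cvg_vanishing u : u @ \oo --> (0 : R) -> vanishing u.
Proof.
move=> /cvgr0Pnorm_le cu e e0; have [N _ h] := cu e e0; exists N => n Nn.
exact: le_trans (ler_norm _) (h n Nn).
Qed.

End Vanishing.

(** * From the approximate loop equation to L^1 convergence *)

Section MomentConvergence.
Variables (R : realType) (Om : nat -> finType).
Variables (tau : forall n, nat -> Om n -> R) (K : nat -> R) (e : nat -> R) (N0 : nat).
Local Arguments tau : clear implicits.
Hypothesis Om_gt0 : forall n, (N0 <= n)%N -> (0 < #|Om n|)%N.
Hypothesis tau0 : forall n w, (N0 <= n)%N -> tau n 0 w = 1.
Hypothesis tau_sqr : forall n j w, (N0 <= n)%N -> tau n j w ^+ 2 <= tau n j.*2 w.
Hypothesis tau_bound : forall j, exists C : R, forall n, (N0 <= n)%N ->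
  mean (tau n j.*2) <= C.
Hypothesis K_ge0 : forall k, 0 <= K k.
Hypothesis e_vanishing : vanishing e.
Hypothesis loop : forall n k (phi : R -> R), (N0 <= n)%N ->
  (forall a, `|phi a| <= 1) -> (forall a b, `|phi a - phi b| <= `|a - b|) ->
  `|mean (fun w => phi (tau n k.+1 w) *
      (tau n k.+1 w - \sum_(i < k) tau n i w * tau n (k - i.+1) w))| <= K k * e n.

Local Notation c := (semicircle_moment R).

Definition clip (a : R) : R := Num.max (-1) (Num.min 1 a).

Lemma clipE a :
  [\/ 1 <= a /\ clip a = 1, a <= -1 /\ clip a = -1 | -1 < a < 1 /\ clip a = a].
Proof.
rewrite /clip; case: (lerP 1 a) => h.
  by apply: Or31; split=> //; apply/max_idPr; lra.
case: (lerP (-1) a) => h'; last by apply: Or32; split=> //; exact: ltW.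
case: (eqVneq a (-1)) => [->|ne]; first by apply: Or32.
by apply: Or33; split=> //; apply/andP; split=> //; rewrite lt_neqAle eq_sym ne h'.
Qed.

Lemma clip_le1 a : `|clip a| <= 1.
Proof.
rewrite ler_norml; apply/andP; case: (clipE a) => -[h ->]; split; lra.
Qed.

Lemma clip_lip a b : `|clip a - clip b| <= `|a - b|.
Proof.
have := ler_norm (a - b); have := ler_norm (- (a - b)); rewrite normrN ler_norml.
by case: (clipE a) => -[h ->]; case: (clipE b) => -[h' ->] n1 n2;
  apply/andP; split; lra.
Qed.

(** Recovers an L^1 norm from a bounded test function. Where [clip a = a] this follows from
    [(|a| - d) ^+ 2 >= 0]; elsewhere [a * clip a = |a|] and [d^-1 >= 1]. *)
Lemma norm_le_clip d a : 0 < d -> d <= 1 -> `|a| <= d + d^-1 * (a * clip a).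
Proof.
move=> d0 d1.
have di : 1 <= d^-1 by rewrite invf_ge1.
have dd : d^-1 * d = 1 by rewrite mulVf// lt0r_neq0.
case: (clipE a) => -[h ->].
- rewrite mulr1 ger0_norm; last lra.
  by have := ler_wpM2r (le_trans ler01 h) di; lra.
- rewrite ltr0_norm; last lra.
  have a0 : 0 <= - a by lra.
  by have := ler_wpM2r a0 di; lra.
- have : 0 <= d^-1 * (`|a| - d) ^+ 2 by rewrite mulr_ge0 ?sqr_ge0 ?invr_ge0 ?ltW.
  rewrite -expr2 -[a ^+ 2]real_normK ?num_real//.
  have -> : d^-1 * (`|a| - d) ^+ 2 = d^-1 * `|a| ^+ 2 - 2 * (d^-1 * d) * `|a| + (d^-1 * d) * d.
    by ring.
  by rewrite dd; have := normr_ge0 a; lra.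
Qed.

(** The second factor is unbounded, so it is truncated at a level [B = C / d] by
    [y <= B + B^-1 * y ^+ 2]; the excess is at most [B^-1] times bounded even moments. *)
Lemma mean_tau_cross i j : vanishing (fun n => mean (fun w => `|tau n i w - c i|)) ->
  vanishing (fun n => mean (fun w => `|tau n i w - c i| * `|tau n j w|)).
Proof.
move=> vi; have [C1 h1] := tau_bound i; have [C2 h2] := tau_bound j.*2.
pose C := 1 + `|2 * C1 + 2 * c i ^+ 2 + C2|.
have C0 : 0 < C by rewrite /C ltr_pwDl.
apply: vanishing_approx => d d0; exists (fun n => (C / d) *
    mean (fun w => `|tau n i w - c i|)).
  by apply: vanishingZ => //; rewrite divr_ge0 ?ltW.
exists N0 => n Nn; pose B := C / d.
have B0 : 0 < B by rewrite divr_gt0.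
have ptw w : `|tau n i w - c i| * `|tau n j w| <= B * `|tau n i w - c i| +
    B^-1 * (2 * tau n i.*2 w + 2 * c i ^+ 2 + tau n j.*2.*2 w).
  have s1 := tau_sqr i w Nn; have s2 := tau_sqr j w Nn; have s3 := tau_sqr j.*2 w Nn.
  have s4 : `|tau n j w| ^+ 2 ^+ 2 <= tau n j.*2.*2 w.
    apply: le_trans s3; rewrite real_normK ?num_real// lerXn2r ?nnegrE ?sqr_ge0//.
    exact: le_trans (sqr_ge0 _) s2.
  have s5 : `|tau n i w - c i| ^+ 2 <= 2 * tau n i.*2 w + 2 * c i ^+ 2.
    rewrite real_normK ?num_real//; have := sqr_ge0 (tau n i w + c i).
    by move: s1; rewrite !expr2; lra.
  have Bi : 0 <= B^-1 by rewrite invr_ge0 ltW.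
  apply: le_trans (lerD (lexx _) (ler_wpM2l Bi (lerD s5 s4))).
  move: (normr_ge0 (tau n i w - c i)) (normr_ge0 (tau n j w)).
  move: (`|tau n i w - c i|) (`|tau n j w|) => x y x0 y0.
  have key : y <= B + B^-1 * y ^+ 2.
    have : 0 <= B^-1 * (y - B) ^+ 2 by rewrite mulr_ge0 ?sqr_ge0.
    have -> : B^-1 * (y - B) ^+ 2 = B^-1 * y ^+ 2 - 2 * (B^-1 * B) * y + (B^-1 * B) * B.
      by ring.
    by rewrite mulVf ?lt0r_neq0//; lra.
  apply: (le_trans (ler_wpM2l x0 key)).
  rewrite mulrDr [x * B]mulrC lerD2l mulrCA ler_wpM2l//.
  have := sqr_ge0 (x - y ^+ 2); rewrite sqrrB.
  have : 0 <= x ^+ 2 + y ^+ 2 ^+ 2 by rewrite addr_ge0 ?sqr_ge0.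
  by lra.
apply: (le_trans (ler_mean ptw)).
have -> : mean (fun w => B * `|tau n i w - c i| +
    B^-1 * (2 * tau n i.*2 w + 2 * c i ^+ 2 + tau n j.*2.*2 w)) =
  B * mean (fun w => `|tau n i w - c i|) +
  B^-1 * (2 * mean (tau n i.*2) + 2 * c i ^+ 2 + mean (tau n j.*2.*2)).
  by rewrite meanD !meanZ !meanD !meanZ mean_cst ?Om_gt0.
rewrite addrC lerD2r.
have Bi : 0 <= B^-1 by rewrite invr_ge0 ltW.
apply: (@le_trans _ _ (B^-1 * C)); last first.
  by rewrite /B invf_div mulfVK // lt0r_neq0.
apply: ler_wpM2l => //; rewrite /C.
apply: (@le_trans _ _ (2 * C1 + 2 * c i ^+ 2 + C2)).
  by rewrite !lerD ?h2// ler_wpM2l// h1.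
by apply: (le_trans (ler_norm _)); rewrite lerDr.
Qed.

Lemma mean_tau_cvg j : vanishing (fun n => mean (fun w => `|tau n j w - c j|)).
Proof.
elim/ltn_ind: j => -[|k] IH.
  apply: vanishing_le (@vanishing0 R); exists N0 => n Nn.
  rewrite (eq_mean (Y := fun=> 0)); first by rewrite /mean big1 ?mul0r.
  by move=> w; rewrite tau0// /semicircle_moment /= catalan0 subrr normr0.
pose S n w := \sum_(i < k) tau n i w * tau n (k - i.+1) w.
have vS : vanishing (fun n => mean (fun w => `|S n w - c k.+1|)).
  apply: (@vanishing_le _ _ (fun n => \sum_(i < k)
     (mean (fun w => `|tau n i w - c i| * `|tau n (k - i.+1) w|) +
      `|c i| * mean (fun w => `|tau n (k - i.+1) w - c (k - i.+1)|)))).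
    exists 0%N => n _.
    rewrite -[X in _ <= X](eq_bigr _ (fun i _ => erefl)).
    under [leRHS]eq_bigr => i _ do rewrite -meanZ -meanD.
    rewrite -mean_sum; apply: ler_mean => w.
    rewrite semicircle_momentS /S -sumrB; apply: (le_trans (ler_norm_sum _ _ _)).
    apply: ler_sum => i _.
    have -> : tau n i w * tau n (k - i.+1) w - c i * c (k - i.+1) =
      (tau n i w - c i) * tau n (k - i.+1) w + c i * (tau n (k - i.+1) w - c (k - i.+1)).
      by ring.
    by apply: (le_trans (ler_normD _ _)); rewrite !normrM.
  apply: vanishing_sum => i; apply: vanishingD.
    apply: mean_tau_cross; apply: IH; exact: ltnW (ltn_ord i).
  apply: vanishingZ => //; apply: IH; rewrite ltnS; exact: leq_subr.
apply: vanishing_approx => d d0.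
pose d' := Num.min d 1.
have d'0 : 0 < d' by rewrite lt_min d0 ltr01.
have d'1 : d' <= 1 by rewrite ge_min lexx orbT.
exists (fun n => d'^-1 * (K k * e n + mean (fun w => `|S n w - c k.+1|))).
  apply: vanishingZ; first by rewrite invr_ge0 ltW.
  by apply: vanishingD vS; exact: vanishingZ.
exists N0 => n Nn.
(* Centring at the limit makes the tested quantity [a * clip a] with [a = tau n k.+1 w - c k.+1],
   the form required by [norm_le_clip]. *)
pose phi a := clip (a - c k.+1).
have p1 a : `|phi a| <= 1 by exact: clip_le1.
have p2 a b : `|phi a - phi b| <= `|a - b|.
  by apply: (le_trans (clip_lip _ _)); rewrite opprB addrA subrK.
have L := loop k Nn p1 p2.
apply: (@le_trans _ _ (d' + d'^-1 * mean (fun w => (tau n k.+1 w - c k.+1) * phi (tau n k.+1 w)))).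
  rewrite -[X in X + _](mean_cst _ (Om_gt0 Nn)) -meanZ -meanD.
  by apply: ler_mean => w; exact: norm_le_clip.
apply: lerD; first by rewrite ge_min lexx.
apply: ler_wpM2l; first by rewrite invr_ge0 ltW.
have -> : mean (fun w => (tau n k.+1 w - c k.+1) * phi (tau n k.+1 w)) =
  mean (fun w => phi (tau n k.+1 w) * (tau n k.+1 w - S n w)) +
  mean (fun w => phi (tau n k.+1 w) * (S n w - c k.+1)).
  by rewrite -meanD; apply: eq_mean => w; ring.
apply: lerD; first exact: le_trans (ler_norm _) L.
apply: (le_trans (ler_norm _)); apply: (le_trans (ler_norm_mean _)).
by apply: ler_mean => w; rewrite normrM ler_piMl.
Qed.

End MomentConvergence.

(** * Weierstrass approximation *)

Section Weierstrass.
Variable R : realType.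

(* The Bernstein polynomial \sum_i 'C(n, i) X^i (1 - X)^(n - i) phi i, by
   conditioning a sum of n Bernoulli(X) variables on the first one. *)
Fixpoint bernstein n (phi : nat -> R) : {poly R} :=
  if n is m.+1 then (1 - 'X) * bernstein m phi + 'X * bernstein m (phi \o succn)
  else (phi 0)%:P.

Lemma bernsteinS n phi x : (bernstein n.+1 phi).[x] =
  (1 - x) * (bernstein n phi).[x] + x * (bernstein n (phi \o succn)).[x].
Proof. by rewrite /= !hornerE. Qed.

(** Positivity of the Bernstein operator, which averages with weights [1 - x] and [x] at each
    step. *)
Lemma bernstein_dist n (phi psi : nat -> R) c x : 0 <= x <= 1 ->
  (forall i, (i <= n)%N -> `|phi i - c| <= psi i) ->
  `|(bernstein n phi).[x] - c| <= (bernstein n psi).[x].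
Proof.
move=> /andP[x0 x1]; elim: n phi psi => [|n IH] phi psi h.
  by rewrite /= !hornerC; apply: h.
rewrite !bernsteinS.
have h1 : `|(bernstein n phi).[x] - c| <= (bernstein n psi).[x].
  by apply: IH => i ni; apply: h; rewrite leqW.
have h2 : `|(bernstein n (phi \o succn)).[x] - c| <= (bernstein n (psi \o succn)).[x].
  by apply: IH => i ni; apply: h.
have -> : (1 - x) * (bernstein n phi).[x] + x * (bernstein n (phi \o succn)).[x] - c =
  (1 - x) * ((bernstein n phi).[x] - c) + x * ((bernstein n (phi \o succn)).[x] - c).
  by ring.
apply: (le_trans (ler_normD _ _)); rewrite !normrM (ger0_norm x0).
rewrite ger0_norm ?subr_ge0//; apply: lerD; apply: ler_wpM2l => //.
by rewrite subr_ge0.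
Qed.

(** The second moment of a shifted binomial variable. The free shift [t] is what the induction
    needs, as [succn] replaces [t] by [t + 1]. *)
Lemma bernstein_quadratic n a b t x :
  (bernstein n (fun i => a + b * (i%:R + t) ^+ 2)).[x] =
  a + b * ((n%:R * x + t) ^+ 2 + n%:R * x * (1 - x)).
Proof.
elim: n t => [|n IH] t; first by rewrite /= hornerC; ring.
rewrite bernsteinS IH.
have -> : (fun i : nat => a + b * (i%:R + t) ^+ 2) \o succn =
   (fun i : nat => a + b * (i%:R + (t + 1)) ^+ 2).
  by apply/funext => i /=; rewrite -[i.+1]addn1 natrD; ring.
by rewrite IH -[n.+1]addn1 natrD; ring.
Qed.

Lemma continuous_uniform_itv (f : R -> R) (a b e : R) : continuous f -> 0 < e ->
  exists2 d : R, 0 < d &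
    forall x y, a <= x <= b -> `|y - x| < d -> `|f y - f x| <= e.
Proof.
move=> cf e0; have /compact_near_coveringP cpt := @segment_compact R a b.
have := cpt R (0^'+) (fun d x => forall y, `|y - x| < d -> `|f y - f x| <= e) _.
have e2 : 0 < e / 2 by rewrite divr_gt0.
case=> [x _|d /= d0 h].
  have /cvgrPdist_le/(_ _ e2) := cf x; rewrite near_simpl => -[r /= r0 hr].
  have r2 : 0 < r / 2 by rewrite divr_gt0.
  exists (ball x (r / 2), [set d | 0 < d < r / 2]) => /=.
    split; first exact: nbhsx_ballx.
    near=> d => /=; apply/andP; split; near: d; first exact: nbhs_right_gt.
    exact: nbhs_right_lt.
  move=> [x' d] /= [bx /andP[d0 dr]] y yx'.
  have xx' : `|x - x'| < r by apply: (lt_trans bx); lra.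
  have xy : `|x - y| < r.
    have -> : x - y = (x - x') - (y - x') by ring.
    by apply: (le_lt_trans (ler_normB _ _)); move: bx; rewrite /ball /= => bx; lra.
  have := hr x' xx'; have := hr y xy.
  have -> : f y - f x' = (f x - f x') - (f x - f y) by ring.
  by move=> h1 h2; apply: (le_trans (ler_normB _ _)); lra.
exists (d / 2) => [|x y ab yx].
  by rewrite divr_gt0.
apply: (h (d / 2)) => //=; rewrite ?divr_gt0//.
by rewrite /ball /= sub0r normrN ger0_norm; lra.
Unshelve. all: by end_near. Qed.

Lemma bernstein_approx (f : R -> R) (B e : R) : continuous f ->
  (forall x, `|f x| <= B) -> 0 < e ->
  exists p : {poly R}, forall x, 0 <= x <= 1 -> `|f x - p.[x]| <= e.
Proof.
move=> cf fB e0; have e2 : 0 < e / 2 by rewrite divr_gt0.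
have [d d0 hd] := continuous_uniform_itv 0 1 cf e2.
have B0 : 0 <= B := le_trans (normr_ge0 _) (fB 0).
(* Chebyshev's argument: at distance at least [d] from [x], the trivial bound [2 * B] is below [C]
   times the squared distance, and the variance is of order [1 / n]. *)
pose C := 2 * B / d ^+ 2.
have C0 : 0 <= C by rewrite divr_ge0 ?mulr_ge0 ?exprn_ge0 ?(ltW d0).
have [n nC] : exists n, C / (e / 2) < n%:R.
  by exists (Num.truncn (C / (e / 2))).+1; rewrite truncnS_gt.
have n0 : 0 < n%:R :> R by apply: le_lt_trans nC; rewrite divr_ge0// ltW.
exists (bernstein n (fun i => f (i%:R / n%:R))) => x x01.
have /andP[x0 x1] := x01.
rewrite distrC.
apply: (@le_trans _ _ (bernstein n
  (fun i => e / 2 + C / n%:R ^+ 2 * (i%:R + (- n%:R * x)) ^+ 2)).[x]).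
  apply: bernstein_dist => // i _.
  have -> : C / n%:R ^+ 2 * (i%:R + - n%:R * x) ^+ 2 = C * (i%:R / n%:R - x) ^+ 2.
    by field; rewrite lt0r_neq0.
  have S0 : 0 <= C * (i%:R / n%:R - x) ^+ 2 by rewrite mulr_ge0 ?sqr_ge0.
  case: (ltP `|i%:R / n%:R - x| d) => h.
    by apply: (le_trans (hd x _ x01 h)); rewrite lerDl.
  apply: (@le_trans _ _ (2 * B)).
    apply: (le_trans (ler_normB _ _)).
    by have := fB (i%:R / n%:R); have := fB x; lra.
  apply: ler_wpDl; first exact: ltW.
  rewrite /C mulrAC ler_pdivlMr ?exprn_gt0// ler_wpM2l ?mulr_ge0//.
  rewrite -[leRHS]real_normK ?num_real//.
  by apply: lerXn2r => //; rewrite nnegrE ltW.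
rewrite bernstein_quadratic.
have -> : e / 2 + C / n%:R ^+ 2 * ((n%:R * x + - n%:R * x) ^+ 2 + n%:R * x * (1 - x)) =
   e / 2 + (C / n%:R) * (x * (1 - x)) by field; rewrite lt0r_neq0.
have Cn : C / n%:R <= e / 2.
  by rewrite ler_pdivrMr// -ler_pdivrMl// mulrC ltW.
have xx : x * (1 - x) <= 1 by nra.
have xx0 : 0 <= x * (1 - x) by rewrite mulr_ge0// subr_ge0.
have Cn0 : 0 <= C / n%:R by apply: divr_ge0.
by have := ler_pM Cn0 xx0 Cn xx; lra.
Qed.

Lemma Weierstrass_approx (f : R -> R) (B K e : R) : continuous f ->
  (forall x, `|f x| <= B) -> 0 < K -> 0 < e ->
  exists p : {poly R}, forall x, `|x| <= K -> `|f x - p.[x]| <= e.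
Proof.
move=> cf fB K0 e0; pose g y := f (2 * K * y - K).
have cg : continuous g.
  move=> y; apply: (@continuous_comp _ _ _ (fun y => 2 * K * y - K) f); last exact: cf.
  by apply: cvgB; [apply: cvgM; [exact: cvg_cst|exact: cvg_id]|exact: cvg_cst].
have [p hp] := bernstein_approx cg (fun y => fB _) e0.
exists (p \Po ((2 * K)^-1 *: ('X + K%:P))) => x xK.
have K2 : 2 * K != 0 by rewrite mulf_neq0// lt0r_neq0.
have := hp ((2 * K)^-1 * (x + K)); rewrite /g mulVKf// addrK horner_comp !hornerE.
apply; move: xK; rewrite ler_norml => /andP[h1 h2].
rewrite mulrC divr_ge0 ?ler_pdivrMr ?mulr_gt0 ?mulr_ge0//; try lra.
Qed.

End Weierstrass.

(** * The semicircle distribution *)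

Section SemicircleMoments.
Variable R : realType.
Local Notation mu := (@lebesgue_measure R).
Local Notation I2 := `[(- 2 : R), 2]%classic.

Lemma Rintegral_derive (f F : R -> R) (a b : R) : a < b ->
  continuous f -> continuous F ->
  (forall x, a < x < b -> is_derive x 1 F (f x)) ->
  \int[mu]_(x in `[a, b]) f x = F b - F a.
Proof.
move=> ab cf cF dF.
rewrite /Rintegral (@continuous_FTC2 _ f F)//.
- exact: continuous_subspaceT.
- split.
  + by move=> x; rewrite in_itv => /dF[].
  + exact/cvg_at_right_filter/cF.
  + exact/cvg_at_left_filter/cF.
- by move=> x; rewrite in_itv derive1E => /dF[].
Qed.

Definition halfdisk (x : R) : R := Num.sqrt (4 - x ^+ 2).
Local Notation w := halfdisk.

Lemma continuous_halfdisk : continuous w.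
Proof.
move=> x; apply: continuous_comp; last exact: sqrt_continuous.
by apply: cvgB; [exact: cvg_cst|exact: exprn_continuous].
Qed.

Lemma halfdisk_sqr (x : R) : - 2 < x < 2 -> w x ^+ 2 = 4 - x ^+ 2.
Proof. by move=> hx; rewrite sqr_sqrtr//; nra. Qed.

Lemma halfdisk_gt0 (x : R) : - 2 < x < 2 -> 0 < w x.
Proof. by move=> hx; rewrite sqrtr_gt0; nra. Qed.

Lemma is_derive_halfdisk (x : R) : - 2 < x < 2 -> is_derive x 1 w (- x / w x).
Proof.
move=> hx; have w0 := halfdisk_gt0 hx.
have h4 : 0 < 4 - x ^+ 2 by nra.
have dq : is_derive x 1 (fun y : R => 4 - y ^+ 2) (- (x *+ 2)).
  have := is_derive_poly (4%:P - 'X ^+ 2) x.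
  rewrite (_ : horner _ = (fun y : R => 4 - y ^+ 2)); last first.
    by apply/funext => y; rewrite !hornerE.
  move=> h; apply: (is_derive_eq h).
  by rewrite derivB derivC derivXn !hornerE/=; ring.
have h := is_derive1_comp (is_derive1_sqrt h4 :
  is_derive ((fun y : R => 4 - y ^+ 2) x) 1 Num.sqrt _) dq.
 apply: (is_derive_eq h); rewrite -/(w x); field; exact: lt0r_neq0.
Qed.

Lemma halfdisk2 : w 2 = 0.
Proof. by rewrite /w ler0_sqrtr//; nra. Qed.

Lemma halfdiskN x : w (- x) = w x.
Proof. by rewrite /w sqrrN. Qed.

Lemma continuous_horner (p : {poly R}) : continuous (horner p).
Proof.
move=> x; apply: differentiable_continuous.
by apply/derivable1_diffP; case: (is_derive_poly p x).
Qed.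

(** The integrand is the derivative of [q * (4 - x ^+ 2) * w], which vanishes at both ends; the
    factor [4 - x ^+ 2] cancels the singularity of the derivative of [w]. *)
Lemma halfdisk_poly_parts (q : {poly R}) :
  \int[mu]_(x in I2)
    ((q^`() * (4%:P - 'X ^+ 2) - 3%:P * 'X * q).[x] * w x) = 0.
Proof.
have dF (x : R) : - 2 < x < 2 ->
    is_derive x 1 (fun x => (q * (4%:P - 'X ^+ 2)).[x] * w x)
    ((q^`() * (4%:P - 'X ^+ 2) - 3%:P * 'X * q).[x] * w x).
  move=> hx; have dw := is_derive_halfdisk hx.
  have h := is_deriveM (is_derive_poly (q * (4%:P - 'X ^+ 2)) x) dw.
  apply: (is_derive_eq h).
  have w0 := lt0r_neq0 (halfdisk_gt0 hx); have w2 := halfdisk_sqr hx.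
  rewrite derivM derivB derivC derivXn !hornerE /= /GRing.scale/= -w2.
  by field.
rewrite (Rintegral_derive _ _ _ dF).
- by rewrite halfdiskN halfdisk2 !mulr0 subrr.
- by lra.
- by move=> x; apply: cvgM; [exact: continuous_horner|exact: continuous_halfdisk].
- by move=> x; apply: cvgM; [exact: continuous_horner|exact: continuous_halfdisk].
Qed.

Lemma Rintegral_halfdisk : \int[mu]_(x in I2) w x = pi *+ 2.
Proof.
have w2n0 (x : R) : 2 + w x != 0 by rewrite gt_eqF// ltr_pwDl// sqrtr_ge0.
(* With [x = 2 sin a] and [w x = 2 cos a], the quotient [x / (2 + w x)] is the tangent of [a / 2].
   The [atan] term is thus [2 a], in a form that is continuous up to the endpoints. *)
have dF (x : R) : - 2 < x < 2 -> is_derive x 1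
    (fun x => 2^-1 * (x * w x) + 4 * atan (x * (2 + w x)^-1)) (w x).
  move=> hx; have dw := is_derive_halfdisk hx.
  have w0 := lt0r_neq0 (halfdisk_gt0 hx); have w2 := halfdisk_sqr hx.
  have d2w : is_derive x 1 (fun y => 2 + w y) (- x / w x).
    by have := is_deriveD (is_derive_cst (2 : R) x 1) dw; rewrite add0r.
  have dV := @is_deriveV _ (fun y => 2 + w y) _ _ _ (w2n0 x) d2w.
  have dxV := is_deriveM (is_derive_id x 1) dV.
  have dA := @is_derive1_comp _ atan (fun x => x * (2 + w x)^-1) _ _ _ (is_derive1_atan _) dxV.
  have dxw := is_deriveM (is_derive_id x 1) dw.
  have h := is_deriveD (is_deriveZ 2^-1 dxw) (is_deriveZ 4 dA).
  apply: (is_derive_eq h); rewrite /GRing.scale/= !mulr1.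
  move: (w x) (w2n0 x) w0 w2 {dw d2w dV dxV dA dxw h} => a b0 a0 a2.
  have x2 : x ^+ 2 = 4 - a ^+ 2 by rewrite a2; ring.
  have -> : (1 + (x / (2 + a)) ^+ 2)^-1 = (2 + a) / 4.
    rewrite (_ : 1 + _ = 4 / (2 + a)); first by rewrite invf_div.
    by rewrite expr_div_n x2; field.
  apply: (@etrans _ _ (2^-1 * (a - x ^+ 2 / a) + x ^+ 2 / a / (2 + a) + 1)).
    have key (y b : R) : b != 0 -> 2 + b != 0 ->
      2^-1 * (y * (- y / b) + b) +
      4 * ((2 + b) / 4 * (y * (- (2 + b) ^- 2 * (- y / b)) + (2 + b)^-1)) =
      2^-1 * (b - y ^+ 2 / b) + y ^+ 2 / b / (2 + b) + 1.
      by move=> hb h2b; field; rewrite h2b.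
    exact: key.
  by rewrite x2; field; rewrite b0.
rewrite (Rintegral_derive _ _ _ dF).
- rewrite halfdiskN halfdisk2 !mulr0 addr0 mulNr divff ?pnatr_eq0//.
  by rewrite atanN atan1; field.
- by lra.
- exact: continuous_halfdisk.
- move=> x; apply: cvgD; first apply: cvgM; first exact: cvg_cst.
    by apply: cvgM; [exact: cvg_id|exact: continuous_halfdisk].
  apply: cvgM; first exact: cvg_cst.
  apply: continuous_cvg; first exact: continuous_atan.
  apply: cvgM; first exact: cvg_id.
  by apply: cvgV => //; apply: cvgD; [exact: cvg_cst|exact: continuous_halfdisk].
Qed.

Lemma integrable_I2 (f : R -> R) : continuous f ->
  mu.-integrable I2 (EFin \o f).
Proof.
move=> cf; apply: continuous_compact_integrable; first exact: segment_compact.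
exact: continuous_subspaceT.
Qed.

(** [halfdisk_poly_parts] for a monomial. At [j = 0] the left side vanishes whatever the value of
    [j.-1], and the first moment is seen to be zero. *)
Lemma halfdisk_momentS j : 4 * j%:R * \int[mu]_(x in I2) (x ^+ j.-1 * w x) =
  (j%:R + 3) * \int[mu]_(x in I2) (x ^+ j.+1 * w x).
Proof.
have cw k : continuous (fun x : R => x ^+ k * w x).
  by move=> x; apply: cvgM; [exact: exprn_continuous|exact: continuous_halfdisk].
apply/eqP; rewrite -subr_eq0 -!RintegralZl//; try exact: integrable_I2.
have cZ c k : continuous (fun x : R => c * (x ^+ k * w x)).
  by move=> x; apply: cvgM; [exact: cvg_cst|exact: cw].
rewrite -RintegralB//; try exact: integrable_I2.
rewrite -[X in _ == X](halfdisk_poly_parts 'X^j); apply/eqP.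
apply: eq_Rintegral => x _; rewrite derivXn !hornerE /=.
have e : j%:R * x ^+ j.-1 * x ^+ 2 = j%:R * (x ^+ j * x).
  by case: j => [|j]; rewrite ?mul0r//= -mulrA; congr (_ * _); rewrite -exprD -exprSr addn2.
rewrite hornerMn hornerXn -[X in _ = (X * _ - _) * _]mulr_natl mulrBr e exprS.
move: (x ^+ j) (x ^+ j.-1) (w x) (j%:R : R) => a b c d.
have key (y : R) : 4 * d * b * c - (d + 1 + 1 + 1) * (y * a) * c =
  (d * b * 4 - d * (a * y) - 3 * y * a) * c by ring.
exact: key.
Qed.

Lemma continuous_semicircle_pdf : continuous (@semicircle_pdf R).
Proof.
by move=> x; apply: cvgM; [exact: cvg_cst|exact: continuous_halfdisk].
Qed.

Definition scmean (f : R -> R) := \int[mu]_(x in I2) (f x * semicircle_pdf x).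

Let integrable_pdf (f : R -> R) : continuous f ->
  mu.-integrable I2 (EFin \o (fun x => f x * semicircle_pdf x)).
Proof.
move=> cf; apply: integrable_I2 => x; apply: cvgM; first exact: cf.
exact: continuous_semicircle_pdf.
Qed.

Lemma scmeanD (f g : R -> R) : continuous f -> continuous g ->
  scmean (fun x => f x + g x) = scmean f + scmean g.
Proof.
move=> cf cg; rewrite /scmean -RintegralD//; try exact: integrable_pdf.
by apply: eq_Rintegral => x _; rewrite mulrDl.
Qed.

Lemma scmeanZ c (f : R -> R) : continuous f -> scmean (fun x => c * f x) = c * scmean f.
Proof.
move=> cf; rewrite /scmean -RintegralZl//; try exact: integrable_pdf.
by apply: eq_Rintegral => x _; rewrite mulrA.
Qed.

Lemma ler_scmean (f g : R -> R) : continuous f -> continuous g ->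
  (forall x, f x <= g x) -> scmean f <= scmean g.
Proof.
move=> cf cg fg; apply: le_Rintegral => //; try exact: integrable_pdf.
move=> x _; apply: ler_wpM2r => //.
by rewrite mulr_ge0 ?sqrtr_ge0// invr_ge0 mulrn_wge0// pi_ge0.
Qed.

(** The two-step recursion of [halfdisk_momentS] is [catalanS] at even indices; the total mass and
    the first moment start it. *)
Lemma scmeanXn k : scmean (fun x => x ^+ k) = semicircle_moment R k.
Proof.
have pi_neq0 : pi *+ 2 != 0 :> R by rewrite mulrn_eq0/= gt_eqF// pi_gt0.
have scE j : scmean (fun x => x ^+ j) =
    (pi *+ 2)^-1 * \int[mu]_(x in I2) (x ^+ j * w x).
  rewrite -RintegralZl//; first by apply: eq_Rintegral => x _; rewrite mulrCA.
  apply: integrable_I2 => x; apply: cvgM; first exact: exprn_continuous.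
  exact: continuous_halfdisk.
have sc0 : scmean (fun x => x ^+ 0) = 1.
  rewrite scE (_ : Rintegral _ _ _ = pi *+ 2) ?mulVf//.
  by rewrite -Rintegral_halfdisk; apply: eq_Rintegral => x _; rewrite mul1r.
have sc1 : scmean (fun x => x ^+ 1) = 0.
  have /esym/eqP := halfdisk_momentS 0.
  rewrite mulr0 mul0r add0r mulf_eq0 pnatr_eq0/= => /eqP h.
  by rewrite scE h mulr0.
have scS j : 4 * j.+1%:R * scmean (fun x => x ^+ j) =
    (j%:R + 4) * scmean (fun x => x ^+ j.+2).
  rewrite !scE mulrCA (halfdisk_momentS j.+1) mulrCA; congr (_ * (_ * _)).
  by rewrite -natr1; ring.
have j4 (j : nat) : j%:R + 4 != 0 :> R by rewrite -natrD pnatr_eq0 addn_eq0 andbF.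
have [m mk] := ubnP k; elim: m k mk => // m IH [|[|k]] mk.
- by rewrite sc0 /semicircle_moment/= catalan0.
- by rewrite sc1.
apply: (mulfI (j4 k)); rewrite -scS IH; last by rewrite ltnS in mk; apply: ltn_trans mk.
rewrite /semicircle_moment/= negbK; case: ifPn => [_|ke]; first by rewrite !mulr0.
have := catalanS R k./2.
have kE : k%:R = 2 * (k./2)%:R :> R.
  by rewrite -{1}[k]odd_double_half (negbTE ke) add0n -mul2n natrM.
rewrite -!natr1 kE; move: (catalan R k./2) (catalan R k./2.+1) (k./2%:R : R) => a b q h.
lra.
Qed.

Lemma scmean_horner p :
  scmean (horner p) = \sum_(i < size p) p`_i * semicircle_moment R i.
Proof.
rewrite (eq_bigr (fun i : 'I__ => scmean (fun x => p`_i * x ^+ i))); last first.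
  by move=> i _; rewrite scmeanZ ?scmeanXn//; exact: exprn_continuous.
rewrite (_ : horner p = fun x : R => \sum_(i < size p) p`_i * x ^+ i); last first.
  by apply/funext => x; rewrite horner_coef.
elim: (size p) => [|n IH].
  rewrite big_ord0 -[RHS](mul0r (scmean (fun=> 1))) -scmeanZ; last exact: cst_continuous.
  by congr scmean; apply/funext => x; rewrite big_ord0 mul0r.
rewrite big_ord_recr/= -IH -scmeanD.
- by congr scmean; apply/funext => x; rewrite big_ord_recr.
- move=> x; rewrite (_ : (fun x => _) = horner (\poly_(i < n) p`_i)).
    exact: continuous_horner.
  by apply/funext => y; rewrite horner_poly.
- by move=> x; apply: cvgM; [exact: cvg_cst|exact: exprn_continuous].
Qed.

Lemma semicircle_approx (f : R -> R) (p : {poly R}) a c r : continuous f ->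
  (forall x, `|f x - p.[x]| <= a + c * x ^+ r) ->
  `|scmean f - scmean (horner p)| <= a + c * semicircle_moment R r.
Proof.
move=> cf fp; have cp : continuous (horner p) by exact: continuous_horner.
have cb : continuous (fun x : R => a + c * x ^+ r).
  move=> x; apply: cvgD; first exact: cvg_cst.
  by apply: cvgM; [exact: cvg_cst|exact: exprn_continuous].
have bE : scmean (fun x => a + c * x ^+ r) = a + c * semicircle_moment R r.
  have cX k : continuous (fun x : R => x ^+ k) by move=> x; exact: exprn_continuous.
  rewrite (_ : (fun x => _) = (fun x : R => a * x ^+ 0 + c * x ^+ r)); last first.
    by apply/funext => x; rewrite mulr1.
  rewrite scmeanD; try by move=> x; apply: cvgM; [exact: cvg_cst|exact: cX].
  by rewrite !scmeanZ// !scmeanXn /semicircle_moment/= catalan0 mulr1.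
rewrite -bE ler_norml; apply/andP; split.
- rewrite lerBrDr addrC lerBlDr -scmeanD//.
  apply: ler_scmean => //; first by move=> x; apply: cvgD; [exact: cf|exact: cb].
  by move=> x; move: (fp x); rewrite ler_norml; lra.
- rewrite lerBlDr -scmeanD//.
  apply: ler_scmean => //; first by move=> x; apply: cvgD; [exact: cb|exact: cp].
  by move=> x; move: (fp x); rewrite ler_norml; lra.
Qed.

End SemicircleMoments.

(** * Integrals against the semicircle and empirical measures *)

Section SpectralIntegrals.
Variable R : realType.
Local Notation mu := (@lebesgue_measure R).
Local Notation I2 := `[(- 2 : R), 2]%classic.

Lemma measurable_semicircle_pdf :
  measurable_fun [set: measurableTypeR R] (@semicircle_pdf R).
Proof.
apply: continuous_measurable_fun; exact: continuous_semicircle_pdf.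
Qed.

Lemma semicircle_pdf_ge0 (x : R) : 0 <= semicircle_pdf x.
Proof. by rewrite mulr_ge0 ?sqrtr_ge0// invr_ge0 mulrn_wge0// pi_ge0. Qed.

Lemma semicircle_pdf_eq0 (x : R) : ~ I2 x -> semicircle_pdf x = 0.
Proof.
move=> xI; rewrite /semicircle_pdf ler0_sqrtr ?mulr0//.
have [h|h] := leP 2 `|x|; first by rewrite -(real_normK (num_real x)); nra.
by exfalso; apply: xI; rewrite /= in_itv/= -ler_norml ltW.
Qed.

Lemma integrable_semicircle_pdf :
  mu.-integrable [set: measurableTypeR R] (EFin \o @semicircle_pdf R).
Proof.
have -> : EFin \o @semicircle_pdf R = (EFin \o @semicircle_pdf R) \_ I2.
  apply/funext => x; rewrite patchE; case: ifPn => //.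
  by rewrite notin_setE => /semicircle_pdf_eq0/= ->.
apply/integrable_restrict => //; rewrite setTI.
exact/integrable_I2/continuous_semicircle_pdf.
Qed.

Let semicircle_fin_num : fin_num_fun (semicircle R).
Proof.
apply: lty_fin_num_fun => /=.
have /integrableP[_] := integrable_semicircle_pdf.
under eq_integral do rewrite gee0_abs ?lee_fin ?semicircle_pdf_ge0//.
by [].
Qed.

HB.instance Definition _ := @Measure_isFinite.Build _ _ _
  (semicircle R) semicircle_fin_num.

Lemma semicircle_dominated : semicircle R `<< mu.
Proof.
apply/null_content_dominatesP => A mA muA0; apply: null_set_integral => //.
apply/measurable_EFinP; apply: measurable_funTS.
exact: measurable_semicircle_pdf.
Qed.

(** The change of variables is expressed with the Radon-Nikodym derivative, which is identified
    almost everywhere with [semicircle_pdf] by comparing integrals over measurable sets. *)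
Lemma Rintegral_semicircle (f : R -> R) (B : R) : continuous f ->
  (forall x, `|f x| <= B) -> \int[semicircle R]_x f x = scmean f.
Proof.
move=> cf fB.
have mf : measurable_fun [set: measurableTypeR R] f by exact: continuous_measurable_fun.
have intf : (semicircle R).-integrable [set: measurableTypeR R] (EFin \o f).
  apply: measurable_bounded_integrable => //.
    by rewrite -ge0_fin_numE// fin_num_measure.
  exists B; split; first by rewrite num_real.
  by move=> x Bx y _; apply: le_trans (fB y) (ltW Bx).
rewrite /Rintegral -(Radon_Nikodym_change_of_variables semicircle_dominated)//=.
transitivity (fine (\int[mu]_x (f x * semicircle_pdf x)%:E)); last first.
  rewrite /scmean /Rintegral [in RHS]integral_mkcond; congr fine.
  apply: eq_integral => x _; rewrite patchE; case: ifPn => //.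
  by rewrite notin_setE => /semicircle_pdf_eq0 ->; rewrite mulr0.
congr fine; apply: ae_eq_integral => //.
- apply: emeasurable_funM; first exact/measurable_EFinP.
  apply: (measurable_int mu).
  by apply: Radon_Nikodym_integrable; exact: semicircle_dominated.
- apply/measurable_EFinP; apply: measurable_funM => //.
  exact: measurable_semicircle_pdf.
- under [X in ae_eq _ _ _ X]eq_fun do rewrite EFinM.
  apply: ae_eqe_mul2l => /=.
  rewrite Radon_NikodymE//=; first exact: semicircle_dominated.
  move=> dom; case: cid => /= h [h1 h2 h3].
  apply: integral_ae_eq => //=.
  + by apply/measurable_EFinP; exact: measurable_semicircle_pdf.
  + by move=> E _ mE; rewrite -h3.
Qed.

Lemma Rintegral_empirical n (A : 'M[R]_n) (f : R -> R) :
  A^T = A -> continuous f ->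
  \int[empirical_spectral_distribution A]_x f x =
  n%:R^-1 * \sum_(x <- eigenvalues A) f x.
Proof.
move=> /eigenvalues_sym[sz _] cf.
have mf : measurable_fun [set: measurableTypeR R] (EFin \o f).
  by apply/measurable_EFinP; exact: continuous_measurable_fun.
pose a i : measurableTypeR R := (eigenvalues A)`_i.
(* Scaling and summing measures are handled for nonnegative integrands, and [f] is then recovered
   from its positive and negative parts. *)
have nneg (g : measurableTypeR R -> \bar R) : measurable_fun setT g ->
    (forall x, 0 <= g x)%E ->
    (\int[empirical_spectral_distribution A]_x g x =
     n%:R^-1%:E * \sum_(i < n) g (a i))%E.
  move=> mg g0; rewrite /empirical_spectral_distribution.
  rewrite ge0_integral_mscale//= ge0_integral_measure_sum//.
  congr (_ * _)%E; apply: eq_bigr => i _.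
  by rewrite integral_dirac// diracT mul1e.
have sumE (g : R -> R) : (n%:R^-1%:E * \sum_(i < n) (g (a i))%:E)%E =
    (n%:R^-1 * \sum_(x <- eigenvalues A) g x)%:E.
  by rewrite sumEFin -EFinM (big_nth 0) big_mkord sz.
have posE : (EFin \o f)^\+%E = (fun x => (Num.max (f x) 0)%:E).
  by apply/funext => x; rewrite funeposE /= EFin_max.
have negE : (EFin \o f)^\-%E = (fun x => (Num.max (- f x) 0)%:E).
  by apply/funext => x; rewrite funenegE /= EFin_max.
have /= m1 := measurable_funepos mf; have /= m2 := measurable_funeneg mf.
rewrite /Rintegral integralE !nneg//; rewrite posE negE.
rewrite (sumE (fun x => Num.max (f x) 0)) (sumE (fun x => Num.max (- f x) 0)).
rewrite -EFinB/= -mulrBr -sumrB.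
congr (_ * _); apply: eq_bigr => x _.
by case: (leP (f x) 0) => h; case: leP => h'; lra.
Qed.

End SpectralIntegrals.

(** * The configuration model *)

Section PerfectMatchings.
Variable H : finType.
Implicit Types (f g : matching H) (m : {set {set H}}).

(** Positions [2 i] and [2 i + 1] of an enumeration are paired; evenness gives the last position a
    partner. *)
Lemma matching_exists : ~~ odd #|H| -> (0 < #|{: matching H}|)%N.
Proof.
move=> oH; pose flip i := if odd i then i.-1 else i.+1.
have flipK : involutive flip.
  by case=> [|i]//; rewrite /flip /=; case oi: (odd i) => /=; rewrite oi.
have flip_neq i : flip i != i by rewrite /flip; case: i => [|i]//=; case: ifP => _; lia.
have flip_lt i : (i < #|H|)%N -> (flip i < #|H|)%N.
  move=> iH; rewrite /flip; case: ifP => oi; first lia.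
  by rewrite ltn_neqAle iH andbT; apply: contraNneq oH => <-; rewrite /= oi.
pose h x := nth x (enum H) (flip (index x (enum H))).
have idx x : (index x (enum H) < #|H|)%N by rewrite cardE index_mem mem_enum.
have hidx x : index (h x) (enum H) = flip (index x (enum H)).
  by rewrite index_uniq ?enum_uniq// -cardE flip_lt.
have hK : involutive h.
  by move=> x; rewrite {1}/h hidx flipK (set_nth_default x) ?nth_index ?mem_enum// -cardE.
have h_neq x : h x != x.
  by apply: contra_neq (flip_neq (index x (enum H))) => hx; rewrite -hidx hx.
pose f := perm (inv_inj hK).
have fP : is_matching f by apply/forallP => x; rewrite !permE hK eqxx h_neq.
by apply/card_gt0P; exists (exist _ f fP).
Qed.

Definition edges f : {set {set H}} := [set [set x; partner f x] | x : H]%SET.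

Lemma edges_block f e x : e \in edges f -> x \in e -> e = [set x; partner f x]%SET.
Proof.
move=> /imsetP[y _ ->]; rewrite !inE => /orP[/eqP ->//|/eqP ->].
by rewrite partnerK finset.setUC.
Qed.

Lemma mem_edges f x y : ([set x; y]%SET \in edges f) = (y == partner f x).
Proof.
apply/idP/eqP => [/edges_block/(_ (set21 x y)) e|->]; last exact: imset_f.
have : partner f x \in [set x; y]%SET by rewrite e set22.
by rewrite !inE (negbTE (partner_neq f x)) => /eqP.
Qed.

Lemma edges_inj : injective edges.
Proof.
move=> f g e; apply/val_inj/permP => x; apply/eqP.
by rewrite -[_ == _](mem_edges g) -e; apply: imset_f.
Qed.

Lemma edges_partition f : finset.partition (edges f) [set: H]%SET.
Proof.
apply/and3P; split.
- apply/eqP/finset.setP => x; rewrite finset.in_setT; apply/bigcupP.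
  by exists [set x; partner f x]%SET; [exact: imset_f|exact: set21].
- apply/finset.trivIsetP => A B Af Bf; apply: contraNT => /pred0Pn[x /andP[/= xA xB]].
  by rewrite (edges_block Af xA) (edges_block Bf xB).
- by apply/imsetP => -[x _ e]; have := set21 x (partner f x); rewrite -e inE.
Qed.

Lemma card_edges f e : e \in edges f -> #|e| = 2%N.
Proof. by move=> /imsetP[x _ ->]; rewrite cards2 eq_sym partner_neq. Qed.

(** The involution sends [x] to the other element of its block. With [edges_inj], uniform set
    matchings and uniform involutions have the same averages. *)
Lemma edges_surj m : finset.partition m [set: H]%SET ->
  (forall e, e \in m -> #|e| = 2%N) -> exists f, m = edges f.
Proof.
move=> mP m2; have /and3P[/eqP mc mt _] := mP.
have xm x : x \in finset.cover m by rewrite mc finset.in_setT.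
have pm x : finset.pblock m x \in m by rewrite finset.pblock_mem.
have xp x : x \in finset.pblock m x by rewrite finset.mem_pblock.
have /fin_all_exists[h hP] x : exists y, (y != x) && (finset.pblock m x == [set x; y]%SET).
  have /eqP/cards2P[a [b [ab e]]] := m2 _ (pm x).
  have := xp x; rewrite e !inE => /orP[] /eqP ->; [exists b|exists a].
    by rewrite eq_sym ab eqxx.
  by rewrite ab finset.setUC eqxx.
have hK : involutive h.
  move=> x; have /andP[hx /eqP ex] := hP x; have /andP[hhx /eqP ehx] := hP (h x).
  have e : finset.pblock m (h x) = finset.pblock m x.
    by apply: finset.def_pblock => //; rewrite ex set22.
  have : h (h x) \in finset.pblock m x by rewrite -e ehx set22.
  by rewrite ex !inE (negbTE hhx) orbF => /eqP.
pose f := perm (inv_inj hK).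
have fP : is_matching f.
  by apply/forallP => x; rewrite !permE hK eqxx; have /andP[] := hP x.
exists (exist _ f fP); apply/finset.setP => e; apply/idP/imsetP => [em|[x _ ->]].
  have /card_gt0P[x xe] : (0 < #|e|)%N by rewrite m2.
  exists x => //; rewrite -(finset.def_pblock mt em xe).
  by have /andP[_ /eqP ->] := hP x; rewrite /partner/= permE.
by rewrite /partner/= permE; have /andP[_ /eqP <-] := hP x.
Qed.

End PerfectMatchings.

Section ConfigurationModelMatchings.
Variables (R : realType) (n : nat) (d : 'I_n -> nat).
Hypothesis d_gt0 : forall i, (0 < d i)%N.
Local Notation H := (half_edge d).

Lemma perfect_matchings_edges :
  perfect_matchings d = [set edges f | f : matching H]%SET.
Proof.
apply/finset.setP => m; rewrite inE; apply/andP/imsetP => [[mP /forall_inP m2]|].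
  have [f fm] := edges_surj mP (fun e em => eqP (m2 e em)).
  by exists f.
move=> [f _ ->]; split; first exact: edges_partition.
by apply/forall_inP => e /card_edges ->.
Qed.

Lemma expectation_cmE (X : {set {set H}} -> R) :
  expectation_cm d X = mean (fun f : matching H => X (edges f)).
Proof.
rewrite /expectation_cm /mean perfect_matchings_edges.
rewrite big_imset/=; last by move=> f g _ _; exact: edges_inj.
rewrite card_imset; last exact: edges_inj.
by congr (_ / _); apply: eq_bigl => f; rewrite inE.
Qed.

Lemma prob_cmE (E : pred {set {set H}}) :
  prob_cm d R E = mean (fun f : matching H => (E (edges f))%:R).
Proof.
rewrite -(expectation_cmE (fun m => (E m)%:R)) /prob_cm /expectation_cm.
congr (_ / _); rewrite cardsE -sum1_card natr_sum big_mkcondr/=.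
by apply: eq_bigr => m _; case: ifP => _; rewrite ?mulr0n.
Qed.

Lemma card_half_edge : #|H| = total_degree d.
Proof.
by rewrite card_tagged sumnE big_map big_enum; apply: eq_bigr => i _; rewrite card_ord.
Qed.

Lemma sum_half_edge (F : H -> R) i :
  \sum_(s < d i) F (hedge s) = \sum_(x : H | tag x == i) F x.
Proof.
rewrite -(@big_pred1_eq R 0 +%R _ i (fun i => \sum_(s < d i) F (hedge s))) sig_big_dep.
by apply: eq_big => [x|[j s] _//]; rewrite andbT.
Qed.

Lemma card_half_edge_fiber i : #|[set x : H | tag x == i]%SET| = d i.
Proof.
apply/eqP; rewrite -(@eqr_nat R) -sum1_card natr_sum (eq_bigl (fun x => tag x == i)).
  by rewrite -(sum_half_edge (fun=> 1)) sumr_const card_ord.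
by move=> x; rewrite inE.
Qed.

Lemma adjacency_edges (f : matching H) i j : (adjacency (edges f) i j)%:R =
  \sum_(x : H | tag x == i) (tag (partner f x) == j)%:R :> R.
Proof.
rewrite natr_sum -(sum_half_edge (fun x => (tag (partner f x) == j)%:R)).
apply: eq_bigr => s _; rewrite natr_sum.
rewrite (eq_bigr (fun t : 'I_(d j) => (hedge t == partner f (hedge s))%:R)); last first.
  by move=> t _; rewrite /matched mem_edges.
rewrite (sum_half_edge (fun y => (y == partner f (hedge s))%:R)).
rewrite big_mkcond (bigD1 (partner f (hedge s)))//= eqxx big1 ?addr0.
  by case: ifP.
by move=> y /negbTE ->; case: ifP.
Qed.

Lemma normalized_laplacian_edges (f : matching H) :
  normalized_laplacian R (edges f) =
  lapm (tag : H -> 'I_n) d (Num.sqrt ((total_degree d)%:R / n%:R)) f.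
Proof.
have d0 i : 0 < (d i)%:R :> R by rewrite ltr0n.
have uE (x : H) i : uvec R (tag : H -> 'I_n) d x 0 i =
    (Num.sqrt (d i)%:R)^-1 * (tag x == i)%:R.
  rewrite /uvec /kap !mxE eqxx/= [i == _]eq_sym; case: eqP => [->|_].
    by rewrite sqrtrV// ltW.
  by rewrite !mulr0.
have gE i : gvec R (tag : H -> 'I_n) d 0 i = Num.sqrt (d i)%:R.
  rewrite /gvec summxE (eq_bigr (fun x => (Num.sqrt (d i)%:R)^-1 * (tag x == i)%:R)).
    rewrite -mulr_sumr -natr_sum -big_mkcond/= sum1dep_card card_half_edge_fiber.
    rewrite -{2}[(d i)%:R]sqr_sqrtr ?ltW// expr2 mulKf//.
    by rewrite sqrtr_eq0 -ltNge.
  by move=> x _; rewrite uE.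
apply/matrixP => i j; rewrite /lapm /adjm /csub !mxE card_half_edge -mulrA; congr (_ * _).
rewrite summxE big_ord1 !mxE !gE mulrBr adjacency_edges sqrtrM ?ltW//.
have s0 k : Num.sqrt (d k)%:R != 0 :> R by rewrite sqrtr_eq0 -ltNge.
congr (_ - _).
  rewrite mulr_sumr [LHS]big_mkcond/=; apply: eq_bigr => x _.
  rewrite !mxE big_ord1 mxE !uE invfM.
  by case: eqP => _; rewrite ?mulr1 ?mulr0 ?mul0r// -mulrA.
rewrite -{2}[(d i)%:R]sqr_sqrtr ?ltW// -{2}[(d j)%:R]sqr_sqrtr ?ltW//.
have key (a b c : R) : a != 0 -> b != 0 ->
    (a * b)^-1 * (a ^+ 2 * b ^+ 2 * c) = c * (a * b).
  by move=> a0 b0; field; rewrite b0.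
by rewrite key.
Qed.

End ConfigurationModelMatchings.

(** * From the degree hypothesis to moment convergence *)

Section DegreeAsymptotics.
Variable R : realType.

Lemma min_degree_le n (d : 'I_n -> nat) i : (min_degree d <= d i)%N.
Proof.
rewrite /min_degree; have := mem_index_enum i.
move: (\max_(_ < n) _)%N => a; elim: (index_enum _) => // j r IH; rewrite inE big_cons geq_min.
by case/orP => [/eqP ->|/IH ->]; rewrite ?leqnn ?orbT.
Qed.

(* The threshold n >= 3 makes D = s^2 n >= 3 s^2 >= 2 s + 1. *)
Lemma degree_ratio_bounds n (d : 'I_n -> nat) :
  (forall i, (0 < d i)%N) -> ~~ odd (total_degree d) -> (2 < n)%N ->
  let s : R := Num.sqrt ((total_degree d)%:R / n%:R) in
  let dmin : R := (min_degree d)%:R in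
  2 <= dmin / s ->
  [/\ (1 < #|half_edge d|)%N, s ^+ 2 * n%:R = #|half_edge d|%:R, 0 < dmin,
    s <= dmin & shift_coef (half_edge d) s <= 2^-1].
Proof.
move=> d_gt0 D_even n2 s dmin; rewrite card_half_edge => ratio.
have n0 : 0 < n%:R :> R by rewrite ltr0n (ltn_trans _ n2).
have Dn : (n <= total_degree d)%N.
  rewrite -[leqLHS]card_ord -sum1_card; apply: leq_sum => i _; exact: d_gt0.
have D1 : (1 < total_degree d)%N by rewrite (leq_trans _ Dn)// (ltn_trans _ n2).
have s2 : s ^+ 2 * n%:R = (total_degree d)%:R.
  by rewrite sqr_sqrtr ?divr_ge0// divfK// lt0r_neq0.
have s1 : 1 <= s.
  rewrite -[leLHS]sqrtr1 ler_wsqrtr// ler_pdivlMr// mul1r ler_nat//.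
have s0 : 0 < s := lt_le_trans ltr01 s1.
have q2 : 2 * s <= dmin by rewrite -ler_pdivlMr.
split => //; try lra.
rewrite /shift_coef /csub card_half_edge -s2.
have n3 : 3 <= n%:R :> R by rewrite ler_nat.
have h : 2 * s + 1 <= s ^+ 2 * n%:R.
  apply: (@le_trans _ _ (s ^+ 2 * 3)); first by nra.
  by rewrite ler_pM2l// exprn_gt0.
rewrite ler_pdivrMr; last lra.
by lra.
Qed.

Variables (d : forall n : nat, 'I_n -> nat).
Local Arguments d : clear implicits.
Hypothesis d_gt0 : forall n i, (0 < d n i)%N.
Hypothesis D_even : forall n, ~~ odd (total_degree (d n)).
Let s n : R := Num.sqrt ((total_degree (d n))%:R / n%:R).
Hypothesis min_degree_large :
  (fun n : nat => (min_degree (d n))%:R / s n) @ \oo --> +oo.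

Lemma card_matching_gt0 n : (0 < #|{: matching (half_edge (d n))}|)%N.
Proof. by apply: matching_exists; rewrite card_half_edge. Qed.

Lemma min_degree_ratio_ge (A : R) :
  exists N, forall n, (N <= n)%N -> A <= (min_degree (d n))%:R / s n.
Proof.
have /cvgryPge/(_ A)[N _ NA] := min_degree_large.
by exists N => n; exact: NA.
Qed.

Lemma loop_error_vanishing :
  vanishing (fun n => s n / (min_degree (d n))%:R + n%:R^-1).
Proof.
apply: vanishingD => e e0.
  have [N NA] := min_degree_ratio_ge e^-1; exists N => n /NA.
  rewrite -[s n / _]invf_div; move: (_ / _) => a h.
  have a0 : 0 < a by apply: lt_le_trans h; rewrite invr_gt0.
  by rewrite -[leRHS]invrK lef_pV2 ?posrE ?invr_gt0.
have [N NA] := @cvg_vanishing R _ (@cvg_harmonic R) e e0.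
(* The harmonic sequence is indexed from [1 / 1], hence the shift by one. *)
exists N.+1 => -[//|n] /NA; exact.
Qed.

Let tau' n j (f : matching (half_edge (d n))) : R :=
  tau (tag : half_edge (d n) -> 'I_n) (d n) (s n) j f.
Local Arguments tau' : clear implicits.

Lemma mean_spectral_moment_cvg j :
  vanishing (fun n => mean (fun f => `|tau' n j f - semicircle_moment R j|)).
Proof.
have [N1 ratio2] := min_degree_ratio_ge 2.
(* Beyond [N0] both requirements of [degree_ratio_bounds] hold: ratio at least 2 and at least three
   vertices. *)
pose N0 := maxn N1 3.
have bounds n : (N0 <= n)%N -> _ := fun h => degree_ratio_bounds (d_gt0 (n := n))
  (D_even n) (leq_trans (leq_maxr _ _) h) (ratio2 _ (leq_trans (leq_maxl _ _) h)).
have n_gt0 n : (N0 <= n)%N -> (0 < n)%N.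
  by move=> h; apply: leq_trans h; rewrite leq_max orbT.
have s_ge0 n : 0 <= s n := sqrtr_ge0 _.
have dmin_le n i : (min_degree (d n))%:R <= (d n i)%:R :> R.
  by rewrite ler_nat min_degree_le.
pose K k : R := 3000 * k.+1%:R ^+ 2 * loop_Q R k.
pose Om n : finType := matching (half_edge (d n)).
have tau0 n w : (N0 <= n)%N -> tau' n 0 w = 1.
  move=> Nn; rewrite /tau' /tau expr0 mxtrace1 mulfV//.
  by rewrite pnatr_eq0 -lt0n n_gt0.
have tau_sqr n i w : (N0 <= n)%N -> tau' n i w ^+ 2 <= tau' n i.*2 w.
  move=> Nn; rewrite /tau' /tau.
  have nn : n%:R != 0 :> R by rewrite pnatr_eq0 -lt0n n_gt0.
  have := trX_sqr_le i (lapm_sym (tag : half_edge (d n) -> 'I_n) (d n) (s n) w).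
  move: (\tr _) (\tr _) => a b h.
  rewrite expr_div_n [X in _ / X]expr2 invfM mulrA ler_wpM2r//.
  by rewrite ler_pdivrMr ?ltr0n ?n_gt0// mulrC.
have tau_bound i : exists C : R, forall n, (N0 <= n)%N -> mean (tau' n i.*2) <= C.
  exists (moment_const R i) => n Nn.
  have [h1 h2 h3 h4 h5] := bounds n Nn.
  have := mean_trX_le (d_gt0 (n := n)) (card_half_edge_fiber R (d n)) h1
    (card_matching_gt0 n) (s_ge0 n) h2 h3 (dmin_le n) h4 h5 i.
  move=> h; rewrite (eq_mean (Y := fun f => n%:R^-1 *
    \tr (lapm (tag : half_edge (d n) -> 'I_n) (d n) (s n) f ^+ i.*2))); last first.
    by move=> f; rewrite mulrC.
  by rewrite meanZ mulrC ler_pdivrMr ?ltr0n ?n_gt0.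
have K_ge0 k : 0 <= K k.
  rewrite /K; move: 3000%N => c.
  apply: mulr_ge0; first by apply: mulr_ge0; [exact: ler0n|exact: exprn_ge0].
  exact: le_trans ler01 (loop_Q_ge1 R k).
refine (@mean_tau_cvg R Om tau' K _ N0 (fun n _ => card_matching_gt0 n) tau0
  tau_sqr tau_bound K_ge0 loop_error_vanishing _ j).
move=> n k phi Nn phi1 phil.
have [h1 h2 h3 h4 h5] := bounds n Nn.
exact: (loop_bound (d_gt0 (n := n)) (card_half_edge_fiber R (d n)) h1
  (card_matching_gt0 n) (s_ge0 n) h2 h3 (dmin_le n) h4 h5 k phi1 phil).
Qed.

End DegreeAsymptotics.

(** * From moments to weak convergence *)

Section WeakConvergence.
Variable R : realType.

Lemma horner_growth (p : {poly R}) : exists2 C, 0 <= C &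
  forall x, 3 <= `|x| -> `|p.[x]| <= C * (`|x| / 3) ^+ size p.
Proof.
exists (\sum_(i < size p) `|p`_i| * 3 ^+ size p) => [|x x3].
  by apply: sumr_ge0 => i _; rewrite mulr_ge0 ?exprn_ge0.
rewrite -mulr_suml -mulrA -exprMn [3 * _]mulrC divfK// mulr_suml horner_coef.
apply: (le_trans (ler_norm_sum _ _ _)); apply: ler_sum => i _.
rewrite normrM normrX ler_wpM2l//; apply: ler_weXn2l; last exact: ltnW.
by apply: le_trans x3; rewrite ler1n.
Qed.

(** The polynomial and [C] are fixed before [r]. Beyond 3 the error is charged to
    [(|x| / 3) ^+ r.*2], whose semicircle mean is at most [(4 / 9) ^+ r]; the gap between 2 and 3
    makes it decay. *)
Lemma polynomial_approx (f : R -> R) (B a : R) : continuous f ->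
  (forall x, `|f x| <= B) -> 0 < a ->
  exists p : {poly R}, exists2 C, 0 <= C & exists m, forall r, (m <= r)%N ->
    forall x, `|f x - p.[x]| <= a + C / 9 ^+ r * x ^+ r.*2.
Proof.
move=> cf fB a0; have [p pP] := Weierstrass_approx cf fB (ltr0n R 3) a0.
have [C C0 pC] := horner_growth p.
have B0 : 0 <= B := le_trans (normr_ge0 _) (fB 0).
exists p, (B + C); first exact: addr_ge0.
exists (size p) => r pr x.
have -> : (B + C) / 9 ^+ r * x ^+ r.*2 = (B + C) * (`|x| / 3) ^+ r.*2.
  rewrite -mulrA; congr (_ * _); rewrite -mul2n !exprM !expr_div_n.
  by rewrite real_normK ?num_real// mulrC; congr (_ * (_ ^+ _)^-1); ring.
have [x3|x3] := leP `|x| 3.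
  apply: le_trans (pP _ x3) _; rewrite lerDl mulr_ge0 ?addr_ge0 ?exprn_ge0//.
have x1 : 1 <= `|x| / 3 by rewrite ler_pdivlMr// mul1r ltW.
have le1 : 1 <= (`|x| / 3) ^+ r.*2 by exact: exprn_ege1.
apply: (le_trans (ler_normB _ _)); rewrite mulrDl.
have h1 : `|f x| <= B * (`|x| / 3) ^+ r.*2 by apply: (le_trans (fB x)); rewrite ler_peMr.
have h2 : `|p.[x]| <= C * (`|x| / 3) ^+ r.*2.
  apply: (le_trans (pC x (ltW x3))); apply: ler_wpM2l => //.
  by apply: ler_weXn2l => //; rewrite -addnn; apply: leq_trans (leq_addr _ _).
by apply: le_trans (lerD h1 h2) _; rewrite lerDr ltW.
Qed.

Lemma expr_ratio_vanishing (z : R) : `|z| < 1 -> vanishing (fun r => z ^+ r).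
Proof. by move=> /cvg_expr/cvg_vanishing. Qed.

(* Deterministic comparison: beyond [-3, 3] the error is paid by the even
   moment of order 2 r, whose semicircle value is at most 4 ^ r. *)
Lemma spectral_integral_error n (A : 'M[R]_n) (f : R -> R) (B a c : R)
    (p : {poly R}) r : (0 < n)%N -> A^T = A -> continuous f ->
  (forall x, `|f x| <= B) ->
  (forall x, `|f x - p.[x]| <= a + c * x ^+ r) ->
  `|\int[empirical_spectral_distribution A]_x f x - \int[semicircle R]_x f x| <=
  a *+ 2 + c * (\tr (A ^+ r) / n%:R + semicircle_moment R r) +
  \sum_(i < size p) `|p`_i| * `|\tr (A ^+ i) / n%:R - semicircle_moment R i|.
Proof.
pose t j := \tr (A ^+ j) / n%:R.
move=> n0 sA cf fB fp; rewrite Rintegral_empirical// (Rintegral_semicircle cf fB).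
have nn : n%:R != 0 :> R by rewrite pnatr_eq0 -lt0n.
have tE j : t j = n%:R^-1 * \sum_(x <- eigenvalues A) x ^+ j.
  by rewrite /t eigenvalues_trX// mulrC.
have pE : n%:R^-1 * \sum_(x <- eigenvalues A) p.[x] = \sum_(i < size p) p`_i * t i.
  under eq_bigr do rewrite horner_coef.
  rewrite exchange_big mulr_sumr; apply: eq_bigr => i _.
  by rewrite tE mulrCA -mulr_sumr.
have h1 : `|n%:R^-1 * \sum_(x <- eigenvalues A) f x -
    n%:R^-1 * \sum_(x <- eigenvalues A) p.[x]| <= a + c * t r.
  rewrite -mulrBr -sumrB normrM [`|_^-1|]ger0_norm// mulrC ler_pdivrMr ?ltr0n//.
  apply: (le_trans (ler_norm_sum _ _ _)).
  apply: (@le_trans _ _ (\sum_(x <- eigenvalues A) (a + c * x ^+ r))).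
    by apply: ler_sum => x _; exact: fp.
  rewrite big_split/= -mulr_sumr big_const_seq count_predT.
  have [-> _] := eigenvalues_sym sA.
  by rewrite iter_addr_0 mulrDl mulr_natr lerD2l tE; rewrite mulrCA mulrAC mulVf// mul1r.
have h2 := semicircle_approx cf fp; rewrite scmean_horner in h2.
have h3 : `|\sum_(i < size p) p`_i * t i -
    \sum_(i < size p) p`_i * semicircle_moment R i| <=
    \sum_(i < size p) `|p`_i| * `|t i - semicircle_moment R i|.
  rewrite -sumrB; apply: (le_trans (ler_norm_sum _ _ _)).
  by apply: ler_sum => i _; rewrite -mulrBr normrM.
rewrite pE in h1; move: h1 h2 h3; rewrite -/(t r).
rewrite !ler_norml; move: (\sum_(i < _) _) (\sum_(i < _) _) (\sum_(i < _) _).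
move: (_^-1 * _) (scmean f) (t r) (semicircle_moment R r) => ????.
move=> ???; rewrite mulrDr mulr2n; lra.
Qed.

End WeakConvergence.

Theorem theorem1p1 (R : realType) (d : forall n : nat, 'I_n -> nat)
    (d_gt0 : forall (n : nat) (i : 'I_n), (0 < d n i)%N)
    (D_even : forall n : nat, ~~ odd (total_degree (d n)))
    (min_degree_large :
      (fun n : nat => (min_degree (d n))%:R
                      / Num.sqrt ((total_degree (d n))%:R / n%:R) : R)
        @ \oo --> +oo) :
  (forall k : nat, (0 < k)%N ->
    (fun n : nat => n%:R^-1 *
       expectation_cm (d n) (fun m => \tr (normalized_laplacian R m ^+ k)))
      @ \oo --> (if odd k then 0 else catalan R k./2)) /\
  (forall f : R -> R, continuous f -> bounded_fun f ->
   forall eps : R, 0 < eps ->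
    (fun n : nat => prob_cm (d n) R (fun m =>
       `| \int[empirical_spectral_distribution (normalized_laplacian R m)]_x f x
          - \int[semicircle R]_x f x | > eps))
      @ \oo --> (0 : R)).
Proof.
have cvg_moment := mean_spectral_moment_cvg d_gt0 D_even min_degree_large.
split=> [k _|f cf bf eps eps0].
  apply/subr_cvg0; apply: (vanishing_cvg _ (cvg_moment k)); exists 0%N => n _.
  rewrite expectation_cmE -meanZ.
  rewrite -[X in _ - X](mean_cst (semicircle_moment R k) (card_matching_gt0 D_even n)).
  rewrite -meanB; apply: (le_trans (ler_norm_mean _)).
  apply: ler_mean => g; rewrite normalized_laplacian_edges//.
  by rewrite mulrC.
have [B fB] : exists B, forall x, `|f x| <= B.
  have [B [_ fB]] := bf; exists (B + 1) => x.
  by apply: fB => //; rewrite ltrDl.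
set err := fun n (m : {set {set half_edge (d n)}}) =>
  `|\int[empirical_spectral_distribution (normalized_laplacian R m)]_x f x
     - \int[semicircle R]_x f x|.
pose u n := mean (fun g : matching (half_edge (d n)) => err n (edges g)).
(* Markov's inequality reduces convergence in probability to convergence in mean. *)
suff vu : vanishing u.
  apply: (vanishing_cvg _ (vanishingZ (ltW (_ : 0 < eps^-1)) vu)); last by rewrite invr_gt0.
  exists 0%N => n _; rewrite prob_cmE -meanZ ger0_norm; last exact: mean_ge0.
  apply: ler_mean => g; rewrite -/(err n (edges g)).
  rewrite mulrC ler_pdivlMr//; case: ltP => [h|_]; first by rewrite mul1r ltW.
  by rewrite mul0r normr_ge0.
apply: vanishing_approx => dl dl0.
have [p [C C0 [m pP]]] := polynomial_approx cf fB (divr_gt0 dl0 (ltr0n R 4)).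
(* The tail involves the sum of the empirical and semicircle moments of order [r.*2], that is, their
   difference plus twice the latter; hence the factor 2. The approximation error [dl / 4] also
   counts twice, leaving [dl / 2] for this term. *)
have [r mr Cr] : exists2 r, (m <= r)%N & 2 * C * (4 / 9) ^+ r <= dl / 2.
  have z1 : `|4 / 9 : R| < 1 by rewrite ger0_norm//; lra.
  have C2 : 0 <= 2 * C by rewrite mulr_ge0.
  have [N NP] := vanishingZ C2 (expr_ratio_vanishing z1) (divr_gt0 dl0 (ltr0n R 2)).
  by exists (maxn m N); [exact: leq_maxl|exact/NP/leq_maxr].
pose w j n := mean (fun g : matching (half_edge (d n)) =>
  `|tau (tag : half_edge (d n) -> 'I_n) (d n)
      (Num.sqrt ((total_degree (d n))%:R / n%:R)) j g - semicircle_moment R j|).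
have c0 : 0 <= C / 9 ^+ r by rewrite divr_ge0// exprn_ge0.
exists (fun n => C / 9 ^+ r * w r.*2 n + \sum_(i < size p) `|p`_i| * w i n).
  apply: vanishingD; first by apply: vanishingZ => //; exact: cvg_moment.
  by apply: vanishing_sum => i; apply: vanishingZ => //; exact: cvg_moment.
exists 1%N => n n0; rewrite /w -meanZ.
under eq_bigr do rewrite -meanZ.
rewrite -mean_sum -meanD -[dl](mean_cst dl (card_matching_gt0 D_even n)) -meanD.
apply: ler_mean => g; rewrite /err normalized_laplacian_edges//.
apply: le_trans (spectral_integral_error n0 (lapm_sym _ _ _ g) cf fB (pP r mr)) _.
rewrite -/(tau _ _ _ _ g) addrA lerD2r.
have /andP[s0 s4] := semicircle_moment_even_le R r.
have scr : C / 9 ^+ r * semicircle_moment R r.*2 <= C * (4 / 9) ^+ r.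
  by rewrite expr_div_n mulrA mulrAC ler_wpM2r ?invr_ge0 ?exprn_ge0// ler_wpM2l.
have key (x y z t q : R) : 2 * q <= x / 2 -> y - z <= t -> z <= q ->
    x / 4 *+ 2 + (y + z) <= x + t by rewrite [x / 4 *+ 2]mulr2n; lra.
rewrite mulrDr; apply: key scr; first by rewrite mulrA.
by rewrite -mulrBr ler_wpM2l// ler_norm.
Qed.
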